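(* Fix $x\in\Sigma$. Assume that $\mathscr A(x)=\{j\in S:x_j=0\}\ne\varnothing$, set $B=S\setminus\mathscr A(x)$, and assume $|B|\ge 2$. Let $\mathbb P_x$ be the unique solution of the $(\mathfrak L,\mathcal D_S)$-martingale problem with starting point $x$. Denote by $\mathbb P^B_x$ the restriction of $\mathbb P_x$ to $C(\mathbb R_+,\Sigma_B)$. Then the measure $\mathbb P^B_x$ solves the $(\mathfrak L^B,\mathcal D^B_B)$-martingale problem.
   Context: Markov chain. $S=\{1,\dots,p\}$, $p\ge 2$; $r:S\times S\to[0,\infty)$, $r(i,i)=0$, are the jump rates of an irreducible continuous-time Markov chain $(x_t)$ on $S$ with holding rates $\lambda_i=\sum_jr(i,j)$, unique stationary probability $(m_i)_{i\in S}$, and law $\mathbb P_j$ when started from $j\in S$. $(e_i)$ is the canonical basis of $\mathbb R^S$; $b\ge1$ is a fixed real number. Trace process. For $B\subset S$ with $|B|\ge2$, the trace of the chain on $B$ has jump rates $r^B(j,k)=\lambda_j\mathbb P_j[T_k=T_B^+]$, $j\ne k\in B$, $r^B(j,j)=0$, where $T_k$ is the hitting time of $k$ and $T_B^+$ is the return time to $B$ (first time at or after the first jump that the chain is in $B$). For $B=S$, $r^S=r$. Set $v^B_j:=\sum_{k\in B}r^B(j,k)(e_k-e_j)$, $j\in B$. Function spaces. $\Sigma:=\{x\in\mathbb R^S:x_i\ge0,\ \sum_ix_i=1\}$; $\Sigma_B:=\{x\in\Sigma:\sum_{j\in B}x_j=1\}$; $\mathring\Sigma_B:=\{x\in\Sigma_B:x_j>0\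 \forall j\in B\}$; $T_{\Sigma_B}:=\{V\in\mathbb R^S:\sum_{j\in B}V_j=0,\ V_i=0\ \forall i\notin B\}$. For $V\in T_{\Sigma_B}$, $\nabla_Vf$ is the directional derivative on $\mathring\Sigma_B$. $C^1(\Sigma_B)$: functions $f\in C(\Sigma_B)$, continuously differentiable on $\mathring\Sigma_B$ (open subset of its affine hull), with $\nabla_Vf$ extending continuously to $\Sigma_B$ for all $V\in T_{\Sigma_B}$. $C^2(\Sigma_B)$: functions $f\in C^1(\Sigma_B)$, $C^2$ on $\mathring\Sigma_B$, with $\nabla_V\nabla_Wf$ extending continuously to $\Sigma_B$ for all $V,W\in T_{\Sigma_B}$. Extensions are denoted by the same symbols. Operators. For $B\subset S$, $|B|\ge2$, $\mathcal D^B_B$ is the set of $H\in C^2(\Sigma_B)$ such that for every $j\in B$ the map $x\mapsto\mathbf 1\{x_j>0\}\frac{m_j}{x_j}(\nabla_{v^B_j}H)(x)$ is continuous on $\Sigma_B$. For $F\in\mathcal D^B_B$, $x\in\Sigma_B$, $$(\mathfrak L^BF)(x):=b\sum_{j\in B}\frac{m_j}{x_j}\mathbf 1\{x_j>0\}(\nabla_{v^B_j}F)(x)+\frac12\sum_{j,k\in B}m_jr^B(j,k)[\nabla_{e_j-e_k}(\nabla_{e_j-e_k}F)](x).$$ $\mathcal D_S:=\mathcal D^S_S$ and $\mathfrak L:=\mathfrak L^S$. Martingale problem. $C(\mathbb R_+,\Sigma_B)$ is the space of continuous $\Sigma_B$-valued trajectories with coordinate maps $X_t$ and natural filtration. A probability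 measure on $C(\mathbb R_+,\Sigma_B)$ solves the $(\mathfrak L^B,\mathcal D^B_B)$-martingale problem if $H(X_t)-\int_0^t(\mathfrak L^BH)(X_s)ds$ is a martingale for every $H\in\mathcal D^B_B$; for $B=S$ this is the $(\mathfrak L,\mathcal D_S)$-martingale problem, which has, for each $x\in\Sigma$, a unique solution $\mathbb P_x$ with $\mathbb P_x[X_0=x]=1$. It is a fact that, with $B=S\setminus\mathscr A(x)$, $\mathbb P_x$ is concentrated on $C(\mathbb R_+,\Sigma_B)$; $\mathbb P^B_x$ is the probability measure $\mathbb P^B_x(\Xi):=\mathbb P_x(\Xi)$, $\Xi\subset C(\mathbb R_+,\Sigma_B)$ measurable. *)

(* Defs.v *)
From HB Require Import structures.
From mathcomp Require Import all_boot all_order all_algebra.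
From mathcomp Require Import all_classical all_reals all_analysis.

Set Implicit Arguments.
Unset Strict Implicit.
Unset Printing Implicit Defensive.

Import Order.TTheory GRing.Theory Num.Theory.
Import numFieldNormedType.Exports.

Local Open Scope classical_set_scope.
Local Open Scope ring_scope.

Section markov_chain.
Context (R : realType) (p : nat).
Implicit Types (r : 'I_p -> 'I_p -> R) (m : 'I_p -> R) (B : {set 'I_p}).

Definition irreducible_rates r : Prop :=
  forall i j, connect [rel k l | 0 < r k l] i j.

Definition holding_rate r (i : 'I_p) : R := \sum_j r i j.

Definition stationary r m : Prop :=
  [/\ forall i, 0 <= m i,
      \sum_i m i = 1
    & forall j, \sum_i m i * r i j = m j * holding_rate r j].

Context (d : measure_display) (Omega : measurableType d).
Implicit Types (P : 'I_p -> probability Omega R) (X : R -> Omega -> 'I_p).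
Implicit Types (Y : nat -> Omega -> 'I_p) (tau : nat -> Omega -> R).

(* Under every [P j], the process [X] (indexed by times [t >= 0]) is the chain
   with rates [r] started from [j], described by its jump chain [Y] and its
   holding times [tau]: [Y] starts at [j] and jumps with probabilities
   [r k l / holding_rate r k]; given [Y], the holding times are independent and
   exponential with parameters [holding_rate r (Y n)]. The paths are
   right-continuous with finitely many jumps on bounded intervals. *)
Definition markov_chain r P X : Prop :=
  exists Y tau,
    [/\ (forall n i, measurable (Y n @^-1` [set i])) /\
          (forall n, measurable_fun [set: Omega] (tau n)),
        (forall n w, Y n.+1 w <> Y n w) /\ (forall n w, 0 < tau n w),
        forall w (t : R), exists n, t < \sum_(k < n) tau k w,
        forall n w t, \sum_(k < n) tau k w <= t < \sum_(k < n.+1) tau k w ->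
          X t w = Y n w
      & forall (j : 'I_p) n (i : nat -> 'I_p) (t : nat -> R),
          (forall k, 0 <= t k) ->
          P j [set w | forall k, (k <= n)%N -> Y k w = i k /\ t k < tau k w] =
          ((i 0%N == j)%:R *
           \prod_(k < n) (r (i k) (i k.+1) / holding_rate r (i k)) *
           \prod_(k < n.+1) expR (- (holding_rate r (i k) * t k)))%:E].

Definition hitting_time X (k : 'I_p) (w : Omega) : \bar R :=
  ereal_inf [set t%:E | t in [set t | 0 <= t /\ X t w = k]].

Definition first_jump_time X (w : Omega) : \bar R :=
  ereal_inf [set t%:E | t in [set t | 0 <= t /\ X t w <> X 0 w]].

Definition return_time X B (w : Omega) : \bar R :=
  ereal_inf [set t%:E | t in
    [set t | [/\ 0 <= t, (first_jump_time X w <= t%:E)%E & X t w \in B]]].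

(* The rate [r^B(j, k)] of the trace process, meaningful for [j, k \in B]. *)
Definition trace_rate r P X B (j k : 'I_p) : R :=
  if j == k then 0 else
  holding_rate r j * fine (P j [set w | hitting_time X k w = return_time X B w]).

End markov_chain.

Section function_spaces.
Context (R : realType) (p : nat).
Implicit Types (B : {set 'I_p}) (V W x : 'rV[R]_p) (f : 'rV[R]_p -> R).

Definition simplex : set 'rV[R]_p :=
  [set x | (forall i, 0 <= x 0 i) /\ \sum_i x 0 i = 1].

Definition face B : set 'rV[R]_p :=
  [set x | simplex x /\ \sum_(j in B) x 0 j = 1].

Definition open_face B : set 'rV[R]_p :=
  [set x | face B x /\ forall j, j \in B -> 0 < x 0 j].

Definition face_tangent B : set 'rV[R]_p :=
  [set V | \sum_(j in B) V 0 j = 0 /\ forall i, i \notin B -> V 0 i = 0].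

Definition extends_continuously B f : Prop :=
  exists2 g : 'rV[R]_p -> R, {within face B, continuous g} &
    forall x, open_face B x -> g x = f x.

(* Value at [x \in face B] of the continuous extension to [face B] of the
   restriction of [f] to the dense subset [open_face B]. *)
Definition face_extension B f x : R :=
  lim (f @ within (open_face B) (nbhs x)).

(* Functions on [face B] are represented by functions on R^S. If [x] is in
   [open_face B] and [V] in [face_tangent B], the segment [x + h *: V] stays in
   [open_face B] for small [h], so that [derive f x V] only involves the values
   of [f] on [face B]. *)
Definition dirder f V x : R := derive f x V.

Definition face_C1 B f : Prop :=
  {within face B, continuous f} /\
  forall V, face_tangent B V ->
    (forall x, open_face B x -> derivable f x V) /\
    extends_continuously B (dirder f V).

Definition face_C2 B f : Prop :=
  face_C1 B f /\
  forall V W, face_tangent B V -> face_tangent B W ->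
    (forall x, open_face B x -> derivable (dirder f W) x V) /\
    extends_continuously B (dirder (dirder f W) V).

Definition nabla B V f x : R := face_extension B (dirder f V) x.

Definition nabla2 B V W f x : R :=
  face_extension B (dirder (dirder f W) V) x.

End function_spaces.

Section generator.
Context (R : realType) (p : nat).
Context (b : R) (m : 'I_p -> R) (rB : 'I_p -> 'I_p -> R) (B : {set 'I_p}).
Implicit Types (F H : 'rV[R]_p -> R) (x : 'rV[R]_p).

Definition basis_vec (i : 'I_p) : 'rV[R]_p := delta_mx 0 i.

Definition drift_vec (j : 'I_p) : 'rV[R]_p :=
  \sum_(k in B) rB j k *: (basis_vec k - basis_vec j).

Definition drift_term (j : 'I_p) H x : R :=
  (0 < x 0 j)%R%:R * (m j / x 0 j) * nabla B (drift_vec j) H x.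

Definition domain H : Prop :=
  face_C2 B H /\
  forall j, j \in B -> {within face B, continuous (drift_term j H)}.

Definition generator F x : R :=
  b * (\sum_(j in B) drift_term j F x) +
  2^-1 * \sum_(j in B) \sum_(k in B) m j * rB j k *
    nabla2 B (basis_vec j - basis_vec k) (basis_vec j - basis_vec k) F x.

End generator.

(* A trajectory indexed by R_+ is represented by its unique extension to R that
   is constant on the negative half-line; it is continuous on R_+ if and only
   if this extension is continuous on R. *)
Definition trajectories (R : realType) (p : nat) (B : {set 'I_p}) :
    set (R -> 'rV[R]_p) :=
  [set w : R -> 'rV[R]_p | [/\ continuous w,
    forall t, t <= 0 -> w t = w 0 & forall t, face B (w t)]].

Lemma trajectories_nonempty (R : realType) (p : nat) (B : {set 'I_p}) :
  (1 < #|B|)%N -> exists w, w \in @trajectories R p B.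
Proof.
move=> /ltnW /card_gt0P[j jB]; exists (fun=> delta_mx 0 j).
have d0 i : (delta_mx 0 j : 'rV[R]_p) 0 i = (i == j)%:R by rewrite mxE.
apply/mem_set; split => //; first by move=> t; exact: cvg_cst.
move=> _; split; first split.
- by move=> i; rewrite d0.
- rewrite (bigD1 j) //= d0 eqxx big1 ?addr0 // => i ij.
  by rewrite d0 (negbTE ij).
- rewrite (bigD1 j) //= d0 eqxx big1 ?addr0 // => i /andP[_ ij].
  by rewrite d0 (negbTE ij).
Qed.

(* The condition [1 < #|B|] makes the type inhabited, as [measurableType]
   requires. *)
Definition path_type (R : realType) (p : nat) (B : {set 'I_p})
  (hB : (1 < #|B|)%N) : Type := set_type (@trajectories R p B).

HB.instance Definition _ R p B hB := Choice.on (@path_type R p B hB).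
HB.instance Definition _ R p B hB :=
  isPointed.Build (@path_type R p B hB) (cid (@trajectories_nonempty R p B hB)).

Section path_space.
Context (R : realType) (p : nat) (B : {set 'I_p}) (hB : (1 < #|B|)%N).

Definition path_at (t : R) (w : path_type R hB) : 'rV[R]_p := sval w t.

(* The sigma-algebra generated by this family is sigma(X_t : t in T), for the
   Borel sigma-algebra of R^S. *)
Definition path_events (T : set R) : set (set (path_type R hB)) :=
  [set A | exists2 t, T t &
           exists2 U : set 'rV[R]_p, open U & A = path_at t @^-1` U].

Definition path_space := g_sigma_algebraType (path_events `[0, +oo[).

Definition natural_filtration (t : R) : set (set path_space) :=
  <<s path_events `[0, t] >>.

End path_space.

Arguments path_at {R p B} hB t w.
Arguments path_space R {p B} hB.
Arguments natural_filtration R {p B} hB t.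

Definition martingale (R : realType) (d : measure_display)
    (T : measurableType d) (P : probability T R) (F : R -> set (set T))
    (M : R -> T -> R) : Prop :=
  [/\ forall t, 0 <= t -> forall A, measurable A -> F t (M t @^-1` A),
      forall t, 0 <= t -> P.-integrable [set: T] (EFin \o M t)
    & forall s t, 0 <= s <= t -> forall A, F s A ->
        (\int[P]_(w in A) (M t w)%:E = \int[P]_(w in A) (M s w)%:E)%E].

Definition solves_martingale_problem (R : realType) (p : nat)
    (B : {set 'I_p}) (hB : (1 < #|B|)%N)
    (L : ('rV[R]_p -> R) -> 'rV[R]_p -> R) (D : ('rV[R]_p -> R) -> Prop)
    (P : probability (path_space R hB) R) : Prop :=
  forall H, D H ->
    martingale P (natural_filtration R hB)
      (fun t w => H (path_at hB t w) -
         \int[lebesgue_measure]_(s in `[0, t]) L H (path_at hB s w)).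

Definition inclusion_image (R : realType) (p : nat) (B C : {set 'I_p})
    (hB : (1 < #|B|)%N) (hC : (1 < #|C|)%N) (Xi : set (path_space R hB)) :
    set (path_space R hC) :=
  [set w | exists2 w', Xi w' & sval w' = sval w].

(* As [PB] is a probability, this includes that [P] is concentrated on the
   trajectories in [face B]. *)
Definition is_restriction (R : realType) (p : nat) (B C : {set 'I_p})
    (hB : (1 < #|B|)%N) (hC : (1 < #|C|)%N)
    (P : probability (path_space R hC) R)
    (PB : probability (path_space R hB) R) : Prop :=
  forall Xi : set (path_space R hB), measurable Xi ->
    PB Xi = P (inclusion_image (hC := hC) Xi).

Definition zero_set (R : realType) (p : nat) (x : 'rV[R]_p) : {set 'I_p} :=
  finset (fun j => x 0 j == 0).

Lemma card_full (p : nat) : (2 <= p)%N -> (1 < #|finset.setT : {set 'I_p}|)%N.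
Proof. by rewrite cardsT card_ord. Qed.

(* Main.v *)
(* A function F in the domain of the generator on the face is the bounded limit,
   together with its image under the generator, of functions of the full domain.
   Let P be the jump matrix of the chain, and let row l of L be the law of the
   first point of B visited from l. For a small scale e, let a = lcp x be the
   least a >= 0 with a_j >= ramp e (x_j - (a P)_j): a linear complementarity
   problem, smoothed so that a is C2 in x. Then x - a (P - 1) has all its
   coordinates at least e, and it is constant in the direction of row j of P - 1
   where x_j <= e. So H_e(x) = F((x - a (P - 1)) L) has vanishing drift terms near
   the boundary, and belongs to the full domain. The matrix L kills the rows of
   P - 1 outside B and maps those in B to the drifts of the trace chain; on
   the face, the corrections due to a live where some x_j is of order e, and
   there the derivative of F along the drift of j is O(x_j), by the definition
   of the domain. The second order terms agree because the trace of the chain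
   has the same Dirichlet form on the functions that are harmonic off B.
   Finally P_x is the image of P^B_x under the inclusion of path spaces, and the
   martingale property passes to bounded limits. *)
Require Import Defs.
From mathcomp Require Import all_boot all_order all_algebra.
From mathcomp Require Import all_classical all_reals all_analysis.
From mathcomp Require Import measurable_realfun ring lra.

Set Implicit Arguments.
Unset Strict Implicit.
Unset Printing Implicit Defensive.

Import Order.TTheory GRing.Theory Num.Theory.
Import numFieldNormedType.Exports.

Local Open Scope classical_set_scope.
Local Open Scope ring_scope.

(** The obstacle is the domain. The full generator divides the derivative along the drift of j by
    x_j at every state, and near a corner several coordinates are small at once: modifying F for one
    of them changes the derivatives along the other drifts. The complementarity problem, a smoothed
    reflection along the rows of P - 1, treats all coordinates together. It is solvable although P
    is stochastic: w - w P sums to zero, so no strict supersolution exists on all of S, but some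
    coordinate of a point of the simplex is at least 1/p, its constraint is inactive for small e,
    and a supersolution off that one state suffices. Hence one barrier for each state. The second
    derivatives of a are of order 1/e and multiply derivatives of F along drifts, which are O(e)
    where the correction acts. The product is thus only bounded. It tends to zero at each point
    because the quotient of such a derivative by x_j is continuous and zero at x_j = 0; this bounded
    pointwise convergence is all that dominated convergence needs. *)

Section row_norm.
Context {R : realType} {p : nat}.
Implicit Types (u v : 'rV[R]_p).

Lemma rV_coord_le u j : `|u 0 j| <= `|u|.
Proof.
rewrite /Num.norm/= mx_normrE.
exact: (@le_bigmax _ _ _ 0 (fun i => `|u i.1 i.2|) (0, j)).
Qed.

Lemma rV_norm_le u c : 0 <= c -> (forall j, `|u 0 j| <= c) -> `|u| <= c.
Proof.
move=> c0 h; rewrite /Num.norm/= mx_normrE; apply/bigmax_leP; split => //.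
by case=> i j _ /=; rewrite (ord1 i).
Qed.

Lemma rV_mulmx_le (M : 'M[R]_p) c u : 0 <= c ->
  (forall i j, `|M i j| <= c) -> `|u *m M| <= p%:R * c * `|u|.
Proof.
move=> c0 Mc.
apply: rV_norm_le => [|j]; first by rewrite !mulr_ge0.
rewrite mxE; apply: (le_trans (ler_norm_sum _ _ _)).
apply: (@le_trans _ _ (\sum_(k < p) c * `|u|)).
  by apply: ler_sum => k _; rewrite normrM mulrC ler_pM// rV_coord_le.
by rewrite sumr_const card_ord -mulrA mulr_natl.
Qed.

End row_norm.

(** * Directional derivatives from quantitative error bounds *)

Section derivatives.
Context {R : realType}.

(** The derivatives of the correction come from Taylor bounds: a quadratic remainder along the line
    gives both derivability and the value. *)
Lemma is_derive_linear_error (V : normedModType R) (f : V -> R) (x v : V) l C d :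
  0 < d ->
  (forall h : R, 0 < `|h| < d -> `|f (h *: v + x) - f x - h * l| <= C * `|h| ^+ 2) ->
  is_derive x v f l.
Proof.
move=> d0 hf.
suff H : h^-1 *: ((f \o shift x) (h *: v) - f x) @[h --> 0^'] --> l.
  by split; [apply/cvg_ex; exists l | exact/cvg_lim].
apply/subr_cvg0; apply: (@cvg_to_0_linear _ _ C d) => // h /andP[h0 hd].
have hn0 : h != 0 by rewrite -normr_gt0.
have -> : h^-1 *: ((f \o shift x) (h *: v) - f x) - l
    = h^-1 * (f (h *: v + x) - f x - h * l) by rewrite [RHS]mulrBr mulKf.
rewrite normrM normfV ler_pdivrMl// mulrCA -expr2.
by apply: hf; rewrite h0.
Qed.

Lemma cvg_within_linear_error (V : normedModType R) (A : set V) (f : V -> R) x c d :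
  0 < d -> (forall y, A y -> `|y - x| <= d -> `|f y - f x| <= c * `|y - x|) ->
  f @ within A (nbhs x) --> f x.
Proof.
move=> d0 hf; apply/cvgrPdist_le => eps eps0.
(* [c] may be zero or negative; [c'] is positive and can divide [eps]. *)
pose c' := Num.max 1 c.
have c'0 : 0 < c' by rewrite lt_max ltr01.
have e0 : 0 < Num.min d (eps / c') by rewrite lt_min d0 divr_gt0.
rewrite near_withinE; near=> y => Ay.
have : `|y - x| <= Num.min d (eps / c').
  by near: y; apply/nbhs_normP; exists (Num.min d (eps / c')) => //= y /=;
    rewrite distrC => /ltW.
rewrite le_min ler_pdivlMr// => /andP[yd ye].
rewrite distrC; apply: le_trans (hf y Ay yd) _; apply: le_trans ye; rewrite mulrC.
by rewrite ler_wpM2l// le_max lexx orbT.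
Unshelve. all: by end_near. Qed.

Lemma cvg_bigsum (T I : Type) (G : set_system T) {FG : Filter G} (s : seq I) (Q : pred I)
    (f : I -> T -> R) (l : I -> R) :
  (forall i, Q i -> f i t @[t --> G] --> l i) ->
  \sum_(i <- s | Q i) f i t @[t --> G] --> \sum_(i <- s | Q i) l i.
Proof.
move=> h; elim: s => [|i s IHs].
  by rewrite big_nil; under eq_fun do rewrite big_nil; exact: cvg_cst.
rewrite big_cons; under eq_fun do rewrite big_cons.
by case: (boolP (Q i)) => Qi //; apply: cvgD => //; exact: h.
Qed.

Lemma is_derive_bigsum (V : normedModType R) (I : Type) (s : seq I) (Q : pred I)
    (f : I -> V -> R) (x v : V) (l : I -> R) :
  (forall i, Q i -> is_derive x v (f i) (l i)) ->
  is_derive x v (fun z => \sum_(i <- s | Q i) f i z) (\sum_(i <- s | Q i) l i).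
Proof.
move=> h; elim: s => [|i s IHs].
  by rewrite big_nil; under eq_fun do rewrite big_nil; exact: is_derive_cst.
rewrite big_cons; under eq_fun do rewrite big_cons.
case: (boolP (Q i)) => Qi //.
exact: (@is_deriveD _ _ _ (f i) (fun z => \sum_(j <- s | Q j) f j z) x v _ _ (h i Qi) IHs).
Qed.

Lemma is_derive_mul (V : normedModType R) (f g : V -> R) (x v : V) (df dg : R) :
  is_derive x v f df -> is_derive x v g dg ->
  is_derive x v (fun z => f z * g z) (f x * dg + df * g x).
Proof.
by move=> hf hg; have := @is_deriveM _ _ f g x v df dg hf hg; rewrite [df * _]mulrC.
Qed.

Lemma is_derive_cmul (V : normedModType R) (c : R) (f : V -> R) (x v : V) (df : R) :
  is_derive x v f df -> is_derive x v (fun z => c * f z) (c * df).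
Proof. by move=> hf; exact: (@is_deriveZ _ _ _ f c x v df hf). Qed.

Lemma MVT_global (f df : R -> R) : (forall x : R, is_derive x 1 f (df x)) ->
  forall a b, exists c, f b - f a = df c * (b - a).
Proof.
move=> fdf a b.
have cf i : {within [set` i : interval R], continuous f}.
  by apply: derivable_within_continuous => x _; have := fdf x; case.
have [ab|ba] := leP a b.
  by have [c _ ?] := MVT_segment ab (fun x _ => fdf x) (cf _); exists c.
have [c _ E] := MVT_segment (ltW ba) (fun x _ => fdf x) (cf _); exists c.
by rewrite -opprB E -mulrN opprB.
Qed.

End derivatives.

(** * A smoothing of the positive part *)

Section smooth_ramp.
Context {R : realType}.
Implicit Types (e s t : R).

Let pos t : R := Num.max 0 t.

Let posP t : (0 <= t /\ pos t = t) \/ (t <= 0 /\ pos t = 0).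
Proof. by rewrite /pos; case: (ltrP 0 t) => h; [left|right]; split => //; exact: ltW. Qed.

Let pos_lip s t : `|pos t - pos s| <= `|t - s|.
Proof.
rewrite ler_norml; case: (posP t) => -[? ->]; case: (posP s) => -[? ->];
have := ler_norm (t - s); have := ler_norm (- (t - s)); rewrite normrN; intros; apply/andP; split; lra.
Qed.

Let pos2_taylor s t : `|pos t ^+ 2 - pos s ^+ 2 - 2 * pos s * (t - s)| <= (t - s) ^+ 2.
Proof.
have := sqr_ge0 (t - s); have := sqr_ge0 t; rewrite ler_norml.
by case: (posP t) => -[? ->]; case: (posP s) => -[? ->]; intros; apply/andP; split; nra.
Qed.

Let pos3_taylor s t :
  `|pos t ^+ 3 - pos s ^+ 3 - 3 * pos s ^+ 2 * (t - s) - 3 * pos s * (t - s) ^+ 2|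
    <= `|t - s| ^+ 3.
Proof.
set X := (X in `|X|).
(* In each of the four sign cases the remainder lies between 0 and (t - s)^3. *)
suff : X = (t - s) ^+ 3 \/ (0 <= X <= (t - s) ^+ 3) \/ ((t - s) ^+ 3 <= X <= 0).
  rewrite -normrX; move: X ((t - s) ^+ 3) => X Y [->//|[] /andP[h1 h2]].
    by rewrite !ger0_norm// (le_trans h1).
  by rewrite !ler0_norm ?lerN2// (le_trans h1).
rewrite /X {X}; case: (posP t) => -[ht ->]; case: (posP s) => -[hs ->].
- by left; ring.
- right; left; have := exprn_ge0 3 ht.
  have : t ^+ 3 <= (t - s) ^+ 3 by rewrite lerXn2r ?nnegrE ?subr_ge0 //; lra.
  move: (t ^+ 3) ((t - s) ^+ 3); intros; lra.
- right; right.
  have -> : 0 ^+ 3 - s ^+ 3 - 3 * s ^+ 2 * (t - s) - 3 * s * (t - s) ^+ 2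
            = (t - s) ^+ 3 + (- t) ^+ 3 by ring.
  have -> : (t - s) ^+ 3 = - (s - t) ^+ 3 by ring.
  have : 0 <= (- t) ^+ 3 by rewrite exprn_ge0//; lra.
  have : (- t) ^+ 3 <= (s - t) ^+ 3 by rewrite lerXn2r ?nnegrE ?subr_ge0 //; lra.
  move: ((- t) ^+ 3) ((s - t) ^+ 3); intros; lra.
- right; case: (lerP 0 (t - s)) => ts; [left|right].
    have := exprn_ge0 3 ts; move: ((t - s) ^+ 3); intros; lra.
  have -> : (t - s) ^+ 3 = - (s - t) ^+ 3 by ring.
  have : 0 <= (s - t) ^+ 3 by rewrite exprn_ge0//; lra.
  move: ((s - t) ^+ 3); intros; lra.
Qed.

(** A second difference of step e of u_+^3 / 6, divided by e^2: the convolution of (2 e - s)_+ with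
    the hat function supported in [-e, e]. It is C2, equals 2 e - s for s <= e and vanishes for s >=
    3 e. Locking prevents its unfolding. *)
Definition ramp e s : R :=
  locked ((pos (3 * e - s) ^+ 3 - 2 * pos (2 * e - s) ^+ 3 + pos (e - s) ^+ 3) / (6 * e ^+ 2)).

Definition ramp' e s : R :=
  locked (- (pos (3 * e - s) ^+ 2 - 2 * pos (2 * e - s) ^+ 2 + pos (e - s) ^+ 2) / (2 * e ^+ 2)).

Definition ramp'' e s : R :=
  locked ((pos (3 * e - s) - 2 * pos (2 * e - s) + pos (e - s)) / e ^+ 2).

Lemma ramp_lin e s : 0 < e -> s <= e -> ramp e s = 2 * e - s /\ ramp' e s = -1.
Proof.
move=> e0 se; rewrite /ramp /ramp' -!lock /pos !max_r; [|lra..].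
have e' : e != 0 by rewrite gt_eqF.
by split; field.
Qed.

Lemma ramp_zero e s : 0 < e -> 3 * e <= s ->
  [/\ ramp e s = 0, ramp' e s = 0 & ramp'' e s = 0].
Proof.
move=> e0 se; rewrite /ramp /ramp' /ramp'' -!lock /pos !max_l; [|lra..].
by rewrite !(expr0n, mulr0, subr0, addr0, oppr0, mul0r).
Qed.

Lemma ramp''_le e s : 0 < e -> `|ramp'' e s| <= e^-1.
Proof.
move=> e0; rewrite /ramp'' -!lock normrM [X in _ * X]gtr0_norm ?invr_gt0 ?exprn_gt0//.
have e' : e != 0 by rewrite gt_eqF.
rewrite ler_pdivrMr ?exprn_gt0// (_ : e^-1 * _ = e); last by field.
rewrite ler_norml; case: (posP (3 * e - s)) => -[? ->];
case: (posP (2 * e - s)) => -[? ->]; case: (posP (e - s)) => -[? ->];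
by apply/andP; split; lra.
Qed.

Lemma ramp'_le e s : 0 < e -> -1 <= ramp' e s <= 0.
Proof.
move=> e0; rewrite /ramp' -!lock.
have e2 : 0 < 2 * e ^+ 2 by rewrite mulr_gt0 ?exprn_gt0.
rewrite ler_pdivlMr// ler_pdivrMr// mul0r.
case: (posP (3 * e - s)) => -[? ->];
case: (posP (2 * e - s)) => -[? ->]; case: (posP (e - s)) => -[? ->];
apply/andP; split; nra.
Qed.

Lemma ramp'_taylor e s t : 0 < e ->
  `|ramp' e t - ramp' e s - ramp'' e s * (t - s)| <= 2 / e ^+ 2 * (t - s) ^+ 2.
Proof.
move=> e0; rewrite /ramp' /ramp'' -!lock.
have e' : e != 0 by rewrite gt_eqF.
set X := (X in `|X|).
set D := fun c => pos (c - t) ^+ 2 - pos (c - s) ^+ 2 - 2 * pos (c - s) * (c - t - (c - s)).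
have h c : `|D c| <= (t - s) ^+ 2.
  have -> : (t - s) ^+ 2 = (c - t - (c - s)) ^+ 2 by ring.
  exact: pos2_taylor.
have -> : X = - (D (3 * e) - 2 * D (2 * e) + D e) / (2 * e ^+ 2).
  by rewrite /X /D; field.
rewrite normrM [X in _ * X]gtr0_norm ?invr_gt0 ?mulr_gt0 ?exprn_gt0//.
rewrite ler_pdivrMr ?mulr_gt0 ?exprn_gt0//.
have -> : 2 / e ^+ 2 * (t - s) ^+ 2 * (2 * e ^+ 2) = 4 * (t - s) ^+ 2 by field.
have := h (3 * e); have := h (2 * e); have := h e.
move: (D _) (D _) (D _) ((t - s) ^+ 2) => d1 d2 d3 q.
rewrite !ler_norml => /andP[? ?] /andP[? ?] /andP[? ?].
by apply/andP; split; lra.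
Qed.

Lemma ramp_taylor e s t : 0 < e -> `|t - s| <= e ->
  `|ramp e t - ramp e s - ramp' e s * (t - s)| <= 2 / e * (t - s) ^+ 2.
Proof.
move=> e0 ts.
have e' : e != 0 by rewrite gt_eqF.
(* The expansions of the cubes have third order remainders; [|t - s| <= e] turns them into second
   order ones with a factor e. *)
have ts3 : `|t - s| ^+ 3 <= e * (t - s) ^+ 2.
  by rewrite exprS real_normK ?num_real// ler_wpM2r ?sqr_ge0.
set D := fun c => pos (c - t) ^+ 3 - pos (c - s) ^+ 3
  - 3 * pos (c - s) ^+ 2 * (c - t - (c - s))
  - 3 * pos (c - s) * (c - t - (c - s)) ^+ 2.
have h c : `|D c| <= e * (t - s) ^+ 2.
  apply: le_trans ts3.
  have -> : `|t - s| = `|c - t - (c - s)| by rewrite distrC; congr `|_|; ring.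
  exact: pos3_taylor.
have h'' : `|ramp'' e s| <= e^-1 by exact: ramp''_le.
have -> : ramp e t - ramp e s - ramp' e s * (t - s) =
    (D (3 * e) - 2 * D (2 * e) + D e) / (6 * e ^+ 2)
    + ramp'' e s * (t - s) ^+ 2 / 2.
  by rewrite /ramp /ramp' /ramp'' -!lock /D; field.
apply: (le_trans (ler_normD _ _)).
have -> : 2 / e * (t - s) ^+ 2 = 3 / 2 / e * (t - s) ^+ 2 + e^-1 * (t - s) ^+ 2 / 2.
  by field.
apply: lerD; last first.
  move: (sqr_ge0 (t - s)) h''; move: ((t - s) ^+ 2) => q q0 h''.
  rewrite normrM [X in _ * X]gtr0_norm ?invr_gt0//.
  rewrite ler_wpM2r ?invr_ge0// normrM (ger0_norm q0).
  exact: ler_wpM2r.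
rewrite normrM [X in _ * X]gtr0_norm ?invr_gt0 ?mulr_gt0 ?exprn_gt0//.
rewrite ler_pdivrMr ?mulr_gt0 ?exprn_gt0//.
have -> : 3 / 2 / e * (t - s) ^+ 2 * (6 * e ^+ 2) = 9 * (e * (t - s) ^+ 2) by field.
have := h (3 * e); have := h (2 * e); have := h e.
have : 0 <= e * (t - s) ^+ 2 by rewrite mulr_ge0 ?sqr_ge0// ltW.
move: (D _) (D _) (D _) (e * (t - s) ^+ 2) => d1 d2 d3 q q0.
rewrite !ler_norml => /andP[? ?] /andP[? ?] /andP[? ?].
by apply/andP; split; lra.
Qed.

Lemma ramp''_lip e s t : 0 < e -> `|ramp'' e t - ramp'' e s| <= 4 / e ^+ 2 * `|t - s|.
Proof.
move=> e0; rewrite /ramp'' -!lock -mulrBl normrM [X in _ * X]gtr0_norm ?invr_gt0 ?exprn_gt0//.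
rewrite mulrAC ler_pM2r ?invr_gt0 ?exprn_gt0//.
have h c : `|pos (c - t) - pos (c - s)| <= `|t - s|.
  have -> : `|t - s| = `|c - t - (c - s)| by rewrite distrC; congr `|_|; ring.
  exact: pos_lip.
have := h (3 * e); have := h (2 * e); have := h e.
rewrite !ler_norml => /andP[? ?] /andP[? ?] /andP[? ?].
by apply/andP; split; lra.
Qed.

Lemma is_derive_ramp e s : 0 < e -> is_derive s 1 (ramp e) (ramp' e s).
Proof.
move=> e0; apply: (@is_derive_linear_error _ _ _ _ _ _ (2 / e) e) => // h /andP[_ he].
rewrite [h *: 1]mulr1 real_normK ?num_real//.
have := @ramp_taylor e s (h + s) e0; rewrite addrK mulrC; apply; exact: ltW.
Qed.

Lemma ramp_MVT e s t : 0 < e -> exists c, ramp e t - ramp e s = ramp' e c * (t - s).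
Proof. by move=> e0; apply: MVT_global => x; exact: is_derive_ramp. Qed.

Lemma ramp_nonincr e s t : 0 < e -> s <= t -> ramp e t <= ramp e s.
Proof.
move=> e0 st; have [c h] := ramp_MVT s t e0.
rewrite -subr_le0 h; have /andP[_ ?] := ramp'_le c e0.
by rewrite mulr_le0_ge0// subr_ge0.
Qed.

Lemma ramp_lip e s t : 0 < e -> s <= t -> ramp e s <= ramp e t + (t - s).
Proof.
move=> e0 st; have [c h] := ramp_MVT s t e0.
have /andP[? _] := ramp'_le c e0; nra.
Qed.

Lemma ramp_dist e s t : 0 < e -> `|ramp e t - ramp e s| <= `|t - s|.
Proof.
move=> e0; have [c ->] := ramp_MVT s t e0.
rewrite normrM ler_piMl// ler_norml; have /andP[? ?] := ramp'_le c e0.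
by apply/andP; split => //; lra.
Qed.

Lemma ramp'_dist e s t : 0 < e -> `|ramp' e t - ramp' e s| <= e^-1 * `|t - s|.
Proof.
move=> e0.
have h (x : R) : is_derive x 1 (ramp' e) (ramp'' e x).
  apply: (@is_derive_linear_error _ _ _ _ _ _ (2 / e ^+ 2) 1) => // k _.
  rewrite [k *: 1]mulr1 real_normK ?num_real//.
  by have := @ramp'_taylor e x (k + x) e0; rewrite addrK mulrC.
have [c ->] := MVT_global h s t.
by rewrite normrM ler_wpM2r// ramp''_le.
Qed.

Lemma ramp_ge0 e s : 0 < e -> 0 <= ramp e s.
Proof.
move=> e0; have [h|h] := leP (3 * e) s; first by have [->] := ramp_zero e0 h.
by have [<- _ _] := ramp_zero e0 (lexx (3 * e)); apply: ramp_nonincr => //; exact: ltW.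
Qed.

Lemma ramp_le e s : 0 < e -> 0 <= s -> ramp e s <= 2 * e.
Proof.
move=> e0 s0; apply: (le_trans (ramp_nonincr e0 s0)).
by rewrite (ramp_lin e0 (ltW e0)).1 subr0.
Qed.

Lemma ramp_add_ge e s : 0 < e -> e <= s + ramp e s.
Proof.
move=> e0; have [h|h] := leP s e.
  by rewrite (ramp_lin e0 h).1; lra.
by have := ramp_ge0 s e0; lra.
Qed.

End smooth_ramp.

Section simplex_basics.
Context {R : realType} {p : nat}.
Implicit Types x : 'rV[R]_p.

Lemma simplex_le1 x i : simplex x -> x 0 i <= 1.
Proof.
move=> [x0 <-]; rewrite (bigD1 i)//= lerDl.
by apply: sumr_ge0 => j _; exact: x0.
Qed.

Lemma simplex_large_coord x : simplex x -> exists i, p%:R^-1 <= x 0 i.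
Proof.
move=> [x0 x1]; apply/not_existsP => h.
have p0 : (0 < p)%N.
  case: (posnP p) => // p0; move: x1; rewrite big1 => [/esym/eqP|[k kp] _]; first by rewrite oner_eq0.
  by exfalso; move: kp; rewrite p0.
suff : \sum_i x 0 i < \sum_(i < p) p%:R^-1.
  by rewrite x1 sumr_const card_ord -[X in _ < X]mulr_natr mulVf ?ltxx// pnatr_eq0 -lt0n.
apply: ltr_sum => [|i _]; last by rewrite ltNge; exact/negP/h.
by apply/hasP; exists (Ordinal p0); rewrite ?mem_index_enum.
Qed.

End simplex_basics.

(** * The smoothed complementarity problem *)

(* [w i] is a supersolution of the equation [u - u P = 1] off [i]. *)
Record barrier (R : realType) (p : nat) (P : 'M[R]_p) (w : 'I_p -> 'rV[R]_p) (C : R) : Prop := Barrier {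
  barrier_P_ge0 : forall i j, 0 <= P i j;
  barrier_P_sum : forall i, \sum_j P i j = 1;
  barrier_P_diag : forall i, P i i = 0;
  barrier_diag : forall i, w i 0 i = 0;
  barrier_super : forall i l : 'I_p, l != i -> 1 + (w i *m P) 0 l <= w i 0 l;
  barrier_ge0 : forall i l, 0 <= w i 0 l;
  barrier_C_ge1 : 1 <= C;
  barrier_le : forall i l, w i 0 l <= C;
  barrier_mul_le : forall i l, (w i *m P) 0 l <= C }.

(** At a coordinate of x that is at least 1/p, the correction a P is at most 2 C e, and [ramp e]
    vanishes from 3 e on, so the constraint there is inactive. The factor 1/2 leaves room for moving
    x. *)
Definition small_scale (R : realType) (p : nat) (C e : R) : Prop :=
  0 < e /\ (2 * C + 3) * e <= p%:R^-1 / 2.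

Section smooth_lcp.
Context {R : realType} {p : nat} (P : 'M[R]_p) (w : 'I_p -> 'rV[R]_p) (C : R).
Hypothesis bar : barrier P w C.

Let P_ge0 := barrier_P_ge0 bar.
Let P_diag := barrier_P_diag bar.
Let w_super := barrier_super bar.
Let w_ge0 := barrier_ge0 bar.
Let C_ge1 := barrier_C_ge1 bar.
Let w_leC := barrier_le bar.
Let wP_leC := barrier_mul_le bar.

Let P_le1 i j : P i j <= 1.
Proof.
rewrite -(barrier_P_sum bar i) (bigD1 j)//= lerDl.
by rewrite sumr_ge0// => k _; exact: P_ge0.
Qed.

Implicit Types (x a u v V W : 'rV[R]_p).

Variable e : R.
Hypothesis e_ok : small_scale p C e.

Let e_gt0 : 0 < e := proj1 e_ok.
Let e_small : (2 * C + 3) * e <= p%:R^-1 / 2 := proj2 e_ok.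

Let pV_ge0 : 0 <= p%:R^-1 :> R. Proof. by rewrite invr_ge0. Qed.

Let C0 : 0 < C. Proof. exact: lt_le_trans C_ge1. Qed.

Lemma mulmx_mono a a' j :
  (forall k, a 0 k <= a' 0 k) -> (a *m P) 0 j <= (a' *m P) 0 j.
Proof. by move=> h; rewrite !mxE; apply: ler_sum => k _; rewrite ler_wpM2r. Qed.

Definition feasible x : set 'rV[R]_p :=
  [set a | forall j, ramp e (x 0 j - (a *m P) 0 j) <= a 0 j].

Lemma feasible_ge0 x a j : feasible x a -> 0 <= a 0 j.
Proof. by move=> /(_ j); apply: le_trans; exact: ramp_ge0. Qed.

(** Comparison step: the argument of [ramp] at j drops by at most d (1 + (w i P)_j), which off i is
    at most d times the coordinate j of [w i] by the supersolution property, and [ramp] is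
    1-Lipschitz. At i the last hypothesis makes [ramp] zero. *)
Lemma feasible_add x x' a i d : feasible x a -> (forall j, x 0 j - x' 0 j <= d) ->
  0 <= d -> 3 * e <= x' 0 i - ((a + d *: w i) *m P) 0 i ->
  feasible x' (a + d *: w i).
Proof.
move=> fa xd d0 h j; have [->|ji] := eqVneq j i.
  have [-> _ _] := ramp_zero e_gt0 h.
  by rewrite !mxE addr_ge0 ?mulr_ge0// (feasible_ge0 i fa).
have E : ((a + d *: w i) *m P) 0 j = (a *m P) 0 j + d * (w i *m P) 0 j.
  by rewrite mulmxDl -scalemxAl !mxE.
have -> : (a + d *: w i) 0 j = a 0 j + d * w i 0 j by rewrite !mxE.
rewrite E.
set q := (w i *m P) 0 j; set b := (a *m P) 0 j.
have q0 : 0 <= q by rewrite /q mxE sumr_ge0// => k _; rewrite mulr_ge0.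
have h1 : ramp e (x' 0 j - (b + d * q)) <= ramp e (x 0 j - b - d * (1 + q)).
  by apply: ramp_nonincr => //; have := xd j; nra.
have h2 : ramp e (x 0 j - b - d * (1 + q)) <= ramp e (x 0 j - b) + d * (1 + q).
  have := @ramp_lip _ e (x 0 j - b - d * (1 + q)) (x 0 j - b) e_gt0.
  by rewrite subKr; apply; nra.
apply: (le_trans h1); apply: (le_trans h2); apply: lerD; first exact: fa.
by rewrite ler_wpM2l// w_super.
Qed.

(** The factor 2 e is the value of [ramp e] at 0, its largest on nonnegative arguments. *)
Lemma feasible_scale x i : simplex x -> p%:R^-1 <= x 0 i -> feasible x ((2 * e) *: w i).
Proof.
move=> [x0 _] xi j; rewrite -scalemxAl !mxE -/((w i *m P) 0 j).
have -> : \sum_j0 w i 0 j0 * P j0 j = (w i *m P) 0 j by rewrite mxE.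
set q := (w i *m P) 0 j.
have q0 : 0 <= q by rewrite /q mxE sumr_ge0// => k _; rewrite mulr_ge0.
have [ji|ji] := eqVneq j i.
  have [-> _ _] : [/\ ramp e (x 0 j - 2 * e * q) = 0,
      ramp' e (x 0 j - 2 * e * q) = 0 & ramp'' e (x 0 j - 2 * e * q) = 0].
    apply: ramp_zero => //; move: xi; rewrite -ji => xi.
    have : q <= C by exact: wP_leC.
    have := e_small; have := pV_ge0; have := e_gt0; nra.
  by rewrite mulr_ge0// mulr_ge0// ltW.
have h2 : ramp e (x 0 j - 2 * e * q) <= ramp e (x 0 j) + 2 * e * q.
  have := @ramp_lip _ e (x 0 j - 2 * e * q) (x 0 j) e_gt0.
  rewrite subKr; apply.
  by rewrite lerBlDr lerDl mulr_ge0// mulr_ge0// ltW.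
apply: (le_trans h2).
have e2 : 0 <= 2 * e by rewrite mulr_ge0// ltW.
have := ramp_le e_gt0 (x0 j); have := ler_wpM2l e2 (w_super ji).
by rewrite -/q mulrDr mulr1; lra.
Qed.

(** The least feasible point, as a coordinatewise infimum. On the simplex the feasible set is
    nonempty; elsewhere it can be empty, and the value is then a default. *)
Definition lcp : 'rV[R]_p -> 'rV[R]_p :=
  locked (fun x => \row_j inf [set a 0 j | a in feasible x]).

Lemma lcpEinf x j : lcp x 0 j = inf [set a 0 j | a in feasible x].
Proof. by rewrite /lcp -lock mxE. Qed.

Lemma lcp_le x a j : feasible x a -> lcp x 0 j <= a 0 j.
Proof.
move=> fa; rewrite lcpEinf; apply: ge_inf; last by exists a.
by exists 0 => _ [a' fa' <-]; exact: feasible_ge0 fa'.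
Qed.

(** [ramp e] is nonincreasing and P is nonnegative, so replacing a feasible point by a smaller
    vector only lowers the left sides of the constraints. *)
Lemma feasible_lcp x a : feasible x a -> feasible x (lcp x).
Proof.
move=> fa j; rewrite [leRHS]lcpEinf; apply: lb_le_inf; first by exists (a 0 j); exists a.
move=> _ [a' fa' <-]; apply: le_trans (fa' j); apply: ramp_nonincr => //.
by rewrite lerB// mulmx_mono// => k; exact: lcp_le.
Qed.

Lemma lcp_eq x a j : feasible x a ->
  lcp x 0 j = ramp e (x 0 j - (lcp x *m P) 0 j).
Proof.
move=> fa; have fl := feasible_lcp fa; apply/eqP; rewrite eq_le fl andbT.
(* Lower the coordinate j to what its constraint requires. As P has zero diagonal, the constraint j
   is unchanged and the others are relaxed; leastness then gives equality. *)
pose a' : 'rV[R]_p := \row_k if k == j then ramp e (x 0 j - (lcp x *m P) 0 j) else lcp x 0 k.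
have a'le k : a' 0 k <= lcp x 0 k by rewrite mxE; case: eqP => // ->.
have fa' : feasible x a'.
  move=> k; have [->|kj] := eqVneq k j.
    rewrite [leRHS]mxE eqxx; suff -> : (a' *m P) 0 j = (lcp x *m P) 0 j by [].
    rewrite !mxE; apply: eq_bigr => l _; rewrite [a' _ _]mxE.
    by case: eqP => // ->; rewrite P_diag !mulr0.
  rewrite [leRHS]mxE (negbTE kj); apply: le_trans (fl k).
  by apply: ramp_nonincr => //; rewrite lerB// mulmx_mono.
by have := lcp_le j fa'; rewrite [leRHS]mxE eqxx.
Qed.

Definition lcpz : 'rV[R]_p -> 'rV[R]_p := locked (fun x => x - lcp x *m P).

Lemma lcpz_def x : lcpz x = x - lcp x *m P.
Proof. by rewrite /lcpz -lock. Qed.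

Lemma lcpzE x j : lcpz x 0 j = x 0 j - (lcp x *m P) 0 j.
Proof. by rewrite lcpz_def [LHS]mxE [X in _ + X]mxE. Qed.

Lemma lcpE x : simplex x -> forall j, lcp x 0 j = ramp e (lcpz x 0 j).
Proof.
move=> sx j; have [i xi] := simplex_large_coord sx.
by rewrite lcpzE -(lcp_eq j (feasible_scale sx xi)).
Qed.

Lemma lcp_bound x i : simplex x -> p%:R^-1 <= x 0 i ->
  forall j, 0 <= lcp x 0 j <= 2 * e * w i 0 j.
Proof.
move=> sx xi j; have f := feasible_scale sx xi.
rewrite (feasible_ge0 j (feasible_lcp f))/=.
by apply: le_trans (lcp_le j f) _; rewrite mxE.
Qed.

Lemma lcpP_bound x i : simplex x -> p%:R^-1 <= x 0 i ->
  forall j, 0 <= (lcp x *m P) 0 j <= 2 * e * C.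
Proof.
move=> sx xi j; apply/andP; split.
  rewrite mxE sumr_ge0// => k _; rewrite mulr_ge0//.
  by case/andP: (lcp_bound sx xi k).
apply: (@le_trans _ _ (((2 * e) *: w i *m P) 0 j)).
  by apply: mulmx_mono => k; rewrite [leRHS]mxE; case/andP: (lcp_bound sx xi k).
by rewrite -scalemxAl [leLHS]mxE ler_wpM2l// mulr_ge0// ltW.
Qed.

Lemma lcpz_large x i : simplex x -> p%:R^-1 <= x 0 i -> 3 * e <= lcpz x 0 i.
Proof.
move=> sx xi; rewrite lcpzE; have := lcpP_bound sx xi i => /andP[_ h].
have := e_small; have := e_gt0; have := pV_ge0; nra.
Qed.

(** Origin of 2 C + 3: a P is at most 2 C e, and [ramp e] vanishes from 3 e on. Above this height
    the correction at j is switched off. *)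
Lemma lcpz_zero x j : simplex x -> (2 * C + 3) * e <= x 0 j -> 3 * e <= lcpz x 0 j.
Proof.
move=> sx xj; have [i xi] := simplex_large_coord sx.
by rewrite lcpzE; have /andP[_] := lcpP_bound sx xi j; lra.
Qed.

Let d0 : R := p%:R^-1 / 2 / (1 + C).

(** Adding |x' - x| [w i] to [lcp x] gives a feasible point for x', which lies above the least one.
    The radius [d0] spends the half of 1/p left free by [small_scale] on keeping the constraint at i
    inactive. *)
Lemma lcp_lip1 x x' : simplex x -> simplex x' -> `|x' - x| <= d0 ->
  forall j, lcp x' 0 j <= lcp x 0 j + `|x' - x| * C.
Proof.
move=> sx sx' xx' j; have [i xi] := simplex_large_coord sx.
set d := `|x' - x| in xx' *.
have dist k : x 0 k - x' 0 k <= d.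
  rewrite /d distrC; apply: le_trans (rV_coord_le _ k); rewrite !mxE; exact: ler_norm.
have f := feasible_lcp (feasible_scale sx xi).
have dC : d * (1 + C) <= p%:R^-1 / 2 by rewrite -ler_pdivlMr// addr_gt0.
have f' : feasible x' (lcp x + d *: w i).
  apply: (feasible_add f) => //; rewrite ?normr_ge0//.
  have -> : ((lcp x + d *: w i) *m P) 0 i = (lcp x *m P) 0 i + d * (w i *m P) 0 i.
    by rewrite mulmxDl -scalemxAl [LHS]mxE [X in _ + X]mxE.
  have /andP[_ h1] := lcpP_bound sx xi i; have h2 := wP_leC i i.
  have h3 := dist i; have d0' : 0 <= d by rewrite normr_ge0.
  have := e_small; have := pV_ge0; nra.
apply: le_trans (lcp_le j f') _.
have -> : (lcp x + d *: w i) 0 j = lcp x 0 j + d * w i 0 j.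
  by rewrite [LHS]mxE [X in _ + X]mxE.
by rewrite lerD2l ler_wpM2l ?normr_ge0.
Qed.

Lemma lcp_lip x x' : simplex x -> simplex x' -> `|x' - x| <= d0 ->
  `|lcp x' - lcp x| <= C * `|x' - x|.
Proof.
move=> sx sx' xx'; apply: rV_norm_le => [|j]; first by rewrite mulr_ge0// ltW.
have h1 := lcp_lip1 sx sx' xx' j; have := lcp_lip1 sx' sx _ j.
rewrite distrC => /(_ xx') h2.
have -> : (lcp x' - lcp x) 0 j = lcp x' 0 j - lcp x 0 j by rewrite !mxE.
by rewrite mulrC ler_norml; apply/andP; split; lra.
Qed.

Let C3 := 1 + p%:R * C.

Lemma lcpz_lip x x' : simplex x -> simplex x' -> `|x' - x| <= d0 ->
  `|lcpz x' - lcpz x| <= C3 * `|x' - x|.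
Proof.
move=> sx sx' xx'.
have -> : lcpz x' - lcpz x = (x' - x) - (lcp x' - lcp x) *m P.
  by rewrite !lcpz_def mulmxBl !opprB addrACA [RHS]addrACA [X in _ = _ + X]addrC.
apply: (le_trans (ler_normB _ _)); rewrite mulrDl mul1r lerD2l.
have P1 i j : `|P i j| <= 1 by rewrite ger0_norm.
apply: (le_trans (rV_mulmx_le _ ler01 P1)).
by rewrite mulr1 -mulrA ler_wpM2l// lcp_lip.
Qed.

(** Differentiating z = x - ramp(z) P gives dz (1 + diag(ramp' z) P) = dx; this is the matrix
    applied to dz. *)
Definition lcpN : 'rV[R]_p -> 'M[R]_p :=
  locked (fun x => 1%:M + diag_mx (\row_k ramp' e (lcpz x 0 k)) *m P).

Lemma lcpNE u x j :
  (u *m lcpN x) 0 j = u 0 j + \sum_k u 0 k * ramp' e (lcpz x 0 k) * P k j.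
Proof.
rewrite /lcpN -lock mulmxDr mulmx1 mulmxA [LHS]mxE; congr (_ + _).
rewrite mxE; apply: eq_bigr => k _; congr (_ * _).
by rewrite mul_mx_diag !mxE.
Qed.

(* Near the corner the entries of ramp' equal -1, and lcpN is an M-matrix for
   which w i is a strict supersolution off i, where ramp' vanishes. *)
Lemma lcpN_bound u x : simplex x -> `|u| <= (1 + C) * `|u *m lcpN x|.
Proof.
move=> sx; have [i xi] := simplex_large_coord sx.
have zi : ramp' e (lcpz x 0 i) = 0 by have [] := ramp_zero e_gt0 (lcpz_large sx xi).
set v := u *m lcpN x; set n := `|v|.
have w1 l : l != i -> 1 <= w i 0 l.
  move=> li; apply: le_trans (w_super li); rewrite lerDl mxE.
  by rewrite sumr_ge0// => k _; rewrite mulr_ge0.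
have ule (a : R) j : 0 <= a -> (forall l, l != i -> `|u 0 l| <= a * w i 0 l) ->
    `|u 0 j| <= n + a * (w i *m P) 0 j.
  move=> a0 h.
  have -> : u 0 j = v 0 j - \sum_k u 0 k * ramp' e (lcpz x 0 k) * P k j.
    by rewrite /v lcpNE addrK.
  apply: (le_trans (ler_normB _ _)); apply: lerD; first exact: rV_coord_le.
  rewrite mxE mulr_sumr; apply: (le_trans (ler_norm_sum _ _ _)).
  apply: ler_sum => k _; rewrite !normrM (ger0_norm (P_ge0 _ _)) mulrA.
  rewrite ler_wpM2r//; have [->|ki] := eqVneq k i.
    by rewrite zi normr0 mulr0 mulr_ge0.
  apply: le_trans (h _ ki); rewrite ler_piMr// ler_norml.
  by have /andP[? ?] := ramp'_le (lcpz x 0 k) e_gt0; apply/andP; split => //; lra.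
(* The norm of u off i, weighted by [w i]. At an index l that attains it, [ule] gives a w_l <= n + a
   (w P)_l, and the supersolution property turns this into a <= n. *)
pose a := \big[Num.max/0]_(l | l != i) (`|u 0 l| / w i 0 l).
have a_ub l : l != i -> `|u 0 l| <= a * w i 0 l.
  move=> li; rewrite -ler_pdivrMr ?(lt_le_trans _ (w1 _ li))//.
  exact: (le_bigmax_cond 0 (fun l => `|u 0 l| / w i 0 l)) li.
have a0 : 0 <= a by exact: bigmax_ge_id.
have an : a <= n.
  have [->|an0] := eqVneq a 0; first exact: normr_ge0.
  have : exists2 l, l != i & a = `|u 0 l| / w i 0 l.
    have : a = 0 \/ exists2 l, l != i & a = `|u 0 l| / w i 0 l.
      rewrite /a; elim/big_rec : _ => [|l b li [->|[l' l'i ->]]]; first by left.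
        by rewrite /Num.max; case: ifP => _; [left|right; exists l].
      by rewrite /Num.max; case: ifP => _; right; [exists l'|exists l].
    by case=> // /eqP; rewrite (negbTE an0).
  move=> [l li al]; have wl0 : 0 < w i 0 l by exact: lt_le_trans (w1 _ li).
  have ul : `|u 0 l| = a * w i 0 l.
    rewrite al divfK; first by [].
    by rewrite gt_eqF.
  have := ule a l a0 a_ub; rewrite ul => h.
  have := ler_wpM2l a0 (w_super li); rewrite mulrDr mulr1; lra.
apply: rV_norm_le => [|j]; first by rewrite mulr_ge0 ?normr_ge0// addr_ge0// ltW.
apply: (le_trans (ule a j a0 a_ub)); rewrite mulrDl mul1r lerD2l mulrC.
by apply: ler_pM => //; rewrite mxE sumr_ge0// => k _; rewrite mulr_ge0.
Qed.

Lemma lcpN_unit x : simplex x -> lcpN x \in unitmx.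
Proof.
move=> sx; rewrite -row_free_unit; apply: inj_row_free => u u0.
apply/eqP; rewrite -normr_le0; apply: le_trans (lcpN_bound u sx) _.
by rewrite u0 normr0 mulr0.
Qed.

Let K := 1 + C.

Lemma K_ge0 : 0 <= K. Proof. by rewrite addr_ge0// ltW. Qed.

(** [lcpz'] and [lcpz''] are the first and second derivatives of [lcpz] as read off from the
    differentiated equation; that they are derivatives follows from Taylor estimates valid up to the
    boundary of the simplex. *)
Definition lcpz' : 'rV[R]_p -> 'rV[R]_p -> 'rV[R]_p :=
  locked (fun x V => V *m invmx (lcpN x)).

Definition lcpz'' x W V :=
  lcpz' x (- ((\row_k (lcpz' x V 0 k * ramp'' e (lcpz x 0 k) * lcpz' x W 0 k)) *m P)).

Lemma lcpz'K x V : simplex x -> lcpz' x V *m lcpN x = V.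
Proof. by move=> sx; rewrite /lcpz' -lock mulmxKV// lcpN_unit. Qed.

Lemma lcpz'_unique x u V : simplex x -> u *m lcpN x = V -> lcpz' x V = u.
Proof. by move=> sx <-; rewrite /lcpz' -lock mulmxK// lcpN_unit. Qed.

Lemma lcpz'_bound x V : simplex x -> `|lcpz' x V| <= K * `|V|.
Proof.
move=> sx; have := lcpN_bound (lcpz' x V) sx.
by rewrite lcpz'K.
Qed.

Lemma mulmxP_norm u : `|u *m P| <= p%:R * `|u|.
Proof.
have P1 i j : `|P i j| <= 1 by rewrite ger0_norm.
by apply: (le_trans (rV_mulmx_le u ler01 P1)); rewrite mulr1.
Qed.

(** The only singular factor is [ramp''], of order 1/e. *)
Lemma lcpz''_bound x W V : simplex x ->
  `|lcpz'' x W V| <= p%:R * K ^+ 3 / e * `|W| * `|V|.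
Proof.
move=> sx; apply: (le_trans (lcpz'_bound _ sx)).
have -> : p%:R * K ^+ 3 / e * `|W| * `|V| =
    K * (p%:R * ((K * `|V|) * e^-1 * (K * `|W|))) by ring.
rewrite ler_wpM2l ?K_ge0// normrN; apply: (le_trans (mulmxP_norm _)).
have eV : 0 <= e^-1 by rewrite invr_ge0 ltW.
rewrite ler_wpM2l//; apply: rV_norm_le => [|k].
  by rewrite !mulr_ge0 ?K_ge0.
rewrite mxE !normrM; apply: ler_pM => //; rewrite ?mulr_ge0//.
  apply: ler_pM => //; last exact: ramp''_le.
  exact: le_trans (rV_coord_le _ _) (lcpz'_bound _ sx).
exact: le_trans (rV_coord_le _ _) (lcpz'_bound _ sx).
Qed.

(** Multiplication by [lcpN x] reduces the error to the Taylor remainder of [ramp] times P, and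
    [lcpN_bound] undoes the multiplication. *)
Lemma lcpz_taylor x x' : simplex x -> simplex x' -> C3 * `|x' - x| <= e -> `|x' - x| <= d0 ->
  `|lcpz x' - lcpz x - lcpz' x (x' - x)| <= K * (p%:R * (2 / e * C3 ^+ 2)) * `|x' - x| ^+ 2.
Proof.
move=> sx sx' xe xd; have zl := lcpz_lip sx sx' xd.
set u := _ - _ - _; apply: (le_trans (lcpN_bound u sx)).
rewrite -mulrA ler_wpM2l ?K_ge0//.
pose q : 'rV[R]_p := \row_k (ramp e (lcpz x' 0 k) - ramp e (lcpz x 0 k)
  - ramp' e (lcpz x 0 k) * (lcpz x' 0 k - lcpz x 0 k)).
have -> : u *m lcpN x = - (q *m P).
  rewrite /u mulmxBl lcpz'K//.
  have -> : x' - x = (lcpz x' - lcpz x) + (lcp x' - lcp x) *m P.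
    rewrite !lcpz_def mulmxBl; move: (lcp x' *m P) (lcp x *m P) => A' A.
    by apply/rowP => j; rewrite !mxE; ring.
  have rE (A B D : 'rV[R]_p) j : (A - (B + D)) 0 j = A 0 j - B 0 j - D 0 j.
    by rewrite !mxE; ring.
  have rB (A B : 'rV[R]_p) j : (A - B) 0 j = A 0 j - B 0 j by rewrite !mxE.
  apply/rowP => j; rewrite rE lcpNE [X in X - _ - _]addrC addrK mxE -sumrB.
  rewrite [RHS]mxE mxE -sumrN; apply: eq_bigr => k _.
  rewrite !rB !(lcpE sx, lcpE sx') [q _ _]mxE; ring.
rewrite normrN; apply: (le_trans (mulmxP_norm _)).
rewrite -[leRHS]mulrA ler_wpM2l//.
have eV : 0 <= 2 / e by rewrite divr_ge0// ltW.
apply: rV_norm_le => [|k]; first by rewrite mulr_ge0 ?sqr_ge0// mulr_ge0 ?sqr_ge0.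
have zk : `|lcpz x' 0 k - lcpz x 0 k| <= C3 * `|x' - x|.
  by apply: le_trans zl; have := rV_coord_le (lcpz x' - lcpz x) k; rewrite !mxE.
rewrite mxE; apply: le_trans (ramp_taylor e_gt0 (le_trans zk xe)) _.
rewrite -[leRHS]mulrA ler_wpM2l// -exprMn -[X in X <= _]real_normK ?num_real//.
by rewrite lerXn2r ?nnegrE// (le_trans _ zk).
Qed.

(** The resolvent identity for the inverses of [lcpN x'] and [lcpN x]. *)
Lemma lcpz'_diff x x' V : simplex x -> simplex x' ->
  (lcpz' x' V - lcpz' x V) =
   lcpz' x (- ((\row_k (lcpz' x' V 0 k * (ramp' e (lcpz x' 0 k) - ramp' e (lcpz x 0 k)))) *m P)).
Proof.
move=> sx sx'; apply/esym/lcpz'_unique => //; rewrite mulmxBl.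
rewrite [X in _ - X](lcpz'K V sx).
have := lcpz'K V sx'; move: (lcpz' x' V) => u <-.
have rB (A B : 'rV[R]_p) j : (A - B) 0 j = A 0 j - B 0 j by rewrite !mxE.
apply/rowP => j; rewrite rB (lcpNE u x j) (lcpNE u x' j) opprD addrACA subrr add0r.
rewrite -sumrB [RHS]mxE mxE -sumrN; apply: eq_bigr => k _; rewrite mxE; ring.
Qed.

Lemma lcpz'_lip x x' V : simplex x -> simplex x' -> `|x' - x| <= d0 ->
  `|lcpz' x' V - lcpz' x V| <= K ^+ 2 * p%:R / e * C3 * `|x' - x| * `|V|.
Proof.
move=> sx sx' xd; rewrite lcpz'_diff//; apply: (le_trans (lcpz'_bound _ sx)).
have -> : K ^+ 2 * p%:R / e * C3 * `|x' - x| * `|V|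
  = K * (p%:R * ((K * `|V|) * (e^-1 * (C3 * `|x' - x|)))) by ring.
rewrite ler_wpM2l ?K_ge0// normrN; apply: (le_trans (mulmxP_norm _)).
have eV : 0 <= e^-1 by rewrite invr_ge0 ltW.
have C30 : 0 <= C3 by rewrite addr_ge0// mulr_ge0// ltW.
rewrite ler_wpM2l//; apply: rV_norm_le => [|k].
  by rewrite !mulr_ge0 ?K_ge0.
rewrite mxE normrM; apply: ler_pM => //.
  exact: le_trans (rV_coord_le _ _) (lcpz'_bound _ sx').
apply: (le_trans (ramp'_dist _ _ e_gt0)); rewrite ler_wpM2l//.
apply: le_trans (lcpz_lip sx sx' xd).
by have := rV_coord_le (lcpz x' - lcpz x) k; rewrite !mxE.
Qed.

Lemma lcpz'B x U V : simplex x -> lcpz' x (U - V) = lcpz' x U - lcpz' x V.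
Proof. by move=> sx; apply: lcpz'_unique => //; rewrite mulmxBl !lcpz'K. Qed.

Lemma lcpz'Z x c V : simplex x -> lcpz' x (c *: V) = c *: lcpz' x V.
Proof. by move=> sx; apply: lcpz'_unique => //; rewrite -scalemxAl lcpz'K. Qed.

Definition lcp' x V : 'rV[R]_p := \row_k (ramp' e (lcpz x 0 k) * lcpz' x V 0 k).

Definition lcp'' x W V : 'rV[R]_p :=
  \row_k (ramp' e (lcpz x 0 k) * lcpz'' x W V 0 k
           + ramp'' e (lcpz x 0 k) * lcpz' x W 0 k * lcpz' x V 0 k).

Lemma lcp'E x V k : lcp' x V 0 k = ramp' e (lcpz x 0 k) * lcpz' x V 0 k.
Proof. by rewrite mxE. Qed.

Lemma lcp''E x W V k : lcp'' x W V 0 k = ramp' e (lcpz x 0 k) * lcpz'' x W V 0 k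
  + ramp'' e (lcpz x 0 k) * lcpz' x W 0 k * lcpz' x V 0 k.
Proof. by rewrite mxE. Qed.

Lemma lcp'_bound x V k : simplex x -> `|lcp' x V 0 k| <= K * `|V|.
Proof.
move=> sx; rewrite lcp'E normrM; apply: (@le_trans _ _ `|lcpz' x V 0 k|).
  rewrite ler_piMl// ler_norml.
  by have /andP[? ?] := ramp'_le (lcpz x 0 k) e_gt0; apply/andP; split => //; lra.
exact: le_trans (rV_coord_le _ _) (lcpz'_bound _ sx).
Qed.

Lemma lcp''_bound x W V k : simplex x ->
  `|lcp'' x W V 0 k| <= (p%:R * K ^+ 3 + K ^+ 2) / e * `|W| * `|V|.
Proof.
move=> sx; rewrite lcp''E; apply: (le_trans (ler_normD _ _)).
have -> : (p%:R * K ^+ 3 + K ^+ 2) / e * `|W| * `|V| =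
  p%:R * K ^+ 3 / e * `|W| * `|V| + e^-1 * (K * `|W|) * (K * `|V|) by ring.
have zb U : `|lcpz' x U 0 k| <= K * `|U|.
  exact: le_trans (rV_coord_le _ _) (lcpz'_bound _ sx).
have eV : 0 <= e^-1 by rewrite invr_ge0 ltW.
apply: lerD; rewrite normrM.
  apply: (@le_trans _ _ `|lcpz'' x W V 0 k|).
    rewrite ler_piMl// ler_norml.
    by have /andP[? ?] := ramp'_le (lcpz x 0 k) e_gt0; apply/andP; split => //; lra.
  exact: le_trans (rV_coord_le _ _) (lcpz''_bound _ _ sx).
rewrite normrM; apply: ler_pM => //.
by apply: ler_pM => //; exact: ramp''_le.
Qed.

Lemma lcp_far x j : simplex x -> (2 * C + 3) * e <= x 0 j ->
  [/\ lcp x 0 j = 0, forall V, lcp' x V 0 j = 0 & forall W V, lcp'' x W V 0 j = 0].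
Proof.
move=> sx xj; have [b0 b1 b2] := ramp_zero e_gt0 (lcpz_zero sx xj).
split=> [|V|W V]; first by rewrite lcpE.
  by rewrite lcp'E b1 mul0r.
by rewrite lcp''E b1 b2 !mul0r addr0.
Qed.

(** With z = [lcpz x] the coordinate is z_j + ramp(z_j), and s + [ramp e s] >= e for every s. *)
Lemma lcp_repulsion x j : simplex x -> e <= (x - lcp x *m (P - 1%:M)) 0 j.
Proof.
move=> sx; rewrite mulmxBr mulmx1.
have -> : (x - (lcp x *m P - lcp x)) 0 j = lcpz x 0 j + lcp x 0 j.
  rewrite lcpzE; move: (lcp x *m P) (lcp x) => A B; rewrite !mxE; ring.
by rewrite (lcpE sx) ramp_add_ge.
Qed.

(* This makes the map x |-> x - lcp x *m (P - 1) constant in the direction of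
   the k-th row of P - 1 near the face x_k = 0. *)
Lemma lcp'_strip x k : simplex x -> x 0 k <= e ->
  lcp' x (row k (P - 1%:M)) = delta_mx 0 k.
Proof.
move=> sx xk; have zk : ramp' e (lcpz x 0 k) = -1.
  have [i xi] := simplex_large_coord sx.
  apply: (ramp_lin e_gt0 _).2; apply: le_trans xk; rewrite lcpzE lerBlDr lerDl.
  by case/andP: (lcpP_bound sx xi k).
(* Since [ramp'] is -1 at z_k, multiplying [- delta_mx 0 k] by [lcpN x] gives -1 at place k plus the
   row k of P. *)
have zE : lcpz' x (row k (P - 1%:M)) = - delta_mx 0 k.
  apply: lcpz'_unique => //; apply/rowP => j; rewrite lcpNE (bigD1 k)//= big1.
    by rewrite zk !mxE !eqxx /= [k == j]eq_sym; ring.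
  by move=> l lk; rewrite !mxE eqxx (negbTE lk) oppr0 !mul0r.
apply/rowP => j; rewrite lcp'E zE !mxE eqxx /=.
by have [->|] := eqVneq j k; rewrite ?zk ?mulrNN ?mulr1// oppr0 mulr0.
Qed.

Lemma lcpz''E x W V : lcpz'' x W V =
  lcpz' x (- ((\row_k (lcpz' x V 0 k * ramp'' e (lcpz x 0 k) * lcpz' x W 0 k)) *m P)).
Proof. by []. Qed.

Lemma normM_le (c c' s t : R) : `|s| <= c -> `|t| <= c' -> `|s * t| <= c * c'.
Proof. by move=> h h'; rewrite normrM ler_pM. Qed.

Lemma normD_le (c c' s t : R) : `|s| <= c -> `|t| <= c' -> `|s + t| <= c + c'.
Proof. by move=> h h'; apply: le_trans (ler_normD _ _) (lerD h h'). Qed.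

(** * Second order expansion of the correction at a point of the simplex *)

Section local_estimates.
Variables (x : 'rV[R]_p).
Hypothesis sx : simplex x.

(** One constant Q replaces all the explicit ones, so that products of these bounds become powers of
    Q. *)
Let bounds Q x' : Prop := let d := `|x' - x| in
  [/\ forall k, `|lcpz x' 0 k - lcpz x 0 k| <= Q * d,
      forall k, `|lcpz x' 0 k - lcpz x 0 k - lcpz' x (x' - x) 0 k| <= Q * d ^+ 2,
      forall V k, `|lcpz' x' V 0 k - lcpz' x V 0 k| <= Q * d * `|V|
    & forall V k, `|lcpz' x' V 0 k| <= Q * `|V| ].

Let boundsP : exists Q, [/\ 1 <= Q, e^-1 <= Q, 2 / e ^+ 2 <= Q, 4 / e ^+ 2 <= Q &
  exists2 d, 0 < d & forall x', simplex x' -> `|x' - x| <= d ->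
   bounds Q x' /\ 2 / e * (Q * `|x' - x|) ^+ 2 <= Q ^+ 3 * `|x' - x| ^+ 2 /\ Q * `|x' - x| <= e].
Proof.
pose c1 := K * (p%:R * (2 / e * C3 ^+ 2)); pose c2 := K ^+ 2 * p%:R / e * C3.
pose Q := 1 + e^-1 + 4 / e ^+ 2 + 2 / e + C3 + K + c1 + c2.
have eV : 0 <= e^-1 by rewrite invr_ge0 ltW.
have eV2 : 0 <= 2 / e by rewrite divr_ge0// ltW.
have eV4 : 0 <= (e ^+ 2)^-1 by rewrite invr_ge0 exprn_ge0// ltW.
have C30 : 0 <= C3 by rewrite addr_ge0// mulr_ge0// ltW.
have k0 := K_ge0.
have c10 : 0 <= c1 by rewrite /c1 mulr_ge0// mulr_ge0// mulr_ge0// exprn_ge0.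
have c20 : 0 <= c2 by rewrite /c2 mulr_ge0// mulr_ge0// mulr_ge0// exprn_ge0.
have Q1 : 1 <= Q by rewrite /Q; lra.
have Q0 : 0 < Q by lra.
have pV0 : 0 < p%:R^-1 :> R.
  rewrite invr_gt0 ltr0n lt0n; apply/eqP => p0; have [i _] := simplex_large_coord sx.
  by case: i => i ip; exfalso; move: ip; rewrite p0.
have d00 : 0 < d0 by rewrite !divr_gt0 ?addr_gt0.
exists Q; split => //; try by rewrite /Q; lra.
exists (Num.min d0 (e / Q)); first by rewrite lt_min d00 divr_gt0.
move=> x' sx'; rewrite le_min => /andP[xd]; rewrite ler_pdivlMr// [_ * Q]mulrC => xe.
have n0 := normr_ge0 (x' - x).
have C3Q : C3 <= Q by rewrite /Q; lra.
split; [split|split => //].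
- move=> k; have := rV_coord_le (lcpz x' - lcpz x) k.
  rewrite !mxE => /le_trans; apply.
  by apply: le_trans (lcpz_lip sx sx' xd) _; rewrite ler_wpM2r.
- move=> k; have := rV_coord_le (lcpz x' - lcpz x - lcpz' x (x' - x)) k.
  rewrite !mxE => /le_trans; apply.
  apply: (le_trans (lcpz_taylor sx sx' _ xd)); last first.
    by rewrite ler_wpM2r ?exprn_ge0// /Q -/c1; lra.
  by apply: le_trans xe; rewrite ler_wpM2r.
- move=> V k; have := rV_coord_le (lcpz' x' V - lcpz' x V) k.
  rewrite !mxE => /le_trans; apply.
  apply: (le_trans (lcpz'_lip V sx sx' xd)); rewrite ler_wpM2r// ler_wpM2r//.
  by rewrite /Q -/c2; lra.
- move=> V k; apply: (le_trans (rV_coord_le _ _)); apply: (le_trans (lcpz'_bound _ sx')).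
  by rewrite ler_wpM2r// /Q; lra.
rewrite exprMn mulrA ler_wpM2r ?exprn_ge0// [Q ^+ 3]exprS ler_wpM2r ?exprn_ge0 ?(ltW Q0)//.
by rewrite /Q; lra.
Qed.

Let ramp''_Q Q s : e^-1 <= Q -> `|ramp'' e s| <= Q.
Proof. by apply: le_trans; exact: ramp''_le. Qed.

Let ramp'_1 s : `|ramp' e s| <= 1.
Proof.
rewrite ler_norml; have /andP[h1 h2] := ramp'_le s e_gt0.
by rewrite h1 (le_trans h2).
Qed.

Lemma lcp_taylor : exists c dd, 0 < dd /\ forall x', simplex x' -> `|x' - x| <= dd ->
  forall k, `|lcp x' 0 k - lcp x 0 k - lcp' x (x' - x) 0 k| <= c * `|x' - x| ^+ 2.
Proof.
have [Q [Q1 _ _ _ [dd dd0 h]]] := boundsP.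
exists (Q ^+ 3 + Q), dd; split => // x' sx' xd k.
have [[zz zt _ _] [h1 h2]] := h x' sx' xd.
rewrite lcp'E !lcpE//.
set r := ramp' e (lcpz x 0 k).
have -> : ramp e (lcpz x' 0 k) - ramp e (lcpz x 0 k) - r * lcpz' x (x' - x) 0 k
  = (ramp e (lcpz x' 0 k) - ramp e (lcpz x 0 k) - r * (lcpz x' 0 k - lcpz x 0 k))
    + r * (lcpz x' 0 k - lcpz x 0 k - lcpz' x (x' - x) 0 k) by ring.
apply: (le_trans (ler_normD _ _)); rewrite mulrDl; apply: lerD.
  apply: le_trans (ramp_taylor e_gt0 (le_trans (zz k) h2)) _; apply: le_trans h1.
  rewrite ler_wpM2l ?divr_ge0 ?(ltW e_gt0)// -[X in X <= _]real_normK ?num_real//.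
  by rewrite lerXn2r ?nnegrE// (le_trans _ (zz k)).
by rewrite -[leRHS]mul1r; apply: normM_le (zt k); exact: ramp'_1.
Qed.

Let ramp'_diff Q x' k : 1 <= Q -> e^-1 <= Q -> 2 / e ^+ 2 <= Q ->
  4 / e ^+ 2 <= Q -> bounds Q x' ->
  [/\ `|ramp' e (lcpz x' 0 k) - ramp' e (lcpz x 0 k)| <= Q * (Q * `|x' - x|),
  `|ramp' e (lcpz x' 0 k) - ramp' e (lcpz x 0 k)
    - ramp'' e (lcpz x 0 k) * (lcpz x' 0 k - lcpz x 0 k)| <= Q * (Q * `|x' - x|) ^+ 2
  & `|ramp'' e (lcpz x' 0 k) - ramp'' e (lcpz x 0 k)| <= Q * (Q * `|x' - x|)].
Proof.
move=> Q1 h1 h2 h3 [zz _ _ _].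
have z0 := le_trans (normr_ge0 _) (zz k).
have eV : 0 <= e^-1 by rewrite invr_ge0 ltW.
have eV4 : 0 <= (e ^+ 2)^-1 by rewrite invr_ge0 exprn_ge0// ltW.
split.
- by apply: le_trans (ramp'_dist _ _ e_gt0) _; exact: ler_pM.
- apply: le_trans (ramp'_taylor _ _ e_gt0) _; apply: ler_pM => //; rewrite ?sqr_ge0 ?mulr_ge0//.
  rewrite -[X in X <= _]real_normK ?num_real//.
  by rewrite lerXn2r ?nnegrE.
- by apply: le_trans (ramp''_lip _ _ e_gt0) _; apply: ler_pM => //; rewrite mulr_ge0.
Qed.

(** The resolvent identity and the formula for [lcpz''] have the same shape, so the error is [lcpz']
    of a second order remainder. *)
Let lcpz'_taylor : exists c dd, 0 < dd /\ forall x', simplex x' -> `|x' - x| <= dd ->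
  forall V k, `|lcpz' x' V 0 k - lcpz' x V 0 k - lcpz'' x (x' - x) V 0 k|
              <= c * `|x' - x| ^+ 2 * `|V|.
Proof.
have [Q [Q1 h1 h2 h3 [dd dd0 h]]] := boundsP.
exists (K * p%:R * (3 * Q ^+ 4)), dd; split => // x' sx' xd V k.
have [bd _] := h x' sx' xd; have [zz zt Dd DQ] := bd.
set v := (lcpz' x' V - lcpz' x V) - lcpz'' x (x' - x) V.
have -> : lcpz' x' V 0 k - lcpz' x V 0 k - lcpz'' x (x' - x) V 0 k = v 0 k.
  by rewrite /v; move: (lcpz' _ _) (lcpz' _ _) (lcpz'' _ _ _) => A B D; rewrite !mxE.
apply: le_trans (rV_coord_le _ _) _.
pose q : 'rV[R]_p := \row_k (lcpz' x' V 0 k * (ramp' e (lcpz x' 0 k) - ramp' e (lcpz x 0 k))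
  - lcpz' x V 0 k * ramp'' e (lcpz x 0 k) * lcpz' x (x' - x) 0 k).
have -> : v = lcpz' x (- (q *m P)).
  have E (A B : 'rV[R]_p) : - (A *m P) - - (B *m P) = - ((A - B) *m P).
    by rewrite mulmxBl opprB opprK addrC.
  rewrite /v lcpz'_diff// lcpz''E -lcpz'B// E; congr (lcpz' x (- (_ *m P))).
  by apply/rowP => j; rewrite !mxE.
apply: le_trans (lcpz'_bound _ sx) _; rewrite normrN.
set dl := `|x' - x|.
have -> : K * p%:R * (3 * Q ^+ 4) * dl ^+ 2 * `|V| = K * (p%:R * (3 * Q ^+ 4 * dl ^+ 2 * `|V|)).
  by ring.
rewrite ler_wpM2l ?K_ge0//; apply: le_trans (mulmxP_norm _) _; rewrite ler_wpM2l//.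
have Q0 : 0 <= Q by exact: le_trans ler01 Q1.
have Q34 : Q ^+ 3 <= Q ^+ 4 by rewrite ler_weXn2l.
have n0 : 0 <= dl by exact: normr_ge0.
apply: rV_norm_le => [|j].
  by rewrite mulr_ge0// mulr_ge0 ?exprn_ge0// mulr_ge0 ?exprn_ge0.
have [r1 r2 r3] := @ramp'_diff Q x' j Q1 h1 h2 h3 bd.
rewrite mxE.
set r := ramp' e (lcpz x 0 j) in r1 r2 *; set r' := ramp' e (lcpz x' 0 j) in r1 r2 *.
set s := ramp'' e (lcpz x 0 j) in r2 *.
(* Three sources of error: the variation of [lcpz'], the Taylor remainder of [ramp'], and the one of
   [lcpz]. *)
have -> : lcpz' x' V 0 j * (r' - r) - lcpz' x V 0 j * s * lcpz' x (x' - x) 0 j =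
  (lcpz' x' V 0 j - lcpz' x V 0 j) * (r' - r)
  + lcpz' x V 0 j * (r' - r - s * (lcpz x' 0 j - lcpz x 0 j))
  + lcpz' x V 0 j * (s * (lcpz x' 0 j - lcpz x 0 j - lcpz' x (x' - x) 0 j)) by ring.
have DQx : `|lcpz' x V 0 j| <= Q * `|V|.
  have := h x sx; rewrite subrr normr0 => /(_ (ltW dd0))[[_ _ _]]; exact.
have t1 := normM_le (Dd V j) r1; have t2 := normM_le DQx r2.
have t3 := normM_le DQx (normM_le (@ramp''_Q Q (lcpz x 0 j) h1) (zt j)).
apply: (@le_trans _ _ (Q ^+ 3 * dl ^+ 2 * `|V| + Q ^+ 4 * dl ^+ 2 * `|V| + Q ^+ 3 * dl ^+ 2 * `|V|)).
  apply: le_trans (ler_normD _ _) _; apply: lerD; first apply: le_trans (ler_normD _ _) (lerD _ _).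
  - by apply: le_trans t1 _; rewrite -/dl le_eqVlt; apply/orP; left; apply/eqP; ring.
  - by apply: le_trans t2 _; rewrite -/dl le_eqVlt; apply/orP; left; apply/eqP; ring.
  - by apply: le_trans t3 _; rewrite -/dl le_eqVlt; apply/orP; left; apply/eqP; ring.
have : Q ^+ 3 * (dl ^+ 2 * `|V|) <= Q ^+ 4 * (dl ^+ 2 * `|V|).
  by rewrite ler_wpM2r// mulr_ge0// exprn_ge0// normr_ge0.
lra.
Qed.

Lemma lcp'_taylor : exists c dd, 0 < dd /\ forall x', simplex x' -> `|x' - x| <= dd ->
  forall V k, `|lcp' x' V 0 k - lcp' x V 0 k - lcp'' x (x' - x) V 0 k|
              <= c * `|x' - x| ^+ 2 * `|V|.
Proof.
have [c [d1 [d10 hc]]] := lcpz'_taylor.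
have [Q [Q1 h1 h2 h3 [dd dd0 h]]] := boundsP.
exists (c + 3 * Q ^+ 4), (Num.min dd d1); split => [|x' sx']; first by rewrite lt_min dd0.
rewrite le_min => /andP[xd xd1] V k.
have [bd _] := h x' sx' xd; have [zz zt Dd DQ] := bd.
have Q0 : 0 <= Q by exact: le_trans ler01 Q1.
have Q34 : Q ^+ 3 <= Q ^+ 4 by rewrite ler_weXn2l.
have [r1 r2 r3] := @ramp'_diff Q x' k Q1 h1 h2 h3 bd.
have hck := hc x' sx' xd1 V k.
rewrite !lcp'E lcp''E.
set r := ramp' e (lcpz x 0 k) in r1 r2 *; set r' := ramp' e (lcpz x' 0 k) in r1 r2 *.
set s := ramp'' e (lcpz x 0 k) in r2 *; set dl := `|x' - x|.
have -> : r' * lcpz' x' V 0 k - r * lcpz' x V 0 k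
   - (r * lcpz'' x (x' - x) V 0 k + s * lcpz' x (x' - x) 0 k * lcpz' x V 0 k) =
  r * (lcpz' x' V 0 k - lcpz' x V 0 k - lcpz'' x (x' - x) V 0 k)
  + lcpz' x' V 0 k * (r' - r - s * (lcpz x' 0 k - lcpz x 0 k))
  + lcpz' x' V 0 k * (s * (lcpz x' 0 k - lcpz x 0 k - lcpz' x (x' - x) 0 k))
  + s * lcpz' x (x' - x) 0 k * (lcpz' x' V 0 k - lcpz' x V 0 k) by ring.
have DQx : `|lcpz' x (x' - x) 0 k| <= Q * dl.
  have := h x sx; rewrite subrr normr0 => /(_ (ltW dd0))[[_ _ _]]; exact.
have sQ := @ramp''_Q Q (lcpz x 0 k) h1.
have t0 := normM_le (ramp'_1 (lcpz x 0 k)) hck.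
have t2 := normM_le (DQ V k) r2.
have t3 := normM_le (DQ V k) (normM_le sQ (zt k)).
have t4 := normM_le (normM_le sQ DQx) (Dd V k).
apply: (@le_trans _ _ (c * dl ^+ 2 * `|V| + Q ^+ 4 * dl ^+ 2 * `|V| + Q ^+ 3 * dl ^+ 2 * `|V|
   + Q ^+ 3 * dl ^+ 2 * `|V|)).
  apply: normD_le; [apply: normD_le; [apply: normD_le|]|].
  - by apply: le_trans t0 _; rewrite mul1r.
  - by apply: le_trans t2 _; rewrite -/dl le_eqVlt; apply/orP; left; apply/eqP; ring.
  - by apply: le_trans t3 _; rewrite -/dl le_eqVlt; apply/orP; left; apply/eqP; ring.
  - by apply: le_trans t4 _; rewrite -/dl le_eqVlt; apply/orP; left; apply/eqP; ring.
have : Q ^+ 3 * (dl ^+ 2 * `|V|) <= Q ^+ 4 * (dl ^+ 2 * `|V|).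
  by rewrite ler_wpM2r// mulr_ge0// exprn_ge0// normr_ge0.
lra.
Qed.

Lemma lcp_dist : exists c dd, 0 < dd /\ forall x', simplex x' -> `|x' - x| <= dd ->
  forall k, `|lcp x' 0 k - lcp x 0 k| <= c * `|x' - x|.
Proof.
have [Q [_ _ _ _ [dd dd0 h]]] := boundsP; exists Q, dd; split => // x' sx' xd k.
have [[zz _ _ _] _] := h x' sx' xd.
by rewrite !lcpE//; apply: le_trans (ramp_dist _ _ e_gt0) (zz k).
Qed.

Lemma lcp'_dist V : exists c dd, 0 < dd /\ forall x', simplex x' -> `|x' - x| <= dd ->
  forall k, `|lcp' x' V 0 k - lcp' x V 0 k| <= c * `|x' - x|.
Proof.
have [Q [Q1 h1 h2 h3 [dd dd0 h]]] := boundsP.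
exists (Q * Q * (Q * `|V|) + Q * `|V|), dd; split => // x' sx' xd k.
have [bd _] := h x' sx' xd; have [zz _ Dd DQ] := bd.
have [r1 _ _] := @ramp'_diff Q x' k Q1 h1 h2 h3 bd.
rewrite !lcp'E.
set r := ramp' e (lcpz x 0 k) in r1 *; set r' := ramp' e (lcpz x' 0 k) in r1 *.
have -> : r' * lcpz' x' V 0 k - r * lcpz' x V 0 k =
  (r' - r) * lcpz' x' V 0 k + r * (lcpz' x' V 0 k - lcpz' x V 0 k) by ring.
have t1 := normM_le r1 (DQ V k); have t2 := normM_le (ramp'_1 (lcpz x 0 k)) (Dd V k).
rewrite [leRHS]mulrDl; apply: normD_le.
  by apply: le_trans t1 _; rewrite le_eqVlt; apply/orP; left; apply/eqP; ring.
by apply: le_trans t2 _; rewrite le_eqVlt; apply/orP; left; apply/eqP; ring.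
Qed.

(** All factors vary in a Lipschitz way; for [ramp''] this is where the cubic spline is needed. *)
Lemma lcp''_dist W V : exists c dd, 0 < dd /\ forall x', simplex x' -> `|x' - x| <= dd ->
  forall k, `|lcp'' x' W V 0 k - lcp'' x W V 0 k| <= c * `|x' - x|.
Proof.
have [Q [Q1 h1 h2 h3 [dd dd0 h]]] := boundsP.
pose a := Q * `|V|; pose b := Q * `|W|.
pose c0 := p%:R * K ^+ 3 / e * `|W| * `|V|.
pose c1 := Q * p%:R * (a * Q * b) + K * p%:R * (3 * Q ^+ 2 * a * b).
exists (Q ^+ 2 * c0 + c1 + 3 * Q ^+ 2 * a * b), dd; split => // x' sx' xd k.
have [bd _] := h x' sx' xd; have [zz _ Dd DQ] := bd.
have DQx U j : `|lcpz' x U 0 j| <= Q * `|U|.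
  have := h x sx; rewrite subrr normr0 => /(_ (ltW dd0))[[_ _ _]]; exact.
have Q0 : 0 <= Q by exact: le_trans ler01 Q1.
have a0 : 0 <= a by rewrite mulr_ge0.
have b0 : 0 <= b by rewrite mulr_ge0.
set dl := `|x' - x|.
have n0 : 0 <= dl by exact: normr_ge0.
have sQ y j := @ramp''_Q Q (lcpz y 0 j) h1.
have prod3 j : `|lcpz' x' V 0 j * ramp'' e (lcpz x' 0 j) * lcpz' x' W 0 j
   - lcpz' x V 0 j * ramp'' e (lcpz x 0 j) * lcpz' x W 0 j| <= 3 * Q ^+ 2 * a * b * dl.
  have [_ _ r3] := @ramp'_diff Q x' j Q1 h1 h2 h3 bd.
  set s := ramp'' e (lcpz x 0 j) in r3 *; set s' := ramp'' e (lcpz x' 0 j) in r3 *.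
  have -> : lcpz' x' V 0 j * s' * lcpz' x' W 0 j - lcpz' x V 0 j * s * lcpz' x W 0 j
   = (lcpz' x' V 0 j - lcpz' x V 0 j) * s' * lcpz' x' W 0 j
     + lcpz' x V 0 j * (s' - s) * lcpz' x' W 0 j
     + lcpz' x V 0 j * s * (lcpz' x' W 0 j - lcpz' x W 0 j) by ring.
  have t1 := normM_le (normM_le (Dd V j) (sQ x' j)) (DQ W j).
  have t2 := normM_le (normM_le (DQx V j) r3) (DQ W j).
  have t3 := normM_le (normM_le (DQx V j) (sQ x j)) (Dd W j).
  apply: (@le_trans _ _ (Q * a * b * dl + Q ^+ 2 * a * b * dl + Q * a * b * dl)).
    apply: normD_le; [apply: normD_le|].
    - by apply: le_trans t1 _; rewrite -/dl /a /b le_eqVlt; apply/orP; left; apply/eqP; ring.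
    - by apply: le_trans t2 _; rewrite -/dl /a /b le_eqVlt; apply/orP; left; apply/eqP; ring.
    - by apply: le_trans t3 _; rewrite -/dl /a /b le_eqVlt; apply/orP; left; apply/eqP; ring.
  have : Q * (a * b * dl) <= Q ^+ 2 * (a * b * dl).
    by rewrite ler_wpM2r ?mulr_ge0// expr2 ler_peMl.
  lra.
have zdist j : `|lcpz'' x' W V 0 j - lcpz'' x W V 0 j| <= c1 * dl.
  rewrite !lcpz''E; set s' := \row__ _; set s := \row__ _.
  have -> : lcpz' x' (- (s' *m P)) 0 j - lcpz' x (- (s *m P)) 0 j
    = (lcpz' x' (- (s' *m P)) 0 j - lcpz' x (- (s' *m P)) 0 j)
      + lcpz' x (- ((s' - s) *m P)) 0 j.
    have -> : - ((s' - s) *m P) = - (s' *m P) - (- (s *m P)).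
      by rewrite mulmxBl opprB opprK addrC.
    rewrite lcpz'B//; move: (lcpz' x' _) (lcpz' x _) (lcpz' x _) => A B D.
    by rewrite !mxE; ring.
  rewrite [leRHS]mulrDl; apply: normD_le.
    apply: le_trans (Dd _ j) _; rewrite normrN.
    have -> : Q * p%:R * (a * Q * b) * `|x' - x| = Q * `|x' - x| * (p%:R * (a * Q * b)) by ring.
    rewrite ler_wpM2l ?mulr_ge0//; apply: le_trans (mulmxP_norm _) _; rewrite ler_wpM2l//.
    apply: rV_norm_le => [|i]; first by rewrite !mulr_ge0.
    by rewrite mxE; apply: normM_le (DQ W i); apply: normM_le (DQ V i) (sQ x' i).
  apply: le_trans (rV_coord_le _ _) _; apply: le_trans (lcpz'_bound _ sx) _; rewrite normrN.
  have -> : K * p%:R * (3 * Q ^+ 2 * a * b) * `|x' - x|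
    = K * (p%:R * (3 * Q ^+ 2 * a * b * `|x' - x|)) by ring.
  rewrite ler_wpM2l ?K_ge0//; apply: le_trans (mulmxP_norm _) _; rewrite ler_wpM2l//.
  apply: rV_norm_le => [|i]; first by rewrite mulr_ge0// mulr_ge0// mulr_ge0// mulr_ge0 ?exprn_ge0.
  by have := prod3 i; rewrite !mxE.
have [r1 _ _] := @ramp'_diff Q x' k Q1 h1 h2 h3 bd.
have swap y : ramp'' e (lcpz y 0 k) * lcpz' y W 0 k * lcpz' y V 0 k
  = lcpz' y V 0 k * ramp'' e (lcpz y 0 k) * lcpz' y W 0 k by ring.
rewrite !lcp''E !swap.
have zb : `|lcpz'' x' W V 0 k| <= c0.
  by apply: le_trans (rV_coord_le _ _) (lcpz''_bound _ _ sx').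
have p3 := prod3 k.
set r := ramp' e (lcpz x 0 k) in r1 *; set r' := ramp' e (lcpz x' 0 k) in r1 *.
set T := lcpz' x V 0 k * _ * _ in p3 *; set T' := lcpz' x' V 0 k * _ * _ in p3 *.
have -> : r' * lcpz'' x' W V 0 k + T' - (r * lcpz'' x W V 0 k + T)
  = (r' - r) * lcpz'' x' W V 0 k + r * (lcpz'' x' W V 0 k - lcpz'' x W V 0 k) + (T' - T).
  by ring.
have -> : (Q ^+ 2 * c0 + c1 + 3 * Q ^+ 2 * a * b) * dl
  = Q * (Q * dl) * c0 + 1 * (c1 * dl) + 3 * Q ^+ 2 * a * b * dl by ring.
by apply: normD_le p3; apply: normD_le; apply: normM_le => //; exact: ramp'_1.
Qed.

End local_estimates.

Lemma lcp'Z x c V : simplex x -> lcp' x (c *: V) = c *: lcp' x V.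
Proof. by move=> sx; apply/rowP => k; rewrite lcp'E lcpz'Z// !mxE; ring. Qed.

Lemma lcp''Z x c W V : simplex x -> lcp'' x (c *: W) V = c *: lcp'' x W V.
Proof.
move=> sx; apply/rowP => k; rewrite lcp''E lcpz''E lcpz'Z// !mxE.
suff -> : \row_k0 (lcpz' x V 0 k0 * ramp'' e (lcpz x 0 k0) * (c *: lcpz' x W) 0 k0)
    = c *: \row_k0 (lcpz' x V 0 k0 * ramp'' e (lcpz x 0 k0) * lcpz' x W 0 k0).
  by rewrite -scalemxAl -scalerN lcpz'Z// !mxE lcpz''E; ring.
by apply/rowP => j; rewrite !mxE; ring.
Qed.

Lemma lcp_cvg x k : simplex x ->
  lcp y 0 k @[y --> within (@simplex R p) (nbhs x)] --> lcp x 0 k.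
Proof.
move=> sx; have [c [d [d_gt0 h]]] := lcp_dist sx.
by apply: (@cvg_within_linear_error _ _ _ (fun y => lcp y 0 k) x c d) => // y sy yx; exact: h.
Qed.

Lemma lcp'_cvg x V k : simplex x ->
  lcp' y V 0 k @[y --> within (@simplex R p) (nbhs x)] --> lcp' x V 0 k.
Proof.
move=> sx; have [c [d [d_gt0 h]]] := lcp'_dist sx V.
by apply: (@cvg_within_linear_error _ _ _ (fun y => lcp' y V 0 k) x c d) => // y sy yx; exact: h.
Qed.

Lemma lcp''_cvg x W V k : simplex x ->
  lcp'' y W V 0 k @[y --> within (@simplex R p) (nbhs x)] --> lcp'' x W V 0 k.
Proof.
move=> sx; have [c [d [d_gt0 h]]] := lcp''_dist sx W V.
by apply: (@cvg_within_linear_error _ _ _ (fun y => lcp'' y W V 0 k) x c d) => // y sy yx; exact: h.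
Qed.

Let segment_scale V d : 0 < d ->
  exists2 d', 0 < d' & forall h : R, `|h| < d' -> `|h *: V| <= d.
Proof.
move=> d_gt0; exists (d / (1 + `|V|)); first by rewrite divr_gt0// ltr_pwDl.
move=> h; rewrite ltr_pdivlMr ?ltr_pwDl// normrZ => /ltW; apply: le_trans.
by rewrite ler_wpM2l// lerDr.
Qed.

Lemma lcp_derive x V k : simplex x ->
  (exists2 d, 0 < d & forall h : R, `|h| < d -> simplex (h *: V + x)) ->
  is_derive x V (fun y => lcp y 0 k) (lcp' x V 0 k).
Proof.
move=> sx [d1 d1_gt0 sV]; have [c [d [d_gt0 hc]]] := lcp_taylor sx.
have [d2 d2_gt0 hd2] := segment_scale V d_gt0.
apply: (@is_derive_linear_error _ _ _ _ _ _ (c * `|V| ^+ 2) (Num.min d1 d2)).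
  by rewrite lt_min d1_gt0.
move=> h; rewrite lt_min => /and3P[_ hd hd'].
have := hc (h *: V + x) (sV h hd); rewrite addrK => /(_ (hd2 h hd') k).
by rewrite lcp'Z// [X in _ - X]mxE normrZ exprMn mulrCA [leRHS]mulrC.
Qed.

Lemma lcp'_derive x W V k : simplex x ->
  (exists2 d, 0 < d & forall h : R, `|h| < d -> simplex (h *: W + x)) ->
  is_derive x W (fun y => lcp' y V 0 k) (lcp'' x W V 0 k).
Proof.
move=> sx [d1 d1_gt0 sV]; have [c [d [d_gt0 hc]]] := lcp'_taylor sx.
have [d2 d2_gt0 hd2] := segment_scale W d_gt0.
apply: (@is_derive_linear_error _ _ _ _ _ _ (c * `|W| ^+ 2 * `|V|) (Num.min d1 d2)).
  by rewrite lt_min d1_gt0.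
move=> h; rewrite lt_min => /and3P[_ hd hd'].
have := hc (h *: W + x) (sV h hd); rewrite addrK => /(_ (hd2 h hd') V k).
rewrite lcp''Z// [X in _ - X]mxE normrZ; move=> /le_trans; apply.
by rewrite le_eqVlt; apply/orP; left; apply/eqP; ring.
Qed.

End smooth_lcp.

(** * Calculus on the faces of the simplex *)

Section faces.
Context {R : realType} {p : nat} (B : {set 'I_p}).
Implicit Types (x y u V W : 'rV[R]_p).

Lemma face_out x i : face B x -> i \notin B -> x 0 i = 0.
Proof.
move=> [[x0 x1] xB] iB.
have : \sum_(j | j \notin B) x 0 j = 0.
  by move: x1; rewrite (bigID (mem B))/= xB => /(canRL (addKr _)); rewrite addNr.
by move=> /eqP; rewrite psumr_eq0// => /allP/(_ i (mem_index_enum _)); rewrite iB => /eqP.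
Qed.

Lemma face_intro x : (forall i, 0 <= x 0 i) -> (forall i, i \notin B -> x 0 i = 0) ->
  \sum_i x 0 i = 1 -> face B x.
Proof.
move=> x0 xout x1; split => //; move: x1; rewrite (bigID (mem B))/= => <-.
by rewrite [X in _ + X]big1 ?addr0.
Qed.

Lemma tangentD u V : face_tangent B u -> face_tangent B V -> face_tangent B (u + V).
Proof.
move=> [u0 uB] [v0 vB]; split.
  by under eq_bigr do rewrite mxE; rewrite big_split/= u0 v0 addr0.
by move=> i iB; rewrite mxE uB// vB// addr0.
Qed.

Lemma tangentZ c u : face_tangent B u -> face_tangent B (c *: u).
Proof.
move=> [u0 uB]; split.
  by under eq_bigr do rewrite mxE; rewrite -mulr_sumr u0 mulr0.
by move=> i iB; rewrite mxE uB// mulr0.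
Qed.

Lemma tangent0 : face_tangent B (0 : 'rV[R]_p).
Proof. by split => [|i _]; rewrite ?big1// => *; rewrite mxE. Qed.

Lemma tangent_sum (I : Type) (s : seq I) (Q : pred I) (F : I -> 'rV[R]_p) :
  (forall i, Q i -> face_tangent B (F i)) -> face_tangent B (\sum_(i <- s | Q i) F i).
Proof. by move=> h; apply: big_ind => //; [exact: tangent0|exact: tangentD]. Qed.

Lemma tangent_basis i j : i \in B -> j \in B ->
  face_tangent B (basis_vec R i - basis_vec R j).
Proof.
move=> iB jB; split.
  under eq_bigr do rewrite !mxE eqxx/=.
  rewrite sumrB (bigD1 i)//= eqxx big1 => [|k /andP[_ /negbTE->]//].
  by rewrite (bigD1 j)//= eqxx big1 ?subrr// => k /andP[_ /negbTE->].
move=> k kB; rewrite !mxE eqxx/=.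
have ne l : l \in B -> (k == l) = false.
  by move=> lB; apply/negbTE; apply: contraNneq kB => ->.
by rewrite !ne// subrr.
Qed.

Lemma tangent_sub x y : face B x -> face B y -> face_tangent B (x - y).
Proof.
move=> fx fy; split.
  under eq_bigr do rewrite !mxE.
  by rewrite sumrB; case: fx fy => _ -> [_ ->]; rewrite subrr.
by move=> i iB; rewrite !mxE (face_out fx iB) (face_out fy iB) subrr.
Qed.

Lemma open_face_near y : open_face B y ->
  exists2 t, 0 < t & forall u, face_tangent B u -> `|u| < t -> open_face B (u + y).
Proof.
move=> [fy y0]; pose t := \big[Num.min/1]_(j in B) y 0 j.
have t0 : 0 < t by apply: lt_bigmin => //; exact: y0.
exists t => // u [u0 uB] ut.
have pos j : j \in B -> 0 < (u + y) 0 j.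
  move=> jB; have : `|u 0 j| < y 0 j.
    apply: le_lt_trans (rV_coord_le _ _) (lt_le_trans ut _).
    exact: (bigmin_le_cond 1 (fun j => y 0 j)).
  by rewrite ltr_norml => /andP[h _]; rewrite mxE; lra.
have out j : j \notin B -> (u + y) 0 j = 0.
  by move=> jB; rewrite mxE uB// (face_out fy jB) addr0.
split=> //; apply: face_intro => //.
  by move=> i; have [/pos/ltW//|/out->] := boolP (i \in B).
under eq_bigr do rewrite mxE.
rewrite big_split/= (bigID (mem B))/= u0 big1// add0r add0r.
by case: fy => -[].
Qed.

Lemma open_face_line y V : open_face B y -> face_tangent B V ->
  exists2 d, 0 < d & forall h : R, `|h| < d -> open_face B (h *: V + y).
Proof.
move=> oy tV; have [t t0 ht] := open_face_near oy.
exists (t / (1 + `|V|)); first by rewrite divr_gt0// ltr_pwDl.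
move=> h; rewrite ltr_pdivlMr ?ltr_pwDl// => hd; apply: ht; first exact: tangentZ.
by rewrite normrZ; apply: le_lt_trans hd; rewrite ler_wpM2l// lerDr.
Qed.

(** Every point of the face is reached along a segment from the barycentre whose other points are in
    the open face; limits taken from the open face are therefore meaningful at every point. *)
Lemma open_face_nonempty x : face B x -> (0 < #|B|)%N ->
  exists2 y, open_face B y & forall t, 0 < t <= 1 -> open_face B (t *: (y - x) + x).
Proof.
move=> fx B0; pose c : R := #|B|%:R^-1.
have c0 : 0 < c by rewrite invr_gt0 ltr0n.
pose y : 'rV[R]_p := \row_j (if j \in B then c else 0).
have fy : face B y.
  apply: face_intro => [i|i /negbTE iB|]; rewrite ?mxE ?iB//; first by case: ifP => // _; exact: ltW.
  under eq_bigr do rewrite mxE.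
  rewrite -big_mkcond/= sumr_const -[LHS]mulr_natr mulVf// pnatr_eq0 -lt0n//.
have conv t : 0 < t <= 1 -> open_face B (t *: (y - x) + x).
  move=> /andP[t0 t1].
  have co j : (t *: (y - x) + x) 0 j = t * y 0 j + (1 - t) * x 0 j by rewrite !mxE; ring.
  have xj j : 0 <= (1 - t) * x 0 j by case: fx => -[x0 _] _; rewrite mulr_ge0 ?subr_ge0.
  split; last by move=> j jB; rewrite co ltr_wpDr// mxE jB mulr_gt0.
  apply: face_intro => [i|i iB|].
  - by rewrite co addr_ge0// mulr_ge0 ?(ltW t0)//; case: fy => -[].
  - by rewrite co (face_out fx iB) (face_out fy iB) !mulr0 addr0.
  under eq_bigr do rewrite co.
  rewrite big_split/= -!mulr_sumr; case: fx fy => -[_ ->] _ [[_ ->] _]; ring.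
exists y => //; have := conv 1; rewrite scale1r subrK; apply.
by rewrite ltr01 lexx.
Qed.

Lemma open_face_proper x : face B x -> (0 < #|B|)%N ->
  ProperFilter (within (open_face B) (nbhs x)).
Proof.
move=> fx B0; apply: Build_ProperFilter_ex => Q.
move=> /nbhs_normP[e /= e0 he].
have [y oy conv] := open_face_nonempty fx B0.
pose t := Num.min 1 (e / 2 / (1 + `|y - x|)).
have t0 : 0 < t by rewrite lt_min ltr01 !divr_gt0// ltr_pwDl.
have t1 : t <= 1 by rewrite ge_min lexx.
exists (t *: (y - x) + x); apply: he; last by apply: conv; rewrite t0.
rewrite /= distrC addrK normrZ gtr0_norm//.
have : t <= e / 2 / (1 + `|y - x|) by rewrite ge_min lexx orbT.
rewrite ler_pdivlMr ?ltr_pwDl// => h.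
apply: (@le_lt_trans _ _ (t * (1 + `|y - x|))).
  by rewrite ler_wpM2l ?(ltW t0)// lerDr.
by apply: le_lt_trans h _; lra.
Qed.

(** The trace of the neighbourhood filter on the open face is proper, so the limit is unique and any
    continuous candidate identifies it. *)
Lemma face_extension_eq f g x : (0 < #|B|)%N -> {within face B, continuous g} ->
  (forall y, open_face B y -> g y = f y) -> face B x ->
  face_extension B f x = g x.
Proof.
move=> B0 /subspace_continuousP cg gf fx.
have FF := open_face_proper fx B0.
apply: cvg_lim => //.
have sub : within (open_face B) (nbhs x) --> within (face B) (nbhs x).
  move=> Q hQ; have {}hQ : nbhs x (fun y => face B y -> Q y) := hQ.
  by suff : nbhs x (fun y => open_face B y -> Q y) by []; apply: filterS hQ => y hy [/hy].
have h : g @ within (open_face B) (nbhs x) --> g x.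
  by have h0 := cg x fx; move=> Q /h0; exact: sub.
apply: cvg_trans _ h; apply: near_eq_cvg.
by rewrite near_withinE; apply: nearW => y /gf.
Qed.

Lemma face_extension_open (f : 'rV[R]_p -> R) y : (0 < #|B|)%N -> extends_continuously B f ->
  open_face B y -> face_extension B f y = f y.
Proof.
move=> B0 [g cg gf] oy; rewrite (face_extension_eq B0 cg gf) ?gf//.
by case: oy.
Qed.

Lemma eq_within_continuous (A : set 'rV[R]_p) (f g : 'rV[R]_p -> R) :
  (forall x, A x -> f x = g x) -> {within A, continuous f} -> {within A, continuous g}.
Proof.
move=> fg /subspace_continuousP cf; apply/subspace_continuousP => x Ax.
suff : g @ within A (nbhs x) --> f x by rewrite (fg x Ax).
apply: cvg_trans _ (cf x Ax); apply: near_eq_cvg.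
by rewrite near_withinE; apply: nearW.
Qed.

Lemma face_extension_continuous (f : 'rV[R]_p -> R) : (0 < #|B|)%N -> extends_continuously B f ->
  {within face B, continuous (face_extension B f)}.
Proof.
move=> B0 [g cg gf]; apply: (eq_within_continuous _ cg) => x fx.
by rewrite (face_extension_eq B0 cg gf).
Qed.

End faces.

(** * Mean values and differentiability inside a face *)

Section derivatives_on_faces.
Context {R : realType} {p : nat}.
Implicit Types (x y u V W : 'rV[R]_p) (f g : 'rV[R]_p -> R).

Lemma is_derive_eq_line f g x V l d : 0 < d ->
  (forall h : R, `|h| < d -> f (h *: V + x) = g (h *: V + x)) ->
  is_derive x V f l -> is_derive x V g l.
Proof.
move=> d0 fg df; have fgx : f x = g x.
  by have := fg 0; rewrite normr0 scale0r add0r; apply.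
have H : h^-1 *: ((f \o shift x) (h *: V) - f x) @[h --> 0^'] --> l.
  by case: df => /cvg_ex[l' hl'] <-; have := cvg_lim (@norm_hausdorff _ _) hl' => E;
    rewrite /derive E.
suff H' : h^-1 *: ((g \o shift x) (h *: V) - g x) @[h --> 0^'] --> l.
  by split; [apply/cvg_ex; exists l | exact/cvg_lim].
apply: cvg_trans _ H; apply: near_eq_cvg.
by near=> h; rewrite /= fgx fg//; near: h; exact: dnbhs0_lt.
Unshelve. all: by end_near. Qed.

Lemma is_derive_line f x V t l : is_derive (t *: V + x) V f l ->
  is_derive t 1 (fun s : R => f (s *: V + x)) l.
Proof.
have E : (fun h : R => h^-1 *: (((fun s : R => f (s *: V + x)) \o shift t) (h *: 1) - f (t *: V + x)))
    = (fun h : R => h^-1 *: ((f \o shift (t *: V + x)) (h *: V) - f (t *: V + x))).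
  by apply/funext => h /=; rewrite [h *: 1]mulr1 scalerDl addrA.
case=> h1 h2; split; first by rewrite /derivable E.
by rewrite /derive E.
Qed.

(** One form for both signs of c, to be applied to coordinates of tangent vectors. *)
Lemma MVT_line (f : R -> R) (df : R -> R) (c : R) :
  (forall t : R, `|t| <= `|c| -> is_derive t 1 f (df t)) ->
  exists2 t, `|t| <= `|c| & f c - f 0 = df t * c.
Proof.
move=> fdf.
have [c0|c0] := leP 0 c.
  have h (t : R) : t \in `[0, c] -> is_derive t 1 f (df t).
    by rewrite in_itv/= => /andP[t0 tc]; apply: fdf; rewrite !ger0_norm.
  have cf : {within `[0, c], continuous f}.
    by apply: derivable_within_continuous => s sc; have [] := h s sc.
  have [t t0c E] := MVT_segment c0 (fun t tc => h t (subset_itv_oo_cc tc)) cf.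
  exists t; last by rewrite E subr0.
  by move: t0c; rewrite in_itv/= => /andP[t0 tc]; rewrite !ger0_norm.
have h (t : R) : t \in `[c, 0] -> is_derive t 1 f (df t).
  rewrite in_itv/= => /andP[t0 tc]; apply: fdf; rewrite !ler0_norm// ?lerN2//.
  exact: ltW.
have cf : {within `[c, 0], continuous f}.
  by apply: derivable_within_continuous => s sc; have [] := h s sc.
have [t t0c E] := MVT_segment (ltW c0) (fun t tc => h t (subset_itv_oo_cc tc)) cf.
exists t; last by rewrite -opprB E sub0r mulrN opprK.
by move: t0c; rewrite in_itv/= => /andP[t0 tc]; rewrite !ler0_norm ?lerN2// ltW.
Qed.

Context (B : {set 'I_p}) (i0 : 'I_p).
Hypothesis i0B : i0 \in B.

Let E i : 'rV[R]_p := basis_vec R i - basis_vec R i0.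

Let E_norm i : `|E i| <= 2.
Proof.
apply: le_trans (ler_normB _ _) _; rewrite -[2]/(1 + 1).
by apply: lerD; apply: rV_norm_le => // j; rewrite mxE; case: (_ && _); rewrite ?normr1 ?normr0.
Qed.

(** [E i0] is zero; the coordinate at i0 is recovered from the zero sum. *)
Lemma tangent_expand u : face_tangent B u -> u = \sum_(i in B) u 0 i *: E i.
Proof.
move=> [u0 uB]; apply/rowP => j; rewrite summxE.
under eq_bigr do rewrite !mxE mulrBr.
rewrite sumrB -mulr_suml u0 mul0r subr0.
have [jB|jB] := boolP (j \in B); last first.
  rewrite uB// big1// => i iB; have [ji|] := eqVneq j i; last by rewrite andbF mulr0.
  by rewrite ji iB in jB.
rewrite (bigD1 j)//= eqxx mulr1 big1 ?addr0// => i /andP[_ ij].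
by rewrite eq_sym (negbTE ij) mulr0.
Qed.

(* Telescoping along the directions [E i]. *)
Lemma face_frechet f (G : 'I_p -> 'rV[R]_p -> R) y :
  (forall z i, open_face B z -> i \in B -> is_derive z (E i) f (G i z)) ->
  open_face B y ->
  (forall i, i \in B -> G i z @[z --> within (open_face B) (nbhs y)] --> G i y) ->
  forall eps : R, 0 < eps -> exists2 d, 0 < d & forall u, face_tangent B u -> `|u| < d ->
    `|f (u + y) - f y - \sum_(i in B) u 0 i * G i y| <= eps * `|u|.
Proof.
move=> fG oy cG eps eps0.
have [t t0 ht] := open_face_near oy.
pose eps' := eps / (1 + p%:R).
have p1 : 0 < 1 + p%:R :> R by rewrite ltr_pwDl.
have eps'0 : 0 < eps' by rewrite divr_gt0.
have [d1 d10 hd1] : exists2 d, 0 < d & forall z, open_face B z -> `|z - y| < d ->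
    forall i, i \in B -> `|G i z - G i y| <= eps'.
  have : \forall z \near nbhs y, forall i, i \in B -> open_face B z -> `|G i z - G i y| <= eps'.
    apply: filter_forall => i; have [iB|_] := boolP (i \in B); last exact: nearW.
    have /cvgrPdistC_le/(_ _ eps'0) := cG i iB.
    by rewrite near_withinE; apply: filterS => z hz _ /hz.
  move=> /nbhs_normP[d /= d0 hd]; exists d => // z oz zy i iB.
  by apply: hd => //=; rewrite distrC.
(* As |E i| <= 2, every point met while telescoping is within |u| D of y. *)
pose D := 2 * (1 + p%:R) : R.
have D0 : 0 < D by rewrite mulr_gt0.
exists (Num.min t d1 / D); first by rewrite divr_gt0// lt_min t0.
move=> u tu; rewrite ltr_pdivlMr// lt_min => /andP[ut ud1].
(* Partial sums of the expansion of u; consecutive ones differ by a multiple of one [E i], along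
   which the mean value theorem applies. *)
pose q n : 'rV[R]_p := \sum_(i in B | (i < n)%N) u 0 i *: E i.
have tq n : face_tangent B (q n).
  by apply: tangent_sum => i /andP[iB _]; apply: tangentZ; exact: tangent_basis.
have nq n s i : i \in B -> `|s| <= `|u 0 i| -> `|s *: E i + q n| <= `|u| * D.
  move=> iB su; apply: le_trans (ler_normD _ _) _.
  have -> : `|u| * D = `|u| * 2 + p%:R * (`|u| * 2) by rewrite /D; ring.
  apply: lerD; first by rewrite normrZ ler_pM// (le_trans su)// rV_coord_le.
  apply: le_trans (ler_norm_sum _ _ _) _.
  rewrite mulr_natl -[X in _ *+ X]card_ord -sumr_const big_mkcond/=.
  by apply: ler_sum => j _; case: ifP => _; rewrite ?mulr_ge0// normrZ ler_pM// rV_coord_le.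
have on n s i : i \in B -> `|s| <= `|u 0 i| -> open_face B (s *: E i + q n + y).
  move=> iB su; apply: ht; last exact: le_lt_trans (nq n s i iB su) ut.
  by apply: tangentD => //; apply: tangentZ; exact: tangent_basis.
have step (i : 'I_p) : `|f (q i.+1 + y) - f (q i + y) - (i \in B)%:R * (u 0 i * G i y)|
    <= eps' * `|u|.
  have [iB|iB] := boolP (i \in B); last first.
    have -> : q i.+1 = q i.
      apply: eq_bigl => j; rewrite ltnS leq_eqVlt.
      have [ji|//] := eqVneq (j : nat) i.
      by rewrite (val_inj ji : j = i) (negbTE iB).
    by rewrite subrr mul0r subrr normr0 mulr_ge0// ltW.
  have -> : q i.+1 = u 0 i *: E i + q i.
    rewrite /q (bigD1 i)/= ?iB ?ltnSn//; congr (_ + _); apply: eq_bigl => j.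
    rewrite ltnS -andbA; congr (_ && _); rewrite ltn_neqAle andbC; congr (_ && _).
  have dG (s : R) : `|s| <= `|u 0 i| ->
      is_derive s 1 (fun s : R => f (s *: E i + (q i + y))) (G i (s *: E i + (q i + y))).
    by move=> su; apply: is_derive_line; apply: fG => //; rewrite addrA; exact: on.
  have [s su sE] := MVT_line dG.
  move: sE; rewrite scale0r add0r addrA => ->.
  rewrite mul1r [u 0 i * _]mulrC -mulrBl normrM; apply: ler_pM => //; last exact: rV_coord_le.
  apply: hd1 => //; first by rewrite addrA; exact: on.
  by rewrite addrA addrK; apply: le_lt_trans ud1; exact: nq.
have -> : f (u + y) - f y - \sum_(i in B) u 0 i * G i y =
  \sum_(i < p) (f (q i.+1 + y) - f (q i + y) - (i \in B)%:R * (u 0 i * G i y)).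
  rewrite sumrB; congr (_ - _); last first.
    by rewrite big_mkcond; apply: eq_bigr => i _; case: ifP; rewrite ?mul1r ?mul0r.
  rewrite -(big_mkord xpredT (fun i => f (q i.+1 + y) - f (q i + y))) telescope_sumr//.
  congr (f (_ + y) - f _).
    rewrite {1}(tangent_expand tu); apply: eq_bigl => i; by rewrite ltn_ord andbT.
  by rewrite /q big_pred0 ?add0r// => i; rewrite ltn0 andbF.
apply: le_trans (ler_norm_sum _ _ _) _.
apply: (@le_trans _ _ (\sum_(i < p) eps' * `|u|)); first exact: ler_sum.
rewrite sumr_const card_ord -mulr_natl mulrA ler_wpM2r// /eps' mulrCA ger_pMr//.
by rewrite ler_pdivrMr// mul1r lerDr.
Qed.

End derivatives_on_faces.

(** * The chain rule for maps into an open face *)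

Section chain_rule.
Context {R : realType} {p : nat} (B : {set 'I_p}) (i0 : 'I_p).
Hypothesis i0B : i0 \in B.
Implicit Types (x y u V W : 'rV[R]_p) (f : 'rV[R]_p -> R).

(** Directional derivatives do not compose by themselves, as c need not map the line to a line. The
    estimate of [face_frechet] is uniform in the direction and applies to the difference quotients D
    of c, which converge. *)
Lemma face_chain f (G : 'I_p -> 'rV[R]_p -> R) (c : 'rV[R]_p -> 'rV[R]_p) x W (c' : 'rV[R]_p) d :
  (forall z i, open_face B z -> i \in B ->
     is_derive z (basis_vec R i - basis_vec R i0) f (G i z)) ->
  0 < d -> (forall h : R, `|h| < d -> open_face B (c (h *: W + x))) ->
  (forall i, i \in B -> G i z @[z --> within (open_face B) (nbhs (c x))] --> G i (c x)) ->
  (forall k, is_derive x W (fun z => c z 0 k) (c' 0 k)) ->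
  is_derive x W (f \o c) (\sum_(i in B) c' 0 i * G i (c x)).
Proof.
move=> fG d0 oc cG dc.
have ox : open_face B (c x) by have := oc 0; rewrite normr0 scale0r add0r; apply.
pose D h : 'rV[R]_p := h^-1 *: (c (h *: W + x) - c x).
have Dk k : D h 0 k @[h --> 0^'] --> c' 0 k.
  have -> : (fun h => D h 0 k) =
    (fun h : R => h^-1 *: (((fun z => c z 0 k) \o shift x) (h *: W) - c x 0 k)).
    by apply/funext => h; rewrite !mxE.
  by case: (dc k) => /cvg_ex[l hl] <-; rewrite /derive (cvg_lim (@norm_hausdorff _ _) hl).
have Dbd : \forall h \near 0^', `|D h| <= `|c'| + 1.
  have : \forall h \near 0^', forall k, `|D h 0 k - c' 0 k| <= 1.
    by apply: filter_forall => k; have /cvgrPdistC_le/(_ _ ltr01) := Dk k.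
  apply: filterS => h hk; apply: rV_norm_le => [|k]; first by rewrite addr_ge0.
  rewrite -[D h 0 k](subrK (c' 0 k)) addrC.
  by apply: le_trans (ler_normD _ _) _; apply: lerD => //; exact: rV_coord_le.
pose S h := \sum_(i in B) D h 0 i * G i (c x).
have cS : S h @[h --> 0^'] --> \sum_(i in B) c' 0 i * G i (c x).
  by apply: cvg_bigsum => i _; apply: cvgMl; exact: Dk.
suff H : h^-1 *: (((f \o c) \o shift x) (h *: W) - (f \o c) x) @[h --> 0^']
    --> \sum_(i in B) c' 0 i * G i (c x).
  by split; [apply/cvg_ex; eexists; exact: H | exact/cvg_lim].
pose A h := h^-1 * (f (c (h *: W + x)) - f (c x)) - S h.
suff cA : A h @[h --> 0^'] --> 0.
  rewrite -[X in _ --> X]add0r.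
  rewrite (_ : (fun h : R => _) = (fun h => A h + S h)); first exact: cvgD.
  by apply/funext => h; rewrite /A subrK.
apply/cvgrPdist_le => eps eps0.
have M0 : 0 < `|c'| + 1 by rewrite ltr_wpDl.
have [d' d'0 hd'] := face_frechet i0B fG ox cG (divr_gt0 eps0 M0).
near=> h.
have h0 : h != 0 by near: h; exact: nbhs_dnbhs_neq.
have hd : `|h| < d by near: h; exact: dnbhs0_lt.
have hD : `|D h| <= `|c'| + 1 by near: h.
pose u := c (h *: W + x) - c x.
have uD : u = h *: D h by rewrite /D scalerA mulfV// scale1r.
have tu : face_tangent B u by apply: tangent_sub; [case: (oc h hd) | case: ox].
have ud' : `|u| < d'.
  rewrite uD normrZ; apply: le_lt_trans (ler_wpM2l (normr_ge0 h) hD) _.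
  by rewrite -ltr_pdivlMr//; near: h; apply: dnbhs0_lt; rewrite divr_gt0.
have := hd' u tu ud'; rewrite {1}/u subrK => hf.
have -> : A h = h^-1 * (f (c (h *: W + x)) - f (c x) - \sum_(i in B) u 0 i * G i (c x)).
  rewrite [RHS]mulrBr; congr (_ - _); rewrite /S mulr_sumr; apply: eq_bigr => i _.
  have -> : u 0 i = h * D h 0 i by rewrite uD [LHS]mxE.
  by rewrite !mulrA mulVf// mul1r.
rewrite sub0r normrN normrM normfV ler_pdivrMl ?normr_gt0//.
apply: le_trans hf _; rewrite {1}uD normrZ mulrCA ler_wpM2l//.
by rewrite mulrAC ler_pdivrMr// ler_wpM2l// ltW.
Unshelve. all: by end_near. Qed.

End chain_rule.

(** * Partial derivatives of a C2 function on a closed face *)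

Section face_derivatives.
Context {R : realType} {p : nat} (B : {set 'I_p}) (i0 : 'I_p).
Hypothesis i0B : i0 \in B.
Implicit Types (x y u U V W : 'rV[R]_p).
Variable F : 'rV[R]_p -> R.
Hypothesis F2 : face_C2 B F.

Let E i : 'rV[R]_p := basis_vec R i - basis_vec R i0.
Let B0 : (0 < #|B|)%N. Proof. by apply/card_gt0P; exists i0. Qed.
Let tE i : i \in B -> face_tangent B (E i). Proof. by move=> ?; exact: tangent_basis. Qed.

Definition partial i y := nabla B (basis_vec R i - basis_vec R i0) F y.
Definition partial2 k i y :=
  nabla2 B (basis_vec R k - basis_vec R i0) (basis_vec R i - basis_vec R i0) F y.

Lemma partial_continuous i : i \in B -> {within face B, continuous (partial i)}.
Proof.
move=> /tE tEi; have [[_ /(_ _ tEi)[_ ext]] _] := F2.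
exact: face_extension_continuous.
Qed.

Lemma partial2_continuous k i : k \in B -> i \in B ->
  {within face B, continuous (partial2 k i)}.
Proof.
move=> /tE tk /tE ti; have [_ /(_ _ _ tk ti)[_ ext]] := F2.
exact: face_extension_continuous.
Qed.

Lemma within_open_face (f : 'rV[R]_p -> R) y : open_face B y ->
  {within face B, continuous f} ->
  f z @[z --> within (open_face B) (nbhs y)] --> f y.
Proof.
move=> [fy _] /subspace_continuousP/(_ y fy) h.
move=> Q /h hQ; have {}hQ : nbhs y (fun z => face B z -> Q (f z)) := hQ.
by suff : nbhs y (fun z => open_face B z -> Q (f z)) by []; apply: filterS hQ => z hz [/hz].
Qed.

Lemma partial_open i y : i \in B -> open_face B y -> partial i y = dirder F (E i) y.
Proof.
move=> /tE tEi oy; have [[_ /(_ _ tEi)[_ ext]] _] := F2.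
exact: face_extension_open.
Qed.

Lemma partialP y i : open_face B y -> i \in B -> is_derive y (E i) F (partial i y).
Proof.
move=> oy iB; rewrite partial_open//.
have [[_ /(_ _ (tE iB))[df _]] _] := F2.
by have /derivableP := df y oy.
Qed.

(** [partial] agrees with the directional derivative of F only on the open face, which contains the
    line near y. *)
Lemma partial2P y i k : i \in B -> open_face B y -> k \in B ->
  is_derive y (E k) (partial i) (partial2 k i y).
Proof.
move=> iB oy kB.
have [_ /(_ _ _ (tE kB) (tE iB))[df ext]] := F2.
have [d d0 hd] := open_face_line oy (tE kB).
apply: (@is_derive_eq_line _ _ (dirder F (E i)) _ _ _ _ d d0).
  by move=> h /hd/(partial_open iB)->.
rewrite /partial2 /nabla2 (face_extension_open B0 ext oy).
by have /derivableP := df y oy.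
Qed.

(** Linearity in the direction, from the chain rule for the identity map. *)
Lemma dirder_open U y : face_tangent B U -> open_face B y ->
  dirder F U y = \sum_(i in B) U 0 i * partial i y.
Proof.
move=> tU oy; have [d d0 hd] := open_face_line oy tU.
have h : is_derive y U (F \o id) (\sum_(i in B) U 0 i * partial i y).
  apply: (@face_chain _ _ B i0 i0B F partial id y U U d) => //.
  - by move=> z i oz iB; exact: partialP.
  - by move=> i iB; apply: within_open_face => //; exact: partial_continuous.
  - move=> k; apply: (@is_derive_linear_error _ _ _ _ _ _ 0 1) => // h _.
    by rewrite !mxE addrK subrr normr0 mul0r.
by case: h.
Qed.

Lemma nablaE U y : face_tangent B U -> face B y ->
  nabla B U F y = \sum_(i in B) U 0 i * partial i y.
Proof.
move=> tU fy.
apply: (@face_extension_eq _ _ _ _ (fun y => \sum_(i in B) U 0 i * partial i y)) => //.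
  apply/subspace_continuousP => z fz; apply: cvg_bigsum => i iB; apply: cvgMr.
  by have /subspace_continuousP := partial_continuous iB; apply.
by move=> z oz; rewrite dirder_open.
Qed.

Lemma nabla2E U W y : face_tangent B U -> face_tangent B W -> face B y ->
  nabla2 B U W F y = \sum_(i in B) W 0 i * \sum_(k in B) U 0 k * partial2 k i y.
Proof.
move=> tU tW fy.
apply: (@face_extension_eq _ _ _ _
  (fun y => \sum_(i in B) W 0 i * \sum_(k in B) U 0 k * partial2 k i y)) => //.
  apply/subspace_continuousP => z fz; apply: cvg_bigsum => i iB; apply: cvgMr.
  apply: cvg_bigsum => k kB; apply: cvgMr.
  by have /subspace_continuousP := partial2_continuous kB iB; apply.
move=> z oz; have [d d0 hd] := open_face_line oz tU.
have dp i : i \in B -> is_derive z U (partial i) (\sum_(k in B) U 0 k * partial2 k i z).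
  move=> iB; apply: (@face_chain _ _ B i0 i0B (partial i) (fun k => partial2 k i) id z U U d) => //.
  - by move=> y' k oy' kB; exact: partial2P.
  - by move=> k kB; apply: within_open_face => //; exact: partial2_continuous.
  - move=> k; apply: (@is_derive_linear_error _ _ _ _ _ _ 0 1) => // h _.
    by rewrite !mxE addrK subrr normr0 mul0r.
have H : is_derive z U (fun y => \sum_(i in B) W 0 i * partial i y)
    (\sum_(i in B) W 0 i * \sum_(k in B) U 0 k * partial2 k i z).
  by apply: is_derive_bigsum => i iB; apply: is_derive_cmul; exact: dp.
have : is_derive z U (dirder F W) (\sum_(i in B) W 0 i * \sum_(k in B) U 0 k * partial2 k i z).
  by apply: (is_derive_eq_line d0 _ H) => h /hd oh; rewrite dirder_open.
by case.
Qed.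

End face_derivatives.

(** * Functions in the full domain *)

Section test_function.
Context {R : realType} {p : nat} (B : {set 'I_p}) (i0 : 'I_p).
Hypothesis i0B : i0 \in B.
Variables (P L : 'M[R]_p) (w : 'I_p -> 'rV[R]_p) (C : R).
Hypothesis bar : barrier P w C.
Hypothesis L_ge0 : forall i j, 0 <= L i j.
Hypothesis L_out : forall i j, j \notin B -> L i j = 0.
Hypothesis L_sum : forall i, \sum_j L i j = 1.
Hypothesis L_id : forall i j, i \in B -> L i j = (i == j)%:R.

Variable e : R.
Hypothesis e_ok : small_scale p C e.

Variable F : 'rV[R]_p -> R.
Hypothesis F2 : face_C2 B F.

Implicit Types (x y u U V W : 'rV[R]_p).

Let a := lcp P e.
Let a' := lcp' P e.
Let a'' := lcp'' P e.

Definition retract x : 'rV[R]_p := (x - a x *m (P - 1%:M)) *m L.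
Definition retract' x V : 'rV[R]_p := (V - a' x V *m (P - 1%:M)) *m L.
Definition retract'' x W V : 'rV[R]_p := - (a'' x W V *m (P - 1%:M)) *m L.

Definition lift : 'rV[R]_p -> R := F \o retract.
Definition lift' V x : R := \sum_(i in B) retract' x V 0 i * partial B i0 F i (retract x).
Definition lift'' W V x : R := \sum_(i in B)
  (retract' x V 0 i * (\sum_(k in B) retract' x W 0 k * partial2 B i0 F k i (retract x))
   + retract'' x W V 0 i * partial B i0 F i (retract x)).

Lemma face_setT x : face [set: 'I_p]%SET x <-> simplex x.
Proof.
split=> [[]//|sx]; split => //; case: (sx) => _ <-.
by apply: eq_bigl => i; rewrite inE.
Qed.

Lemma mulmx_sum1 (M : 'M[R]_p) u : (forall i, \sum_j M i j = 1) ->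
  \sum_j (u *m M) 0 j = \sum_j u 0 j.
Proof.
move=> M1; under eq_bigr do rewrite mxE.
rewrite exchange_big/=; apply: eq_bigr => i _.
by rewrite -mulr_sumr M1 mulr1.
Qed.

Lemma rVB_E (A D : 'rV[R]_p) j : (A - D) 0 j = A 0 j - D 0 j.
Proof. by rewrite !mxE. Qed.

Lemma mulmx_gen_sum0 u : \sum_j (u *m (P - 1%:M)) 0 j = 0.
Proof.
rewrite mulmxBr mulmx1; under eq_bigr do rewrite rVB_E.
rewrite sumrB mulmx_sum1 ?subrr//; exact: barrier_P_sum bar.
Qed.

Lemma mulmxL_ge y j : (forall i, 0 <= y 0 i) -> j \in B -> y 0 j <= (y *m L) 0 j.
Proof.
move=> y0 jB; rewrite mxE (bigD1 j)//= L_id// eqxx mulr1 lerDl.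
by rewrite sumr_ge0// => k _; rewrite mulr_ge0.
Qed.

Lemma retract_ge x j : simplex x -> j \in B -> e <= retract x 0 j.
Proof.
move=> sx jB; have h i := lcp_repulsion bar e_ok i sx.
apply: le_trans (h j) _; apply: mulmxL_ge => // i.
by apply: le_trans (h i); apply: ltW; case: e_ok.
Qed.

Lemma retract_sum x : simplex x -> \sum_j retract x 0 j = 1.
Proof.
move=> [_ sx]; rewrite mulmx_sum1//; under eq_bigr do rewrite rVB_E.
by rewrite sumrB mulmx_gen_sum0 subr0.
Qed.

Lemma mulmxL_out y j : j \notin B -> (y *m L) 0 j = 0.
Proof. by move=> jB; rewrite mxE big1// => k _; rewrite L_out// mulr0. Qed.

Lemma mulmxL_tangent y : \sum_j y 0 j = 0 -> face_tangent B (y *m L).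
Proof.
move=> y0; split; last exact: mulmxL_out.
have : \sum_j (y *m L) 0 j = 0 by rewrite mulmx_sum1.
rewrite (bigID (mem B))/= [X in _ + X]big1 ?addr0// => k kB.
exact: mulmxL_out.
Qed.

(** Even for x on the boundary, F and its derivatives are evaluated in the open face only; the
    smoothness of [lift] thus needs no boundary behaviour of F. *)
Lemma retract_open x : simplex x -> open_face B (retract x).
Proof.
move=> sx; have e0 : 0 < e by case: e_ok.
have pos j : j \in B -> 0 < retract x 0 j.
  by move=> jB; apply: lt_le_trans e0 (retract_ge sx jB).
split => //; apply: face_intro => [j|j jB|]; last exact: retract_sum.
  by have [/pos/ltW//|jB] := boolP (j \in B); rewrite /retract mulmxL_out.
exact: mulmxL_out.
Qed.

Let coordE (A : 'rV[R]_p) u k : ((u - A *m (P - 1%:M)) *m L) 0 k =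
  \sum_l (u 0 l - \sum_j A 0 j * (P - 1%:M) j l) * L l k.
Proof. by rewrite mxE; apply: eq_bigr => l _; rewrite rVB_E [X in _ - X]mxE. Qed.

Lemma simplex_line x V : open_face [set: 'I_p]%SET x -> face_tangent [set: 'I_p]%SET V ->
  exists2 d : R, 0 < d & forall h : R, `|h| < d -> simplex (h *: V + x).
Proof.
move=> ox tV; have [d d0 hd] := open_face_line ox tV; exists d => // h /hd[].
by case.
Qed.

Lemma coord_derive x V k : is_derive x V (fun z : 'rV[R]_p => z 0 k) (V 0 k).
Proof.
apply: (@is_derive_linear_error _ _ _ _ _ _ 0 1) => // h _.
by rewrite !mxE addrK subrr normr0 mul0r.
Qed.

Lemma coord_cvg (A : set 'rV[R]_p) x k : z 0 k @[z --> within A (nbhs x)] --> x 0 k.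
Proof.
apply: (@cvg_within_linear_error _ _ A (fun z : 'rV[R]_p => z 0 k) x 1 1) => // y _ _.
by rewrite mul1r; apply: le_trans (rV_coord_le _ k); rewrite rVB_E.
Qed.

Lemma retract_derive x V k : open_face [set: 'I_p]%SET x -> face_tangent [set: 'I_p]%SET V ->
  is_derive x V (fun z => retract z 0 k) (retract' x V 0 k).
Proof.
move=> ox tV; have sx : simplex x by case: ox => -[].
rewrite coordE.
have -> : (fun z => retract z 0 k) =
  (fun z => \sum_l L l k * (z 0 l + -1 * \sum_j (P - 1%:M) j l * a z 0 j)).
  apply/funext => z; rewrite coordE; apply: eq_bigr => l _; rewrite mulrC; congr (_ * _).
  by rewrite mulN1r; congr (_ - _); apply: eq_bigr => j _; rewrite mulrC.
have -> : \sum_l (V 0 l - \sum_j a' x V 0 j * (P - 1%:M) j l) * L l k =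
  \sum_l L l k * (V 0 l + -1 * \sum_j (P - 1%:M) j l * a' x V 0 j).
  apply: eq_bigr => l _; rewrite mulrC; congr (_ * _).
  by rewrite mulN1r; congr (_ - _); apply: eq_bigr => j _; rewrite mulrC.
apply: is_derive_bigsum => l _; apply: is_derive_cmul.
apply: (@is_deriveD _ _ _ (fun z : 'rV[R]_p => z 0 l)
  (fun z => -1 * \sum_j (P - 1%:M) j l * a z 0 j)); first exact: coord_derive.
apply: is_derive_cmul; apply: is_derive_bigsum => j _; apply: is_derive_cmul.
by apply: (lcp_derive bar e_ok) => //; exact: simplex_line.
Qed.

Lemma retract'_derive x W V k : open_face [set: 'I_p]%SET x -> face_tangent [set: 'I_p]%SET W ->
  is_derive x W (fun z => retract' z V 0 k) (retract'' x W V 0 k).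
Proof.
move=> ox tW; have sx : simplex x by case: ox => -[].
rewrite /retract'' -[- _]add0r coordE.
have -> : (fun z => retract' z V 0 k) =
  (fun z => \sum_l L l k * (V 0 l + -1 * \sum_j (P - 1%:M) j l * a' z V 0 j)).
  apply/funext => z; rewrite coordE; apply: eq_bigr => l _; rewrite mulrC; congr (_ * _).
  by rewrite mulN1r; congr (_ - _); apply: eq_bigr => j _; rewrite mulrC.
have -> : \sum_l ((0 : 'rV[R]_p) 0 l - \sum_j a'' x W V 0 j * (P - 1%:M) j l) * L l k =
  \sum_l L l k * (0 + -1 * \sum_j (P - 1%:M) j l * a'' x W V 0 j).
  apply: eq_bigr => l _; rewrite mulrC [(0 : 'rV[R]_p) 0 l]mxE; congr (_ * _).
  by rewrite mulN1r; congr (_ - _); apply: eq_bigr => j _; rewrite mulrC.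
apply: is_derive_bigsum => l _; apply: is_derive_cmul.
apply: (@is_deriveD _ _ _ (fun z : 'rV[R]_p => V 0 l)
  (fun z => -1 * \sum_j (P - 1%:M) j l * a' z V 0 j)).
apply: is_derive_cmul; apply: is_derive_bigsum => j _; apply: is_derive_cmul.
by apply: (lcp'_derive bar e_ok) => //; exact: simplex_line.
Qed.

Let S := @simplex R p.

Lemma retract_cvg x k : simplex x ->
  retract z 0 k @[z --> within S (nbhs x)] --> retract x 0 k.
Proof.
move=> sx; rewrite coordE; under eq_fun do rewrite coordE.
apply: cvg_bigsum => l _; apply: cvgMl; apply: cvgB; first exact: coord_cvg.
by apply: cvg_bigsum => j _; apply: cvgMl; exact: (lcp_cvg bar e_ok).
Qed.

Lemma retract'_cvg x V k : simplex x ->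
  retract' z V 0 k @[z --> within S (nbhs x)] --> retract' x V 0 k.
Proof.
move=> sx; rewrite coordE; under eq_fun do rewrite coordE.
apply: cvg_bigsum => l _; apply: cvgMl; apply: cvgB; first exact: cvg_cst.
by apply: cvg_bigsum => j _; apply: cvgMl; exact: (lcp'_cvg bar e_ok).
Qed.

Lemma retract''_cvg x W V k : simplex x ->
  retract'' z W V 0 k @[z --> within S (nbhs x)] --> retract'' x W V 0 k.
Proof.
move=> sx.
have E z : retract'' z W V 0 k =
    \sum_l ((0 : 'rV[R]_p) 0 l - \sum_j a'' z W V 0 j * (P - 1%:M) j l) * L l k.
  by rewrite /retract'' -[- _]add0r coordE.
rewrite E; under eq_fun do rewrite E.
apply: cvg_bigsum => l _; apply: cvgMl; apply: cvgB; first exact: cvg_cst.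
by apply: cvg_bigsum => j _; apply: cvgMl; exact: (lcp''_cvg bar e_ok).
Qed.

Lemma rV_cvg (T : Type) (G : set_system T) {FG : Filter G} (c : T -> 'rV[R]_p) (l : 'rV[R]_p) :
  (forall k, c t 0 k @[t --> G] --> l 0 k) -> c t @[t --> G] --> l.
Proof.
move=> h; apply/cvgrPdist_le => eps eps0.
have : \forall t \near G, forall k, `|l 0 k - c t 0 k| <= eps.
  by apply: filter_forall => k; have /cvgrPdist_le/(_ _ eps0) := h k.
apply: filterS => t ht; apply: rV_norm_le => [|k]; first exact: ltW.
by rewrite rVB_E.
Qed.

Lemma comp_retract_cvg (f : 'rV[R]_p -> R) x : simplex x -> {within face B, continuous f} ->
  f (retract z) @[z --> within S (nbhs x)] --> f (retract x).
Proof.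
move=> sx /subspace_continuousP cf.
have cr : retract z @[z --> within S (nbhs x)] --> retract x.
  by apply: rV_cvg => k; exact: retract_cvg.
have fr : face B (retract x) by case: (retract_open sx).
have {}cf := cf _ fr; move=> Q /cf hQ.
have {}hQ : nbhs (retract x) (fun z => face B z -> Q (f z)) := hQ.
have h := cr _ hQ; have {}h : \forall z \near nbhs x, S z -> face B (retract z) -> Q (f (retract z)) := h.
suff : \forall z \near nbhs x, S z -> Q (f (retract z)) by [].
by apply: filterS h => z hz Sz; apply: hz => //; case: (retract_open Sz).
Qed.

Lemma lift_cvg x : simplex x -> lift z @[z --> within S (nbhs x)] --> lift x.
Proof. by move=> sx; apply: comp_retract_cvg => //; case: F2 => -[]. Qed.

Lemma lift'_cvg x V : simplex x -> lift' V z @[z --> within S (nbhs x)] --> lift' V x.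
Proof.
move=> sx; apply: cvg_bigsum => i iB; apply: cvgM; first exact: retract'_cvg.
by apply: comp_retract_cvg => //; exact: partial_continuous.
Qed.

Lemma lift''_cvg x W V : simplex x -> lift'' W V z @[z --> within S (nbhs x)] --> lift'' W V x.
Proof.
move=> sx; apply: cvg_bigsum => i iB; apply: cvgD; apply: cvgM; [exact: retract'_cvg| |
  exact: retract''_cvg|by apply: comp_retract_cvg => //; exact: partial_continuous].
apply: cvg_bigsum => k kB; apply: cvgM; first exact: retract'_cvg.
by apply: comp_retract_cvg => //; exact: partial2_continuous.
Qed.

Lemma lift_derive x V : open_face [set: 'I_p]%SET x -> face_tangent [set: 'I_p]%SET V ->
  is_derive x V lift (lift' V x).
Proof.
move=> ox tV; have [d d0 hd] := simplex_line ox tV.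
have sx : simplex x by case: ox => -[].
apply: (face_chain i0B (partialP i0B F2) d0) => //.
- by move=> h /hd; exact: retract_open.
- move=> i iB; apply: within_open_face; [exact: retract_open|exact: partial_continuous].
- by move=> k; exact: retract_derive.
Qed.

Lemma lift'_derive x W V : open_face [set: 'I_p]%SET x -> face_tangent [set: 'I_p]%SET W ->
  is_derive x W (lift' V) (lift'' W V x).
Proof.
move=> ox tW; have [d d0 hd] := simplex_line ox tW.
have sx : simplex x by case: ox => -[].
apply: is_derive_bigsum => i iB; apply: is_derive_mul; first exact: retract'_derive.
apply: (@face_chain _ _ B i0 i0B (partial B i0 F i) (fun k => partial2 B i0 F k i) retract x W _ d) => //.
- by move=> z k oz kB; exact: partial2P.
- by move=> h /hd; exact: retract_open.
- move=> k kB; apply: within_open_face; [exact: retract_open|exact: partial2_continuous].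
- by move=> k; exact: retract_derive.
Qed.

Lemma face_setTE : face [set: 'I_p]%SET = S.
Proof. by apply/seteqP; split => x /face_setT. Qed.

Lemma dirder_lift x V : open_face [set: 'I_p]%SET x -> face_tangent [set: 'I_p]%SET V ->
  dirder lift V x = lift' V x.
Proof. by move=> ox tV; have [] := lift_derive ox tV. Qed.

Lemma dirder_lift'_derive x W V : open_face [set: 'I_p]%SET x ->
  face_tangent [set: 'I_p]%SET W -> face_tangent [set: 'I_p]%SET V ->
  is_derive x W (dirder lift V) (lift'' W V x).
Proof.
move=> ox tW tV; have [d d0 hd] := open_face_line ox tW.
apply: (is_derive_eq_line d0 _ (lift'_derive V ox tW)) => h /hd oh.
by rewrite dirder_lift.
Qed.

Lemma lift_C2 : face_C2 [set: 'I_p]%SET lift.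
Proof.
split.
  split; first by rewrite face_setTE; apply/subspace_continuousP; exact: lift_cvg.
  move=> V tV; split; first by move=> x ox; have [] := lift_derive ox tV.
  exists (lift' V); last by move=> x ox; rewrite dirder_lift.
  by rewrite face_setTE; apply/subspace_continuousP => x; exact: lift'_cvg.
move=> V W tV tW; split; first by move=> x ox; have [] := dirder_lift'_derive ox tV tW.
exists (lift'' V W); last by move=> x ox; have [] := dirder_lift'_derive ox tV tW.
by rewrite face_setTE; apply/subspace_continuousP => x; exact: lift''_cvg.
Qed.

Let setT_gt0 : (0 < #|[set: 'I_p]%SET|)%N.
Proof. by apply/card_gt0P; exists i0; rewrite inE. Qed.

Lemma nabla_lift x V : simplex x -> face_tangent [set: 'I_p]%SET V ->
  nabla [set: 'I_p]%SET V lift x = lift' V x.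
Proof.
move=> sx tV; apply: face_extension_eq => //; last exact/face_setT.
  by rewrite face_setTE; apply/subspace_continuousP => y; exact: lift'_cvg.
by move=> y oy; rewrite dirder_lift.
Qed.

Lemma nabla2_lift x W V : simplex x -> face_tangent [set: 'I_p]%SET W ->
  face_tangent [set: 'I_p]%SET V ->
  nabla2 [set: 'I_p]%SET W V lift x = lift'' W V x.
Proof.
move=> sx tW tV; apply: face_extension_eq => //; last exact/face_setT.
  by rewrite face_setTE; apply/subspace_continuousP => y; exact: lift''_cvg.
by move=> y oy; have [] := dirder_lift'_derive oy tW tV.
Qed.

Lemma retract'_strip x k : simplex x -> x 0 k <= e -> retract' x (row k (P - 1%:M)) = 0.
Proof.
by move=> sx xk; rewrite /retract' /a' (lcp'_strip bar e_ok)// -rowE subrr mul0mx.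
Qed.

Lemma lift'_strip x k : simplex x -> x 0 k <= e -> lift' (row k (P - 1%:M)) x = 0.
Proof.
move=> sx xk; rewrite /lift' retract'_strip// big1// => i _.
by rewrite mxE mul0r.
Qed.

End test_function.

(** * Functions in the domain of a face at its boundary *)

Section boundary_behaviour.
Context {R : realType} {p : nat} (B : {set 'I_p}) (i0 : 'I_p).
Hypothesis i0B : i0 \in B.
Implicit Types (x y u U V W : 'rV[R]_p).

Let B0 : (0 < #|B|)%N. Proof. by apply/card_gt0P; exists i0. Qed.

Lemma face_compact : compact (face B : set 'rV[R]_p).
Proof.
apply: bounded_closed_compact.
  exists 1; split => // M M1 x [sx _]; apply: rV_norm_le => [|j]; first exact: ltW (lt_trans ltr01 M1).
  by case: (sx) => x0 _; rewrite ger0_norm//; apply: le_trans (ltW M1); exact: simplex_le1.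
have cc (Q : pred 'I_p) : continuous (fun x : 'rV[R]_p => \sum_(j | Q j) x 0 j).
  move=> x; apply: (@cvg_bigsum R _ _ (nbhs x) _ _ _ (fun j z => z 0 j) (fun j => x 0 j)) => j _.
  exact: coord_continuous.
have -> : (face B : set 'rV[R]_p) =
    \bigcap_(i : 'I_p) [set x | 0 <= x 0 i] `&` [set x | \sum_i x 0 i = 1]
    `&` [set x | \sum_(j in B) x 0 j = 1].
  apply/seteqP; split => x; first by move=> [[x0 x1] xB]; split => //; split => // i _; exact: x0.
  by move=> [[x0 x1] xB]; split => //; split => // i; exact: x0.
apply: closedI; last by apply: (closed_comp (f := fun x : 'rV[R]_p => \sum_(j in B) x 0 j)) (@closed_eq R 1) => x _; exact: cc.
apply: closedI; last by apply: (closed_comp (f := fun x : 'rV[R]_p => \sum_j x 0 j)) (@closed_eq R 1) => x _; exact: cc.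
apply: closed_bigI => i _.
by apply: (closed_comp (f := fun x : 'rV[R]_p => x 0 i)) (@closed_ge R 0) => x _; exact: coord_continuous.
Qed.

Lemma face_bounded (f : 'rV[R]_p -> R) : {within face B, continuous f} ->
  exists2 M, 0 <= M & forall x, face B x -> `|f x| <= M.
Proof.
move=> cf; have /compact_bounded[M [_ hM]] := continuous_compact cf face_compact.
exists (`|M| + 1) => [|x fx]; first by rewrite addr_ge0.
by apply: (hM (`|M| + 1)); [rewrite ltr_pwDr// ler_norm|exists x].
Qed.

Lemma face_extension_unique (f g : 'rV[R]_p -> R) x :
  {within face B, continuous f} -> {within face B, continuous g} ->
  (forall y, open_face B y -> f y = g y) -> face B x -> f x = g x.
Proof.
move=> cf cg fg fx.
have E1 := face_extension_eq B0 cf (fun _ _ => erefl) fx.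
by rewrite -E1 (face_extension_eq B0 cg (fun y oy => esym (fg y oy)) fx).
Qed.

Variable F : 'rV[R]_p -> R.
Hypothesis F2 : face_C2 B F.

Let E i : 'rV[R]_p := basis_vec R i - basis_vec R i0.
Let G := partial B i0 F.
Let G2 := partial2 B i0 F.
Let tE i : i \in B -> face_tangent B (E i). Proof. by move=> ?; exact: tangent_basis. Qed.

(** The second difference of F over a small parallelogram, treated by two mean values in either
    order of the directions, is s^2 times a nearby value of each mixed derivative. *)
Let schwarz_open y i k : i \in B -> k \in B -> open_face B y -> G2 k i y = G2 i k y.
Proof.
move=> iB kB oy; apply/eqP; rewrite -subr_eq0 -normr_le0; apply/ler_addgt0Pr => eps eps0.
rewrite add0r.
have c i' k' : i' \in B -> k' \in B -> exists2 d, 0 < d & forall z, open_face B z ->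
    `|z - y| < d -> `|G2 k' i' z - G2 k' i' y| <= eps / 2.
  move=> i'B k'B.
  have := within_open_face oy (partial2_continuous i0B F2 k'B i'B).
  move=> /cvgrPdistC_le/(_ (eps / 2)); rewrite divr_gt0// => /(_ isT).
  rewrite near_withinE => /nbhs_normP[d /= d0 hd]; exists d => // z oz zy.
  by apply: hd => //=; rewrite distrC.
have [d1 d10 h1] := c i k iB kB; have [d2 d20 h2] := c k i kB iB.
have [t t0 ht] := open_face_near oy.
pose M := Num.min t (Num.min d1 d2).
have M0 : 0 < M by rewrite !lt_min t0 d10.
pose K := 1 + `|E i| + `|E k|.
have K0 : 0 < K by rewrite /K -addrA ltr_pwDl// addr_ge0.
pose s := M / 2 / K.
have s0 : 0 < s by rewrite !divr_gt0.
have sK : s * K < M by rewrite /s divfK ?gt_eqF// ltr_pdivrMr// ltr_pMr// ltr1n.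
clearbody s.
have near a b : `|a| <= `|s| -> `|b| <= `|s| -> `|a *: E i + b *: E k| < M.
  move=> ha hb; apply: (@le_lt_trans _ _ (`|s| * K)).
    apply: le_trans (ler_normD _ _) _; rewrite !normrZ.
    apply: (@le_trans _ _ (`|s| * `|E i| + `|s| * `|E k|)).
      by apply: lerD; rewrite ler_wpM2r.
    by rewrite -mulrDr ler_wpM2l// /K -addrA lerDr.
  by rewrite gtr0_norm.
have on a b : `|a| <= `|s| -> `|b| <= `|s| -> open_face B (a *: E i + b *: E k + y).
  move=> ha hb; apply: ht; first by apply: tangentD; apply: tangentZ; exact: tE.
  by apply: lt_le_trans (near a b ha hb) _; rewrite ge_min lexx.
have S0 : `|0 : R| <= `|s| by rewrite normr0.
have diff2 (i' k' : 'I_p) : i' \in B -> k' \in B ->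
  (forall a b, `|a| <= `|s| -> `|b| <= `|s| -> open_face B (a *: E i' + (b *: E k' + y))) ->
  exists a b, [/\ `|a| <= `|s|, `|b| <= `|s| &
    F (s *: E i' + (s *: E k' + y)) - F (s *: E i' + y) - F (s *: E k' + y) + F y
    = s * (s * G2 k' i' (a *: E i' + (b *: E k' + y)))].
  move=> i'B k'B on'.
  have d1F (a : R) : `|a| <= `|s| -> is_derive a 1
      (fun a : R => F (a *: E i' + (s *: E k' + y)) - F (a *: E i' + y))
      (G i' (a *: E i' + (s *: E k' + y)) - G i' (a *: E i' + y)).
    move=> ha; apply: (@is_deriveB _ _ _ (fun a : R => F (a *: E i' + (s *: E k' + y)))
      (fun a : R => F (a *: E i' + y))); apply: is_derive_line; apply: partialP => //.
      exact: on'.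
    by have := on' a 0 ha S0; rewrite scale0r add0r.
  have [a ha Ea] := MVT_line d1F.
  have d2F (b : R) : `|b| <= `|s| -> is_derive b 1
      (fun b : R => G i' (b *: E k' + (a *: E i' + y))) (G2 k' i' (b *: E k' + (a *: E i' + y))).
    by move=> hb; apply: is_derive_line; apply: partial2P => //; rewrite addrCA; exact: on'.
  have [b hb Eb] := MVT_line d2F.
  exists a, b; split => //; move: Ea Eb; rewrite !scale0r !add0r => Ea Eb.
  have -> : s * G2 k' i' (a *: E i' + (b *: E k' + y)) =
      G i' (a *: E i' + (s *: E k' + y)) - G i' (a *: E i' + y).
    by rewrite mulrC [a *: E i' + (b *: _ + _)]addrCA -Eb [s *: E k' + (a *: _ + _)]addrCA.
  rewrite [RHS]mulrC -Ea; move: (F _) (F _) (F _) (F _) => f1 f2 f3 f4; ring.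
have [a [b [ha hb Eab]]] := diff2 i k iB kB (fun a b ha hb => eq_ind _ _ (on a b ha hb) _ (esym (addrA _ _ _))).
have on2 a' b' : `|a'| <= `|s| -> `|b'| <= `|s| -> open_face B (a' *: E k + (b' *: E i + y)).
  by move=> h h'; rewrite addrA [_ *: E k + _]addrC; exact: on.
have [a' [b' [ha' hb' Eab']]] := diff2 k i kB iB on2.
rewrite [s *: E k + (s *: E i + y)]addrCA in Eab'.
have Eq : G2 k i (a *: E i + (b *: E k + y)) = G2 i k (a' *: E k + (b' *: E i + y)).
  have s0' : s != 0 by rewrite gt_eqF.
  move: Eab Eab'.
  move: (F _) (F _) (F _) (F _) (G2 _ _ _) (G2 _ _ _) => f1 f2 f3 f4 g g' h h'.
  have : s * (s * g) = s * (s * g') by rewrite -h -h'; ring.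
  by move=> /(mulfI s0')/(mulfI s0').
have n1 : `|G2 k i (a *: E i + (b *: E k + y)) - G2 k i y| <= eps / 2.
  apply: h1; first by rewrite addrA; exact: on.
  rewrite addrA addrK; apply: lt_le_trans (near a b ha hb) _.
  by rewrite /M ge_min ge_min lexx orbT.
have n2 : `|G2 i k (a' *: E k + (b' *: E i + y)) - G2 i k y| <= eps / 2.
  apply: h2; first exact: on2.
  rewrite addrA addrK addrC; apply: lt_le_trans (near b' a' hb' ha') _.
  by rewrite /M ge_min ge_min lexx !orbT.
move: n1 n2; rewrite Eq.
move: (G2 i k (a' *: _ + _)) (G2 k i y) (G2 i k y) => g g1 g2 n1 n2.
have -> : g1 - g2 = - (g - g1) + (g - g2) by ring.
by apply: le_trans (ler_normD _ _) _; rewrite normrN [leRHS]splitr lerD.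
Qed.

Lemma partial2_sym i k y : i \in B -> k \in B -> face B y -> G2 k i y = G2 i k y.
Proof.
move=> iB kB; apply: face_extension_unique; try exact: partial2_continuous.
by move=> z; exact: schwarz_open.
Qed.

End boundary_behaviour.

(** * Derivatives along the drifts where a coordinate vanishes *)

Section drift_at_boundary.
Context {R : realType} {p : nat} (B : {set 'I_p}) (i0 : 'I_p).
Hypothesis i0B : i0 \in B.
Implicit Types (x y z u U V W : 'rV[R]_p).

Let B0 : (0 < #|B|)%N. Proof. by apply/card_gt0P; exists i0. Qed.

Lemma open_face_conv x z t : face B x -> open_face B z -> 0 < t <= 1 ->
  open_face B (t *: (z - x) + x).
Proof.
move=> fx [fz z0] /andP[t0 t1].
have co j : (t *: (z - x) + x) 0 j = t * z 0 j + (1 - t) * x 0 j by rewrite !mxE; ring.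
have xj j : 0 <= (1 - t) * x 0 j by case: fx => -[x0 _] _; rewrite mulr_ge0 ?subr_ge0.
split; last by move=> j jB; rewrite co ltr_wpDr// mulr_gt0// z0.
apply: face_intro => [i|i iB|].
- by rewrite co addr_ge0// mulr_ge0 ?(ltW t0)//; case: fz => -[].
- by rewrite co (face_out fx iB) (face_out fz iB) !mulr0 addr0.
under eq_bigr do rewrite co.
rewrite big_split/= -!mulr_sumr; case: fx fz => -[_ ->] _ [[_ ->] _]; ring.
Qed.

Variables (m lam : 'I_p -> R) (rB : 'I_p -> 'I_p -> R) (nu : 'I_p -> 'rV[R]_p).
Hypothesis m_gt0 : forall j, 0 < m j.
Hypothesis lam_gt0 : forall j, 0 < lam j.
Hypothesis nu_drift : forall j, j \in B -> drift_vec rB B j = lam j *: nu j.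
Hypothesis nu_tangent : forall j, j \in B -> face_tangent B (nu j).

Variable F : 'rV[R]_p -> R.
Hypothesis FD : domain m rB B F.

Let F2 : face_C2 B F := proj1 FD.
Let E i : 'rV[R]_p := basis_vec R i - basis_vec R i0.
Let G := partial B i0 F.
Let G2 := partial2 B i0 F.
Let K j := drift_term m rB B j F.

(** [nu j] is the drift of j in the trace chain divided by the holding rate [lam j]. *)
Definition jump_deriv j y := \sum_(i in B) nu j 0 i * G i y.
Definition jump_deriv2 j k y := \sum_(i in B) nu j 0 i * G2 k i y.

Lemma jump_deriv_continuous j : {within face B, continuous (jump_deriv j)}.
Proof.
apply/subspace_continuousP => y fy; apply: cvg_bigsum => i iB; apply: cvgMr.
by have /subspace_continuousP := partial_continuous i0B F2 iB; apply.
Qed.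

Lemma jump_deriv2_continuous j k : k \in B -> {within face B, continuous (jump_deriv2 j k)}.
Proof.
move=> kB; apply/subspace_continuousP => y fy; apply: cvg_bigsum => i iB; apply: cvgMr.
by have /subspace_continuousP := partial2_continuous i0B F2 kB iB; apply.
Qed.

Lemma drift_termE j y : j \in B -> face B y ->
  K j y = (0 < y 0 j)%R%:R * (m j / y 0 j) * (lam j * jump_deriv j y).
Proof.
move=> jB fy; congr (_ * _); rewrite (nablaE i0B F2) ?nu_drift//; last first.
  by apply: tangentZ; exact: nu_tangent.
by rewrite mulr_sumr; apply: eq_bigr => i _; rewrite mxE mulrA.
Qed.

Lemma drift_term0 j y : y 0 j = 0 -> K j y = 0.
Proof. by move=> y0; rewrite /K /drift_term y0 ltxx !mul0r. Qed.

(** Immediate on the open face; both sides are continuous up to the boundary by the definition of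
    the domain. As the drift term is bounded, [jump_deriv j] is O(y_j). *)
Lemma jump_derivE j y : j \in B -> face B y ->
  m j * lam j * jump_deriv j y = y 0 j * K j y.
Proof.
move=> jB; apply: (@face_extension_unique _ _ B i0 i0B
  (fun y => m j * lam j * jump_deriv j y) (fun y => y 0 j * K j y)).
- apply/subspace_continuousP => z fz; apply: cvgMr.
  by have /subspace_continuousP := @jump_deriv_continuous j; apply.
- apply/subspace_continuousP => z fz; apply: cvgM; first exact: coord_cvg.
  by case: FD => _ /(_ j jB)/subspace_continuousP; apply.
move=> z [fz z0]; rewrite drift_termE// z0// mul1r.
have zj : z 0 j != 0 by rewrite gt_eqF// z0.
by field.
Qed.

Lemma jump_deriv0 j y : j \in B -> face B y -> y 0 j = 0 -> jump_deriv j y = 0.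
Proof.
move=> jB fy y0; have := jump_derivE jB fy; rewrite y0 mul0r => /eqP.
by rewrite !mulf_eq0 (gt_eqF (m_gt0 j)) (gt_eqF (lam_gt0 j)) => /eqP.
Qed.

Lemma face_cont_near (f : 'rV[R]_p -> R) y eps : {within face B, continuous f} -> face B y ->
  0 < eps -> exists2 d, 0 < d & forall z, face B z -> `|z - y| < d -> `|f z - f y| <= eps.
Proof.
move=> /subspace_continuousP cf fy eps0; have /cvgrPdistC_le/(_ _ eps0) := cf y fy.
rewrite near_withinE => /nbhs_normP[d /= d0 hd]; exists d => // z fz zy.
by apply: hd => //=; rewrite distrC.
Qed.

(* By the drift identity the jump derivative is o(y_j) near y_j = 0; being C1
   up to the boundary, its whole gradient vanishes there. *)
Lemma jump_deriv2_0 j k y : j \in B -> k \in B -> face B y -> y 0 j = 0 ->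
  jump_deriv2 j k y = 0.
Proof.
move=> jB kB fy y0.
have [z oz _] := open_face_nonempty fy B0.
have tE : face_tangent B (E k) by exact: tangent_basis.
have [d d0 hd] := open_face_line oz tE.
pose tau := d / 2; have tau0 : 0 < tau by rewrite divr_gt0.
have oz' s : `|s| <= tau -> open_face B (s *: E k + z).
  by move=> hs; apply: hd; apply: le_lt_trans hs _; rewrite ltr_pdivrMr// ltr_pMr// ltr1n.
pose M := tau * `|E k| + `|z - y| + 1.
have M0 : 0 < M by rewrite ltr_wpDl// addr_ge0// mulr_ge0// ltW.
(* The point at fraction t on the way from y to z + s E_k: increasing s by [tau] moves it by t [tau]
   E_k. *)
pose c s t : 'rV[R]_p := t *: (s *: E k + z - y) + y.
have oc s t : `|s| <= tau -> 0 < t <= 1 -> open_face B (c s t).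
  by move=> hs ht; apply: open_face_conv => //; exact: oz'.
have cy s t : `|s| <= tau -> 0 < t -> `|c s t - y| < t * M.
  move=> hs ht; rewrite addrK normrZ gtr0_norm// ltr_pM2l// ltr_pwDr//.
  rewrite -addrA; apply: le_trans (ler_normD _ _) _; rewrite lerD2r normrZ.
  by rewrite ler_wpM2r.
have mB : 0 < m j * lam j by rewrite mulr_gt0.
(* Since y_j = 0, the coordinate j of [c s t] is at most t. *)
have gK s t : `|s| <= tau -> 0 < t <= 1 ->
    `|jump_deriv j (c s t)| <= t / (m j * lam j) * `|K j (c s t)|.
  move=> hs ht; have [fc _] := oc s t hs ht.
  have /(canRL (mulKf (lt0r_neq0 mB)))-> := jump_derivE jB fc.
  rewrite mulrA normrM ler_wpM2r// normrM [X in X * _]gtr0_norm ?invr_gt0// mulrC ler_wpM2r//.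
    by rewrite invr_ge0 ltW.
  have [fz _] := oz' s hs; case/andP: ht => t0 _.
  have -> : c s t 0 j = t * (s *: E k + z) 0 j.
    by rewrite mxE y0 addr0 mxE rVB_E y0 subr0.
  have [[zs0 _] _] := fz.
  rewrite ger0_norm ?mulr_ge0 ?(ltW t0)// ger_pMr//.
  by apply: simplex_le1; case: fz.
apply/eqP; rewrite -normr_le0; apply/ler_addgt0Pr => eps eps0; rewrite add0r.
(* 1 stands for the continuity error of the second derivative, the other term for the two ends of
   the difference quotient. *)
pose Q := 1 + 2 / (tau * (m j * lam j)).
have tm0 : 0 < tau * (m j * lam j) by rewrite mulr_gt0.
have Q0 : 0 < Q by rewrite ltr_pwDl// divr_ge0// ltW.
have e0 : 0 < eps / Q by rewrite divr_gt0.
have [d1 d10 h1] := face_cont_near (@jump_deriv2_continuous j k kB) fy e0.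
have [d2 d20 h2] := face_cont_near (proj2 FD j jB) fy e0.
pose t := Num.min 1 (Num.min d1 d2 / M).
have t0 : 0 < t by rewrite lt_min ltr01 divr_gt0// lt_min d10.
have t01 : 0 < t <= 1 by rewrite t0 ge_min lexx.
have tM : t * M <= Num.min d1 d2 by rewrite -ler_pdivlMr// ge_min lexx orbT.
have tM1 : t * M <= d1 by apply: le_trans tM _; rewrite ge_min lexx.
have tM2 : t * M <= d2 by apply: le_trans tM _; rewrite ge_min lexx orbT.
have tau_n : `|tau| = tau by rewrite gtr0_norm.
have S0 : `|0 : R| <= tau by rewrite normr0 ltW.
have S1 : `|tau| <= tau by rewrite tau_n.
have dg (s : R) : `|s| <= `|t * tau| -> is_derive s 1
    (fun s : R => jump_deriv j (s *: E k + c 0 t)) (jump_deriv2 j k (s *: E k + c 0 t)).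
  move=> hs; apply: is_derive_line; apply: is_derive_bigsum => i iB; apply: is_derive_cmul.
  apply: partial2P => //.
  have -> : s *: E k + c 0 t = c (s / t) t.
    rewrite /c scale0r add0r addrA; congr (_ + _); rewrite -[in RHS]addrA [RHS]scalerDr scalerA.
    by rewrite mulrC divfK ?gt_eqF.
  apply: oc => //; rewrite normrM normfV (gtr0_norm t0) ler_pdivrMr// mulrC.
  by rewrite normrM tau_n (gtr0_norm t0) in hs.
have [s hs Es] := MVT_line dg.
have st : `|s / t| <= tau.
  rewrite normrM normfV (gtr0_norm t0) ler_pdivrMr// mulrC.
  by rewrite normrM tau_n (gtr0_norm t0) in hs.
have cE s' : s' *: E k + c 0 t = c (s' / t) t.
  rewrite /c scale0r add0r addrA; congr (_ + _); rewrite -[in RHS]addrA [RHS]scalerDr scalerA.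
  by rewrite mulrC divfK ?gt_eqF.
move: Es; rewrite scale0r add0r !cE [t * tau / t]mulrAC divff ?gt_eqF// mul1r => Es.
have [fc1 _] := oc tau t S1 t01; have [fc0 _] := oc 0 t S0 t01; have [fcs _] := oc _ t st t01.
have K1 : `|K j (c tau t)| <= eps / Q.
  have := h2 _ fc1 (lt_le_trans (cy tau t S1 t0) tM2).
  by rewrite -/(K j y) (drift_term0 y0) subr0.
have K0 : `|K j (c 0 t)| <= eps / Q.
  have := h2 _ fc0 (lt_le_trans (cy 0 t S0 t0) tM2).
  by rewrite -/(K j y) (drift_term0 y0) subr0.
have H1 := h1 _ fcs (lt_le_trans (cy _ t st t0) tM1).
have tt0 : 0 < t * tau by rewrite mulr_gt0.
(* At both ends the derivative is at most t / (m_j lam_j) times a small drift term; dividing by the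
   length t [tau] cancels t. *)
have hb : `|jump_deriv2 j k (c (s / t) t)| <= 2 / (tau * (m j * lam j)) * (eps / Q).
  rewrite -(ler_pM2r tt0) -[X in _ * X <= _](gtr0_norm tt0) -normrM -Es.
  apply: le_trans (ler_normB _ _) _.
  have tq : 0 <= t / (m j * lam j) by rewrite divr_ge0// ltW.
  have g1 := le_trans (gK tau t S1 t01) (ler_wpM2l tq K1).
  have g0 := le_trans (gK 0 t S0 t01) (ler_wpM2l tq K0).
  apply: le_trans (lerD g1 g0) _; rewrite le_eqVlt; apply/orP; left; apply/eqP.
  have nt : tau != 0 by rewrite gt_eqF.
  have nm : m j != 0 by rewrite gt_eqF.
  have nl : lam j != 0 by rewrite gt_eqF.
  have nQ : Q != 0 by rewrite gt_eqF.
  by move: (Q) nQ => q nq; field; rewrite nq nt nm nl.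
move: H1 hb; move: (jump_deriv2 j k _) (jump_deriv2 j k y) => f1 f2 H1 hb.
have -> : f2 = f1 - (f1 - f2) by ring.
apply: le_trans (ler_normB _ _) _; apply: le_trans (lerD hb H1) _.
by rewrite -[X in _ + X]mul1r -mulrDl [X in X * _]addrC -/Q mulrC divfK ?gt_eqF.
Qed.

End drift_at_boundary.

Section shifted_sums.
Context {R : comNzRingType} {I : finType} (B : {set I}) (nu : I -> I -> R).

Lemma sum_shift (u v c X : I -> R) :
  (forall i, u i = v i - \sum_(j in B) c j * nu j i) ->
  \sum_(i in B) u i * X i =
  \sum_(i in B) v i * X i - \sum_(j in B) c j * \sum_(i in B) nu j i * X i.
Proof.
move=> uE; under eq_bigr => i iB do rewrite uE mulrBl mulr_suml.
rewrite sumrB; congr (_ - _); rewrite exchange_big; apply: eq_bigr => j jB.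
by rewrite mulr_sumr; apply: eq_bigr => i _; rewrite mulrA.
Qed.

(** Symmetry of X lets the shift of the inner vector contract the other index. Every correction then
    contains a contraction with nu, that is, a derivative along a drift. *)
Lemma sum_shift2 (u v c u' v' c' : I -> R) (X : I -> I -> R) :
  (forall i, u i = v i - \sum_(j in B) c j * nu j i) ->
  (forall i, u' i = v' i - \sum_(j in B) c' j * nu j i) ->
  (forall i k, i \in B -> k \in B -> X i k = X k i) ->
  \sum_(i in B) u i * (\sum_(k in B) u' k * X k i) =
  \sum_(i in B) v i * (\sum_(k in B) v' k * X k i
     - \sum_(j in B) c' j * \sum_(k in B) nu j k * X i k)
  - \sum_(j in B) c j * \sum_(k in B) u' k * \sum_(i in B) nu j i * X k i.
Proof.
move=> uE uE' Xsym; rewrite (sum_shift _ uE); congr (_ - _).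
  apply: eq_bigr => i iB; congr (_ * _); rewrite (sum_shift _ uE'); congr (_ - _).
  apply: eq_bigr => j jB; congr (_ * _); apply: eq_bigr => k kB; congr (_ * _).
  exact: Xsym.
apply: eq_bigr => j jB; congr (_ * _).
under eq_bigr do rewrite mulr_sumr.
rewrite exchange_big/=; apply: eq_bigr => k kB; rewrite mulr_sumr.
by apply: eq_bigr => i iB; rewrite mulrCA.
Qed.

End shifted_sums.

(** * Small scale limits *)

Section approximation.
Context {R : realType} {p : nat} (B : {set 'I_p}) (i0 : 'I_p).
Hypothesis i0B : i0 \in B.
Implicit Types (x y z u U V W : 'rV[R]_p).
Variables (b : R) (m lam : 'I_p -> R) (r rB : 'I_p -> 'I_p -> R).
Variables (P L : 'M[R]_p) (w : 'I_p -> 'rV[R]_p) (C : R).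
Hypothesis bar : barrier P w C.
Hypothesis L_ge0 : forall i j, 0 <= L i j.
Hypothesis L_out : forall i j, j \notin B -> L i j = 0.
Hypothesis L_sum : forall i, \sum_j L i j = 1.
Hypothesis L_id : forall i j, i \in B -> L i j = (i == j)%:R.
Hypothesis m_gt0 : forall j, 0 < m j.
Hypothesis lam_gt0 : forall j, 0 < lam j.
Hypothesis r_lam : forall i j, r i j = lam i * P i j.
Hypothesis L_kill : forall j, j \notin B -> row j (P - 1%:M) *m L = 0.
Hypothesis L_drift : forall j, j \in B ->
  drift_vec rB B j = lam j *: (row j (P - 1%:M) *m L).
Hypothesis dirichlet : forall i k, i \in B -> k \in B ->
  \sum_j \sum_l m j * r j l * (((basis_vec R j - basis_vec R l) *m L) 0 i *
     ((basis_vec R j - basis_vec R l) *m L) 0 k) =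
  \sum_(j in B) \sum_(l in B) m j * rB j l * ((basis_vec R j - basis_vec R l) 0 i *
     (basis_vec R j - basis_vec R l) 0 k).
Variable F : 'rV[R]_p -> R.
Hypothesis FD : domain m rB B F.
Let F2 : face_C2 B F := proj1 FD.

Let nu j : 'rV[R]_p := row j (P - 1%:M) *m L.
Let G := partial B i0 F.
Let G2 := partial2 B i0 F.
Let g := jump_deriv B i0 nu F.
Let h := jump_deriv2 B i0 nu F.
Let K j := drift_term m rB B j F.

Let row_gen_sum0 j : \sum_k (row j (P - 1%:M)) 0 k = 0.
Proof. by rewrite rowE (mulmx_gen_sum0 bar). Qed.

Let nu_tangent j : j \in B -> face_tangent B (nu j).
Proof. by move=> jB; apply: mulmxL_tangent. Qed.

Let nu_drift j : j \in B -> drift_vec rB B j = lam j *: nu j.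
Proof. exact: L_drift. Qed.

Let genL (A : 'rV[R]_p) k : (A *m (P - 1%:M) *m L) 0 k = \sum_(j in B) A 0 j * nu j 0 k.
Proof.
rewrite -mulmxA mxE (bigID (mem B))/= [X in _ + X]big1 ?addr0.
  by apply: eq_bigr => j _; rewrite /nu -row_mul [row _ _ _ _]mxE.
move=> j jB; have := L_kill jB; rewrite -row_mul => /rowP/(_ k).
by rewrite !mxE => ->; rewrite mulr0.
Qed.

Let face_mulL x : face B x -> x *m L = x.
Proof.
move=> fx; apply/rowP => k; rewrite mxE.
have [kB|kB] := boolP (k \in B); last first.
  by rewrite (face_out fx kB) big1// => j _; rewrite L_out// mulr0.
rewrite (bigD1 k)//= L_id// eqxx mulr1 big1 ?addr0// => j jk.
have [jB|jB] := boolP (j \in B); last by rewrite (face_out fx jB) mul0r.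
by rewrite L_id// (negbTE jk) mulr0.
Qed.

Lemma retract_face e x k : face B x ->
  retract P L e x 0 k = x 0 k - \sum_(j in B) lcp P e x 0 j * nu j 0 k.
Proof. by move=> fx; rewrite /retract mulmxBl rVB_E face_mulL// genL. Qed.

Lemma retract'E e x V k :
  retract' P L e x V 0 k = (V *m L) 0 k - \sum_(j in B) lcp' P e x V 0 j * nu j 0 k.
Proof. by rewrite /retract' mulmxBl rVB_E genL. Qed.

Lemma retract''E e x W V k :
  retract'' P L e x W V 0 k = - \sum_(j in B) lcp'' P e x W V 0 j * nu j 0 k.
Proof. by rewrite /retract'' mulNmx [LHS]mxE genL. Qed.

Lemma lift'E e V x : lift' B i0 P L e F V x =
  \sum_(i in B) (V *m L) 0 i * G i (retract P L e x)
  - \sum_(j in B) lcp' P e x V 0 j * g j (retract P L e x).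
Proof.
exact: (@sum_shift R _ B (fun j k => nu j 0 k) (fun i => retract' P L e x V 0 i)
  (fun i => (V *m L) 0 i) (fun j => lcp' P e x V 0 j) (fun i => G i (retract P L e x))
  (fun i => retract'E e x V i)).
Qed.

(** Besides the main terms, each term carries a factor [g] or [h]: a first or second derivative of F
    along some [nu j], which vanishes where the coordinate j does. *)
Lemma lift''E e W V x : face B (retract P L e x) ->
  lift'' B i0 P L e F W V x =
  \sum_(i in B) (V *m L) 0 i *
    (\sum_(k in B) (W *m L) 0 k * G2 k i (retract P L e x)
     - \sum_(j in B) lcp' P e x W 0 j * h j i (retract P L e x))
  - \sum_(j in B) lcp' P e x V 0 j *
      \sum_(k in B) retract' P L e x W 0 k * h j k (retract P L e x)
  - \sum_(j in B) lcp'' P e x W V 0 j * g j (retract P L e x).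
Proof.
move=> fy.
have E1 := @sum_shift2 R _ B (fun j k => nu j 0 k)
  (fun i => retract' P L e x V 0 i) (fun i => (V *m L) 0 i) (fun j => lcp' P e x V 0 j)
  (fun i => retract' P L e x W 0 i) (fun i => (W *m L) 0 i) (fun j => lcp' P e x W 0 j)
  (fun k i => G2 k i (retract P L e x))
  (fun i => retract'E e x V i) (fun i => retract'E e x W i)
  (fun i k iB kB => partial2_sym i0B F2 kB iB fy).
have E2 := @sum_shift R _ B (fun j k => nu j 0 k)
  (fun i => retract'' P L e x W V 0 i) (fun=> 0) (fun j => lcp'' P e x W V 0 j)
  (fun i => G i (retract P L e x)) (fun i => etrans (retract''E e x W V i) (esym (sub0r _))).
rewrite /lift'' big_split/= [X in X + _]E1 [X in _ + X]E2; congr (_ + _).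
by rewrite big1 ?sub0r// => i _; rewrite mul0r.
Qed.

Lemma drift_vec_full j : drift_vec r [set: 'I_p]%SET j = lam j *: row j (P - 1%:M).
Proof.
apply/rowP => k; rewrite summxE !mxE.
transitivity (\sum_i lam j * (P j i * (i == k)%:R - P j i * (j == k)%:R)).
  by apply: eq_big => [i|i _]; rewrite ?inE// !mxE r_lam eqxx/= [k == i]eq_sym [k == j]eq_sym; ring.
rewrite -mulr_sumr sumrB -[X in _ - X]mulr_suml (barrier_P_sum bar) mul1r; congr (_ * (_ - _)).
rewrite (bigD1 k)//= eqxx mulr1 big1 ?addr0// => i ik.
by rewrite (negbTE ik) mulr0.
Qed.

Let row_tangent j : face_tangent [set: 'I_p]%SET (row j (P - 1%:M)).
Proof.
split; last by move=> i; rewrite inE.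
by rewrite -[RHS](row_gen_sum0 j); apply: eq_bigl => i; rewrite inE.
Qed.

Let lift'Z e c V x : small_scale p C e -> simplex x ->
  lift' B i0 P L e F (c *: V) x = c * lift' B i0 P L e F V x.
Proof.
move=> ok sx; rewrite /lift' mulr_sumr; apply: eq_bigr => i _; rewrite mulrA; congr (_ * _).
by rewrite /retract' (lcp'Z bar ok)// -scalemxAl -scalerBr -scalemxAl mxE.
Qed.

Lemma drift_lift e j x : small_scale p C e -> simplex x ->
  drift_term m r [set: 'I_p]%SET j (lift P L e F) x =
  (0 < x 0 j)%R%:R * (m j / x 0 j) * (lam j * lift' B i0 P L e F (row j (P - 1%:M)) x).
Proof.
move=> ok sx; congr (_ * _); rewrite drift_vec_full.
have tV := tangentZ (lam j) (row_tangent j).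
by rewrite (nabla_lift i0B bar L_ge0 L_out L_sum L_id ok F2 sx tV) lift'Z.
Qed.

(** The derivative is zero for x_j <= e, so x_j can be replaced by its maximum with e; continuity at
    x_j = 0 becomes evident. *)
Lemma drift_lift_max e j x : small_scale p C e -> simplex x ->
  drift_term m r [set: 'I_p]%SET j (lift P L e F) x =
  (m j * lam j) * ((Num.max (x 0 j) e)^-1 * lift' B i0 P L e F (row j (P - 1%:M)) x).
Proof.
move=> ok sx; rewrite drift_lift//.
have [xe|xe] := leP (x 0 j) e.
  by rewrite (lift'_strip B i0 L bar ok F sx xe) !mulr0.
have e0 : 0 < e by case: ok.
rewrite (lt_trans e0 xe) mul1r; move: (lift' _ _ _ _ _ _ _ _) (x 0 j)^-1 => l q; ring.
Qed.

Lemma lift_domain e : small_scale p C e -> domain m r [set: 'I_p]%SET (lift P L e F).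
Proof.
move=> ok; split; first exact: (lift_C2 i0B bar L_ge0 L_out L_sum L_id ok F2).
move=> j _; rewrite face_setTE.
have e0 : 0 < e by case: ok.
apply: (@eq_within_continuous _ _ _ (fun x => (m j * lam j) * ((Num.max (x 0 j) e)^-1 *
   lift' B i0 P L e F (row j (P - 1%:M)) x))).
  by move=> x sx; rewrite drift_lift_max.
apply/subspace_continuousP => x sx; apply: cvgMr; apply: cvgM; last first.
  exact: (lift'_cvg i0B bar L_ge0 L_out L_sum L_id ok F2).
apply: cvgV; first by rewrite gt_eqF// lt_max e0 orbT.
apply: (@cvg_within_linear_error _ _ _ (fun x : 'rV[R]_p => Num.max (x 0 j) e) x 1 1) => // z _ _.
rewrite mul1r; apply: (@le_trans _ _ `|z 0 j - x 0 j|).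
  move: (z 0 j) (x 0 j) => s t; rewrite /Num.max; case: ifP => h1; case: ifP => h2 //.
  - by rewrite subrr normr0.
  - have {}h2 : e <= t by rewrite leNgt h2.
    by rewrite [leLHS]ler0_norm ?subr_le0// [leRHS]ler0_norm; lra.
  - have {}h1 : e <= s by rewrite leNgt h1.
    by rewrite !ger0_norm; lra.
by rewrite -rVB_E; exact: rV_coord_le.
Qed.

Lemma generator_lift e x : small_scale p C e -> simplex x ->
  generator b m r [set: 'I_p]%SET (lift P L e F) x =
  b * (\sum_j (0 < x 0 j)%R%:R * (m j / x 0 j) * (lam j * lift' B i0 P L e F (row j (P - 1%:M)) x))
  + 2^-1 * \sum_j \sum_k m j * r j k *
     lift'' B i0 P L e F (basis_vec R j - basis_vec R k) (basis_vec R j - basis_vec R k) x.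
Proof.
move=> ok sx; congr (_ * _ + _ * _).
  by apply: eq_big => [j|j _]; rewrite ?inE// drift_lift.
apply: eq_big => [j|j _]; rewrite ?inE//; apply: eq_big => [k|k _]; rewrite ?inE//.
have tV : face_tangent [set: 'I_p]%SET (basis_vec R j - basis_vec R k).
  by apply: tangent_basis; rewrite inE.
by rewrite (nabla2_lift i0B bar L_ge0 L_out L_sum L_id ok F2 sx tV tV).
Qed.

(** The second order part is rewritten over the jumps of the full chain, the form in which the
    lifted generators converge; the hypothesis [dirichlet] compares the coefficients of each second
    partial derivative. *)
Lemma generator_face x : face B x ->
  generator b m rB B F x =
  b * (\sum_(j in B) K j x) + 2^-1 * \sum_j \sum_l m j * r j l *
     \sum_(i in B) ((basis_vec R j - basis_vec R l) *m L) 0 i *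
      \sum_(k in B) ((basis_vec R j - basis_vec R l) *m L) 0 k * G2 k i x.
Proof.
move=> fx; congr (_ + _ * _).
have E2 (D : {set 'I_p}) (c : 'I_p -> 'I_p -> R) (u : 'I_p -> 'I_p -> 'I_p -> R) :
  \sum_(j in D) \sum_(l in D) c j l * (\sum_(i in B) u j l i * \sum_(k in B) u j l k * G2 k i x)
  = \sum_(i in B) \sum_(k in B) G2 k i x * \sum_(j in D) \sum_(l in D) c j l * (u j l i * u j l k).
  transitivity (\sum_(j in D) \sum_(l in D) \sum_(i in B) \sum_(k in B)
     G2 k i x * (c j l * (u j l i * u j l k))).
    apply: eq_bigr => j _; apply: eq_bigr => l _; rewrite mulr_sumr.
    apply: eq_bigr => i _; rewrite mulr_sumr mulr_sumr; apply: eq_bigr => k _.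
    by move: (G2 k i x) => q; ring.
  under eq_bigr => j _ do rewrite exchange_big.
  rewrite exchange_big; apply: eq_bigr => i _.
  under eq_bigr => j _ do rewrite exchange_big.
  rewrite exchange_big; apply: eq_bigr => k _; rewrite mulr_sumr.
  by apply: eq_bigr => j _; rewrite mulr_sumr.
transitivity (\sum_(j in B) \sum_(l in B) m j * rB j l *
   (\sum_(i in B) (basis_vec R j - basis_vec R l) 0 i *
      \sum_(k in B) (basis_vec R j - basis_vec R l) 0 k * G2 k i x)).
  apply: eq_bigr => j jB; apply: eq_bigr => l lB; congr (_ * _).
  by apply: (nabla2E i0B F2) => //; exact: tangent_basis.
rewrite (E2 B (fun j l => m j * rB j l) (fun j l i => (basis_vec R j - basis_vec R l) 0 i)).
transitivity (\sum_(j in [set: 'I_p]%SET) \sum_(l in [set: 'I_p]%SET) m j * r j l *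
     (\sum_(i in B) ((basis_vec R j - basis_vec R l) *m L) 0 i *
      \sum_(k in B) ((basis_vec R j - basis_vec R l) *m L) 0 k * G2 k i x)).
  rewrite (E2 _ (fun j l => m j * r j l) (fun j l i => ((basis_vec R j - basis_vec R l) *m L) 0 i)).
  apply: eq_bigr => i iB; apply: eq_bigr => k kB; congr (_ * _).
  rewrite -dirichlet//; apply: eq_big => [j|j _]; rewrite ?inE//.
  by apply: eq_big => [l|l _]; rewrite ?inE.
apply: eq_big => [j|j _]; rewrite ?inE//.
by apply: eq_big => [l|l _]; rewrite ?inE.
Qed.

Variable e0 : R.
Hypothesis e0_ok : small_scale p C e0.
Let e (n : nat) : R := e0 / n.+1%:R.

Let e_gt0 n : 0 < e n. Proof. by rewrite divr_gt0//; case: e0_ok. Qed.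

Let C_ge0 : 0 <= C. Proof. exact: le_trans ler01 (barrier_C_ge1 bar). Qed.

Lemma scale_ok n : small_scale p C (e n).
Proof.
split; first exact: e_gt0.
case: e0_ok => e00; apply: le_trans.
rewrite ler_wpM2l ?addr_ge0 ?mulr_ge0// /e ler_pdivrMr ?ltr0n//.
by rewrite ler_peMr ?(ltW e00)// ler1n.
Qed.

Lemma scale_cvg : e n @[n --> \oo] --> 0.
Proof.
rewrite -[X in _ --> X](mulr0 e0); apply: cvgMr.
exact: cvg_harmonic.
Qed.

Let y n x := retract P L (e n) x.

Let y_open n x : face B x -> open_face B (y n x).
Proof. by move=> [sx _]; apply: (retract_open bar L_ge0 L_out L_sum L_id (scale_ok n) sx). Qed.

Let y_face n x : face B x -> face B (y n x).
Proof. by move=> /(y_open n)[]. Qed.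

(** [lcp] is at most 2 C e, so D j e bounds the displacement of the coordinate j under the
    retraction. *)
Let D j := \sum_(l in B) 2 * C * `|nu l 0 j|.

Let D_ge0 j : 0 <= D j.
Proof. by rewrite sumr_ge0// => l _; rewrite !mulr_ge0. Qed.

Let y_dist n x j : face B x -> `|y n x 0 j - x 0 j| <= D j * e n.
Proof.
move=> fx; rewrite /y retract_face// addrC addKr normrN mulr_suml.
apply: le_trans (ler_norm_sum _ _ _) _; apply: ler_sum => l _.
have [sx _] := fx; have [i xi] := simplex_large_coord sx.
have /andP[h0 h1] := lcp_bound bar (scale_ok n) sx xi l.
rewrite normrM (ger0_norm h0) mulrAC ler_wpM2r//; apply: le_trans h1 _.
by rewrite mulrAC ler_wpM2r ?(ltW (e_gt0 n))// ler_wpM2l// (barrier_le bar).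
Qed.

Let y_cvg x : face B x -> y n x @[n --> \oo] --> x.
Proof.
move=> fx; apply: rV_cvg => j; apply/subr_cvg0.
have H : D j * e n @[n --> \oo] --> 0.
  by rewrite -[X in _ --> X](mulr0 (D j)); apply: cvgMr; exact: scale_cvg.
apply/norm_cvg0P; apply: (squeeze_cvgr _ (cvg_cst (0 : R)) H).
by apply: nearW => n; rewrite normr_ge0 y_dist.
Qed.

Let comp_cvg (f : 'rV[R]_p -> R) x : face B x -> {within face B, continuous f} ->
  f (y n x) @[n --> \oo] --> f x.
Proof.
move=> fx /subspace_continuousP cf; have {}cf := cf x fx; move=> Q /cf hQ.
have {}hQ : nbhs x (fun z => face B z -> Q (f z)) := hQ.
have hn := y_cvg fx hQ.
have {}hn : \forall n \near \oo, face B (y n x) -> Q (f (y n x)) := hn.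
suff : \forall n \near \oo, Q (f (y n x)) by [].
by apply: filterS hn => n hn; apply: hn; exact: y_face.
Qed.

Let bounded_null (s t : nat -> R) M : (forall n, `|s n| <= M) -> t n @[n --> \oo] --> 0 ->
  s n * t n @[n --> \oo] --> 0.
Proof.
move=> sM t0.
have H : M * `|t n| @[n --> \oo] --> 0.
  rewrite -[X in _ --> X](mulr0 M); apply: cvgMr.
  by rewrite -(@normr0 _ R); apply: cvg_norm.
apply/norm_cvg0P; apply: (squeeze_cvgr _ (cvg_cst (0 : R)) H).
by apply: nearW => n; rewrite normr_ge0 normrM ler_wpM2r.
Qed.

Let cvgB0 (s t : nat -> R) (l : R) : s n @[n --> \oo] --> l -> t n @[n --> \oo] --> 0 ->
  s n - t n @[n --> \oo] --> l.
Proof. by move=> sl t0; rewrite -[l]subr0; exact: cvgB. Qed.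

(* The corrections live where x_j is of order e, that is, for small e, only
   where x_j = 0; there the derivatives of F they multiply vanish. *)
Let local_null j x (s t : nat -> R) M : j \in B -> face B x -> (forall n, `|s n| <= M) ->
  (forall n, (2 * C + 3) * e n <= x 0 j -> s n = 0) ->
  (x 0 j = 0 -> t n @[n --> \oo] --> 0) -> s n * t n @[n --> \oo] --> 0.
Proof.
move=> jB fx sM sfar tx; have [xj0|xj0] := eqVneq (x 0 j) 0.
  exact: bounded_null sM (tx xj0).
have xj : 0 < x 0 j by rewrite lt0r xj0/=; case: fx => -[].
have c0 : (fun=> 0 : R) @ \oo --> (0 : R) by exact: cvg_cst.
apply: cvg_trans _ c0; apply: near_eq_cvg.
have H : (2 * C + 3) * e n @[n --> \oo] --> 0.
  by rewrite -[X in _ --> X](mulr0 (2 * C + 3)); apply: cvgMr; exact: scale_cvg.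
have /cvgrPdistC_le/(_ _ xj) := H; apply: filterS => n.
by rewrite subr0 => /ler_normlW/sfar->; rewrite mul0r.
Qed.

Let far_lcp' n x j V : face B x -> (2 * C + 3) * e n <= x 0 j -> lcp' P (e n) x V 0 j = 0.
Proof. by move=> [sx _] xj; have [_ h' _] := lcp_far bar (scale_ok n) sx xj. Qed.

Let far_lcp'' n x j W V : face B x -> (2 * C + 3) * e n <= x 0 j -> lcp'' P (e n) x W V 0 j = 0.
Proof. by move=> [sx _] xj; have [_ _ h''] := lcp_far bar (scale_ok n) sx xj. Qed.

Let lcp'_bd n x j V : face B x -> `|lcp' P (e n) x V 0 j| <= (1 + C) * `|V|.
Proof. by move=> [sx _]; exact: (lcp'_bound bar (scale_ok n)). Qed.

Let g_cont j : {within face B, continuous (g j)}.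
Proof. exact: (jump_deriv_continuous i0B (F := F) FD). Qed.

Let g0 j x : j \in B -> face B x -> x 0 j = 0 -> g j x = 0.
Proof. exact: (jump_deriv0 i0B m_gt0 lam_gt0 nu_drift nu_tangent FD). Qed.

Let h0 j k x : j \in B -> k \in B -> face B x -> x 0 j = 0 -> h j k x = 0.
Proof. exact: (jump_deriv2_0 i0B m_gt0 lam_gt0 nu_drift nu_tangent FD). Qed.

Let gE j x : j \in B -> face B x -> m j * lam j * g j x = x 0 j * K j x.
Proof. exact: (jump_derivE i0B nu_drift nu_tangent FD). Qed.

Let first_null x V (t : 'I_p -> nat -> R) : face B x ->
  (forall j, j \in B -> x 0 j = 0 -> t j n @[n --> \oo] --> 0) ->
  \sum_(j in B) lcp' P (e n) x V 0 j * t j n @[n --> \oo] --> 0.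
Proof.
move=> fx tx.
have H : \sum_(j in B) lcp' P (e n) x V 0 j * t j n @[n --> \oo] --> \sum_(j in B) (0 : R).
  apply: cvg_bigsum => j jB; apply: (@local_null j x _ _ ((1 + C) * `|V|)) => //.
  - by move=> n; exact: lcp'_bd.
  - by move=> n; exact: far_lcp'.
  - exact: tx.
by rewrite big1 in H.
Qed.

Let lcp''_bd n x j W V : face B x ->
  `|e n * lcp'' P (e n) x W V 0 j| <= (p%:R * (1 + C) ^+ 3 + (1 + C) ^+ 2) * `|W| * `|V|.
Proof.
move=> [sx _]; rewrite normrM gtr0_norm// -ler_pdivlMl//.
have := lcp''_bound bar (scale_ok n) W V j sx; move: (p%:R * _ + _) => c.
by have -> // : (e n)^-1 * (c * `|W| * `|V|) = c / e n * `|W| * `|V| by move: (e n)^-1 => q; ring.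
Qed.

Let K_cont j : j \in B -> {within face B, continuous (K j)}.
Proof. by move=> jB; have [_ /(_ j jB)] := FD. Qed.

Let g_scaled n x j : j \in B -> face B x ->
  g j (y n x) / e n = y n x 0 j / e n / (m j * lam j) * K j (y n x).
Proof.
move=> jB fx; have ml : m j * lam j != 0 by rewrite gt_eqF// mulr_gt0.
have /(canRL (mulKf ml))-> := gE jB (y_face n fx).
by move: (y n x 0 j) (K j (y n x)) (e n) (m j * lam j) => *; ring.
Qed.

(** By [y_dist] the ratio of the coordinate j of y to e stays bounded, while the drift term tends to
    its value at x, which is zero. *)
Let g_scaled_null x j : j \in B -> face B x -> x 0 j = 0 ->
  g j (y n x) / e n @[n --> \oo] --> 0.
Proof.
move=> jB fx xj0; under eq_fun do rewrite g_scaled//.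
have ml : 0 < m j * lam j by rewrite mulr_gt0.
apply: (@bounded_null _ _ (D j / (m j * lam j))) => [n|].
  rewrite normrM [X in _ * X]gtr0_norm ?invr_gt0// ler_pM2r ?invr_gt0//.
  rewrite normrM [X in _ * X]gtr0_norm ?invr_gt0// ler_pdivrMr//.
  by have := y_dist n j fx; rewrite xj0 subr0.
have K0 : K j x = 0 by rewrite /K /drift_term xj0 ltxx !mul0r.
by rewrite -K0; apply: (@comp_cvg (K j)) => //; exact: K_cont.
Qed.

Let scale_cancel (s t q : R) : 0 < q -> (q * s) * (t / q) = s * t.
Proof. by move=> q0; field; rewrite gt_eqF. Qed.

Let second_null x W V : face B x ->
  \sum_(j in B) lcp'' P (e n) x W V 0 j * g j (y n x) @[n --> \oo] --> 0.
Proof.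
move=> fx.
(* [lcp''] is of order 1/e; its product with e is bounded, and the factor 1/e goes to [g]. *)
have H : \sum_(j in B) (e n * lcp'' P (e n) x W V 0 j) * (g j (y n x) / e n)
    @[n --> \oo] --> \sum_(j in B) (0 : R).
  apply: cvg_bigsum => j jB.
  apply: (@local_null j x _ _ ((p%:R * (1 + C) ^+ 3 + (1 + C) ^+ 2) * `|W| * `|V|)) => //.
  - by move=> n; exact: lcp''_bd.
  - by move=> n /far_lcp''->//; rewrite mulr0.
  - exact: g_scaled_null.
rewrite big1 in H => //; apply: cvg_trans _ H; apply: near_eq_cvg.
apply: nearW => n; apply: eq_bigr => j _.
exact: (scale_cancel _ _ (e_gt0 n)).
Qed.

Let retract'_bd n x V k : face B x -> `|retract' P L (e n) x V 0 k|
  <= `|(V *m L) 0 k| + \sum_(j in B) (1 + C) * `|V| * `|nu j 0 k|.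
Proof.
move=> fx; rewrite retract'E; apply: le_trans (ler_normB _ _) _; rewrite lerD2l.
apply: le_trans (ler_norm_sum _ _ _) _; apply: ler_sum => j _.
by rewrite normrM ler_wpM2r// lcp'_bd.
Qed.

Let lift'_limit x V : face B x ->
  lift' B i0 P L (e n) F V x @[n --> \oo] --> \sum_(i in B) (V *m L) 0 i * G i x.
Proof.
move=> fx; under eq_fun do rewrite lift'E; apply: cvgB0.
  apply: cvg_bigsum => i iB; apply: cvgMr; apply: (@comp_cvg (G i)) => //.
  exact: (partial_continuous i0B F2).
apply: (@first_null x V (fun j n => g j (y n x))) => // j jB xj0.
by rewrite -(g0 jB fx xj0); apply: comp_cvg => //; exact: g_cont.
Qed.

Let h_null x j k : j \in B -> k \in B -> face B x -> x 0 j = 0 ->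
  h j k (y n x) @[n --> \oo] --> 0.
Proof.
move=> jB kB fx xj0; rewrite -(h0 jB kB fx xj0); apply: comp_cvg => //.
exact: (jump_deriv2_continuous i0B FD).
Qed.

Let lift''_limit x W V : face B x ->
  lift'' B i0 P L (e n) F W V x @[n --> \oo] -->
  \sum_(i in B) (V *m L) 0 i * \sum_(k in B) (W *m L) 0 k * G2 k i x.
Proof.
move=> fx; under eq_fun => n do rewrite (lift''E _ _ (y_face n fx)).
apply: cvgB0; last exact: second_null.
apply: cvgB0; last first.
  apply: (@first_null x V (fun j n =>
    \sum_(k in B) retract' P L (e n) x W 0 k * h j k (y n x))) => // j jB xj0.
  have H : \sum_(k in B) retract' P L (e n) x W 0 k * h j k (y n x) @[n --> \oo]
      --> \sum_(k in B) (0 : R).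
    apply: cvg_bigsum => k kB; apply: (@bounded_null _ _ _ (fun n => retract'_bd n W k fx)).
    exact: h_null.
  by rewrite big1 in H.
apply: cvg_bigsum => i iB; apply: cvgMr; apply: cvgB0.
  apply: cvg_bigsum => k kB; apply: cvgMr; apply: (@comp_cvg (G2 k i)) => //.
  exact: (partial2_continuous i0B F2).
by apply: (@first_null x W (fun j n => h j i (y n x))) => // j jB xj0; exact: h_null.
Qed.

Lemma lift_limit x : face B x -> lift P L (e n) F x @[n --> \oo] --> F x.
Proof. by move=> fx; apply: (@comp_cvg F) => //; case: F2 => -[]. Qed.

Lemma generator_limit x : face B x ->
  generator b m r [set: 'I_p]%SET (lift P L (e n) F) x @[n --> \oo]
  --> generator b m rB B F x.
Proof.
move=> fx; have [sx _] := fx.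
rewrite generator_face//; under eq_fun do rewrite (generator_lift (scale_ok _))//.
apply: cvgD; apply: cvgMr; last first.
  apply: cvg_bigsum => j _; apply: cvg_bigsum => k _; apply: cvgMr; exact: lift''_limit.
rewrite [X in _ --> X]big_mkcond/=; apply: cvg_bigsum => j _.
(* For j outside B, x_j is zero on the face and the indicator removes the term. *)
case: ifPn => jB; last first.
  rewrite (face_out fx jB) ltxx; under eq_fun do rewrite !mul0r; exact: cvg_cst.
rewrite [K j x](drift_termE i0B nu_drift nu_tangent FD jB fx).
by apply: cvgMr; apply: cvgMr; exact: lift'_limit.
Qed.

(** Uniform in the scale and in the point of the face, as the domination of the time integrals and
    of the expectations requires. *)
Let bdd (f : nat -> 'rV[R]_p -> R) :=
  exists M, forall n x, face B x -> `|f n x| <= M.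

Let bdd_cst c : bdd (fun _ _ => c).
Proof. by exists `|c|. Qed.

Let bddD f f' : bdd f -> bdd f' -> bdd (fun n x => f n x + f' n x).
Proof.
move=> [M fM] [M' fM']; exists (M + M') => n x fx.
by apply: le_trans (ler_normD _ _) _; apply: lerD; [exact: fM|exact: fM'].
Qed.

Let bddM f f' : bdd f -> bdd f' -> bdd (fun n x => f n x * f' n x).
Proof.
move=> [M fM] [M' fM']; exists (M * M') => n x fx.
by rewrite normrM; apply: ler_pM => //; [exact: fM|exact: fM'].
Qed.

Let bddB f f' : bdd f -> bdd f' -> bdd (fun n x => f n x - f' n x).
Proof.
move=> [M fM] [M' fM']; exists (M + M') => n x fx.
by apply: le_trans (ler_normB _ _) _; apply: lerD; [exact: fM|exact: fM'].
Qed.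

Let bdd_sum (Q : pred 'I_p) (f : 'I_p -> nat -> 'rV[R]_p -> R) :
  (forall i, Q i -> bdd (f i)) -> bdd (fun n x => \sum_(i | Q i) f i n x).
Proof.
move=> fb; have {fb}/choice[M fM] : forall i, exists M, Q i ->
    forall n x, face B x -> `|f i n x| <= M.
  move=> i; have [Qi|nQi] := boolP (Q i); last by exists 0.
  by have [M fM] := fb i Qi; exists M.
exists (\sum_(i | Q i) M i) => n x fx; apply: le_trans (ler_norm_sum _ _ _) _.
by apply: ler_sum => i Qi; exact: fM.
Qed.

Let bdd_comp (f : 'rV[R]_p -> R) : {within face B, continuous f} -> bdd (fun n x => f (y n x)).
Proof.
by move=> /face_bounded[M _ fM]; exists M => n x fx; apply: fM; exact: y_face.
Qed.

Let bdd_ext f f' : (forall n x, face B x -> f n x = f' n x) -> bdd f' -> bdd f.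
Proof. by move=> ff [M fM]; exists M => n x fx; rewrite ff// fM. Qed.

Let bdd_lcp' V j : bdd (fun n x => lcp' P (e n) x V 0 j).
Proof. by exists ((1 + C) * `|V|) => n x fx; exact: lcp'_bd. Qed.

Let bdd_retract' V k : bdd (fun n x => retract' P L (e n) x V 0 k).
Proof.
apply: (@bdd_ext _ (fun n x => (V *m L) 0 k - \sum_(j in B) lcp' P (e n) x V 0 j * nu j 0 k)).
  by move=> n x fx; exact: retract'E.
apply: bddB; first exact: bdd_cst.
by apply: bdd_sum => j _; apply: bddM; [exact: bdd_lcp'|exact: bdd_cst].
Qed.

Let ratio_le (a D0 M k q t : R) : 0 < a -> 0 < q -> 0 <= t -> 0 <= D0 -> t <= D0 * q -> `|k| <= M ->
  `|t / q / a * k| <= D0 / a * M.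
Proof.
move=> a0 q0 t0 D00 tq kM; rewrite normrM; apply: ler_pM => //.
have tq0 : 0 <= t / q by rewrite divr_ge0// ltW.
rewrite ger0_norm; last by rewrite divr_ge0// ltW.
by rewrite ler_pM2r ?invr_gt0// ler_pdivrMr.
Qed.

Let y_ge0 n x j : face B x -> 0 <= y n x 0 j.
Proof. by move=> /(y_face n)[[]]. Qed.

Let y_le n x j : face B x -> y n x 0 j <= x 0 j + D j * e n.
Proof. by move=> fx; have /ler_normlW := y_dist n j fx; rewrite lerBlDl. Qed.

(* [K j] is bounded, so [g j] is of order [e] where a correction is active. *)
Let bdd_local j (s : nat -> 'rV[R]_p -> R) : j \in B -> bdd s ->
  (forall n x, face B x -> (2 * C + 3) * e n <= x 0 j -> s n x = 0) ->
  bdd (fun n x => s n x * (g j (y n x) / e n)).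
Proof.
move=> jB [S sS] sfar; have [M M0 KM] := face_bounded (K_cont jB).
exists (S * ((2 * C + 3 + D j) / (m j * lam j) * M)) => n x fx.
have S0 : 0 <= S by apply: le_trans (sS n x fx).
have ml : 0 < m j * lam j by rewrite mulr_gt0.
have C30 : 0 <= 2 * C + 3 + D j by rewrite !addr_ge0 ?mulr_ge0.
have [/sfar->//|/ltW xj] := leP ((2 * C + 3) * e n) (x 0 j).
  by rewrite mul0r normr0 !mulr_ge0// invr_ge0 ltW.
rewrite g_scaled// normrM; apply: ler_pM => //; first exact: sS.
apply: (ratio_le ml (e_gt0 n) (y_ge0 n j fx) C30 _ (KM _ (y_face n fx))).
by apply: le_trans (y_le n j fx) _; rewrite mulrDl lerD2r.
Qed.

Let bdd_lift'' W V : bdd (fun n x => lift'' B i0 P L (e n) F W V x).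
Proof.
apply: (bdd_ext (fun n x fx => lift''E W V (y_face n fx))); apply: bddB; first apply: bddB.
- apply: bdd_sum => i iB; apply: bddM; first exact: bdd_cst.
  apply: bddB.
    apply: bdd_sum => k kB; apply: bddM; first exact: bdd_cst.
    apply: (@bdd_comp (G2 k i)); exact: (partial2_continuous i0B F2).
  apply: bdd_sum => j jB; apply: bddM; first exact: bdd_lcp'.
  apply: (@bdd_comp (h j i)); exact: (jump_deriv2_continuous i0B FD).
- apply: bdd_sum => j jB; apply: bddM; first exact: bdd_lcp'.
  apply: bdd_sum => k kB; apply: bddM; first exact: bdd_retract'.
  apply: (@bdd_comp (h j k)); exact: (jump_deriv2_continuous i0B FD).
- apply: bdd_sum => j jB.
  apply: (@bdd_ext _ (fun n x => (e n * lcp'' P (e n) x W V 0 j) * (g j (y n x) / e n))).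
    by move=> n x fx; exact/esym/scale_cancel.
  apply: bdd_local => //.
    by eexists => n x fx; exact: lcp''_bd.
  by move=> n x fx /far_lcp''->//; rewrite mulr0.
Qed.

Let max_scaled_bd (e' x' t c : R) : 0 < e' -> e' < x' -> `|t / e'| <= c -> `|t / x'| <= c.
Proof.
move=> e0' ex; apply: le_trans; rewrite !normrM ler_wpM2l//.
have x0 := lt_trans e0' ex.
by rewrite !gtr0_norm ?invr_gt0// lef_pV2 ?posrE// ltW.
Qed.

(** For x_j <= e the derivative is zero. For x_j > e the main term is y_j K_j / (m_j lam_j) with y_j
    <= (1 + D j) x_j, and the corrections stay bounded even when divided by the smaller number e. *)
Let bdd_drift j : bdd (fun n x => (0 < x 0 j)%R%:R * (m j / x 0 j) *
  (lam j * lift' B i0 P L (e n) F (row j (P - 1%:M)) x)).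
Proof.
have [jB|jB] := boolP (j \in B); last first.
  apply: (@bdd_ext _ (fun _ _ => 0)); last exact: bdd_cst.
  by move=> n x fx; rewrite (face_out fx jB) ltxx !mul0r.
have [c1 H1] : bdd (fun n x => \sum_(l in B) lcp' P (e n) x (row j (P - 1%:M)) 0 l *
    (g l (y n x) / e n)).
  apply: bdd_sum => l lB.
  apply: (@bdd_local l (fun n x => lcp' P (e n) x (row j (P - 1%:M)) 0 l)) => //.
  by move=> n x fx; exact: far_lcp'.
have [M M0 KM] := face_bounded (K_cont jB).
have ml : 0 < m j * lam j by rewrite mulr_gt0.
exists ((m j * lam j) * ((1 + D j) / (m j * lam j) * M + c1)) => n x fx; have [sx _] := fx.
have D1 : 0 <= 1 + D j by rewrite addr_ge0.
have c10 : 0 <= c1 by apply: le_trans (H1 n x fx).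
have [xe|xe] := leP (x 0 j) (e n).
  rewrite (lift'_strip B i0 L bar (scale_ok n) F sx xe) !mulr0 normr0.
  by rewrite mulr_ge0 ?(ltW ml)// addr_ge0// mulr_ge0// divr_ge0// ltW.
have xj0 := lt_trans (e_gt0 n) xe.
rewrite xj0 mul1r lift'E.
set S1 := \sum_(i in B) _; set S2 := \sum_(i in B) _.
have -> : m j / x 0 j * (lam j * (S1 - S2)) = (m j * lam j) * (S1 / x 0 j - S2 / x 0 j).
  by move: S1 S2 (x 0 j)^-1 => *; ring.
rewrite normrM (gtr0_norm ml) ler_pM2l//; apply: le_trans (ler_normB _ _) _; apply: lerD.
  have -> : S1 / x 0 j = y n x 0 j / x 0 j / (m j * lam j) * K j (y n x).
    have mln : m j * lam j != 0 by rewrite gt_eqF.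
    have -> : S1 = (m j * lam j)^-1 * (y n x 0 j * K j (y n x)).
      by apply: (canRL (mulKf mln)); exact: gE (y_face n fx).
    by move: (y n x 0 j) (K j (y n x)) (x 0 j) (m j * lam j) => *; ring.
  apply: (ratio_le ml xj0 (y_ge0 n j fx) D1 _ (KM _ (y_face n fx))).
  apply: le_trans (y_le n j fx) _; rewrite mulrDl mul1r lerD2l ler_wpM2l//.
  exact: ltW.
apply: max_scaled_bd (e_gt0 n) xe _ => //.
rewrite mulr_suml; have := H1 n x fx.
by under eq_bigr do rewrite mulrA.
Qed.

Lemma lift_bounded : exists M, forall n x, face B x -> `|lift P L (e n) F x| <= M.
Proof. by apply: (@bdd_comp F); case: F2 => -[]. Qed.

Lemma generator_bounded : exists M, forall n x, face B x ->
  `|generator b m r [set: 'I_p]%SET (lift P L (e n) F) x| <= M.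
Proof.
apply: (@bdd_ext _ _ (fun n x fx => generator_lift (scale_ok n) (proj1 fx))).
apply: bddD; apply: bddM; first exact: bdd_cst.
- by apply: bdd_sum => j _; exact: bdd_drift.
- exact: bdd_cst.
- apply: bdd_sum => j _; apply: bdd_sum => k _; apply: bddM; first exact: bdd_cst.
  exact: bdd_lift''.
Qed.

Lemma domain_approximation : exists (H : nat -> 'rV[R]_p -> R) (M : R),
  (forall n, domain m r [set: 'I_p]%SET (H n)) /\
  forall x, face B x ->
    [/\ H n x @[n --> \oo] --> F x,
        generator b m r [set: 'I_p]%SET (H n) x @[n --> \oo] --> generator b m rB B F x,
        forall n, `|H n x| <= M
      & forall n, `|generator b m r [set: 'I_p]%SET (H n) x| <= M].
Proof.
have [M1 H1] := lift_bounded; have [M2 H2] := generator_bounded.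
exists (fun n => lift P L (e n) F), (Num.max M1 M2); split => [n|x fx].
  exact: lift_domain (scale_ok n).
split; [exact: lift_limit|exact: generator_limit| |] => n.
  by apply: le_trans (H1 n x fx) _; rewrite le_max lexx.
by apply: le_trans (H2 n x fx) _; rewrite le_max lexx orbT.
Qed.

End approximation.

(** * Irreducible chains *)

Section irreducible_chain.
Context {R : realType} {p : nat}.

(** At a negative minimum, which lies outside S, the inequality forces equality along every positive
    entry of A; a path to S then contradicts the sign of h there. *)
Lemma minimum_principle (A : 'I_p -> 'I_p -> R) (S : pred 'I_p) (h : 'I_p -> R) :
  (forall l k, 0 <= A l k) ->
  (forall l, exists2 s, S s & connect [rel l k | 0 < A l k] l s) ->
  (forall s, S s -> 0 <= h s) ->
  (forall l, ~~ S l -> 0 <= \sum_k A l k * (h l - h k)) ->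
  forall l, 0 <= h l.
Proof.
move=> A0 AS hS hA l0.
have [l _ hmin] := @arg_minP _ _ _ l0 xpredT h isT.
apply: le_trans (hmin l0 isT); rewrite leNgt; apply/negP => hl.
have step k k' : h k = h l -> 0 < A k k' -> h k' = h l.
  move=> hk kk'; have Sk : ~~ S k by apply: contraTN hl => /hS; rewrite hk leNgt.
  have T0 i : A k i * (h k - h i) <= 0.
    by rewrite mulr_ge0_le0// subr_le0 hk hmin.
  have /eqP : \sum_i A k i * (h k - h i) = 0.
    by apply/eqP; rewrite eq_le hA// andbT sumr_le0.
  rewrite -oppr_eq0 -sumrN psumr_eq0 => [/allP/(_ k' (mem_index_enum _))|i _].
    by rewrite oppr_eq0 mulf_eq0 gt_eqF//= subr_eq0 -hk => /eqP.
  by rewrite oppr_ge0.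
have [s Ss /connectP[pth]] := AS l; have : h l = h l by [].
elim: pth {1 3 4}l => [|k' pth IH] k hk /=.
  by move=> _ sk; move: hl; rewrite -hk -sk ltNge hS.
by move=> /andP[kk' kp] sk; exact: (IH k' (step _ _ hk kk')).
Qed.

Variables (r : 'I_p -> 'I_p -> R) (m : 'I_p -> R).
Hypothesis r_ge0 : forall i j, 0 <= r i j.
Hypothesis r_diag : forall i, r i i = 0.
Hypothesis r_irr : irreducible_rates r.
Hypothesis hm : stationary r m.
Hypothesis hp : (2 <= p)%N.

Lemma holding_rate_gt0 i : 0 < holding_rate r i.
Proof.
have [j ji] : exists j, j != i.
  apply/existsP; rewrite -[X in is_true X]negbK negb_exists; apply/negP => /forallP h.
  have : (#|'I_p| <= 1)%N by apply/card_le1_eqP => a c _ _; move: (h a) (h c); rewrite !negbK => /eqP-> /eqP->.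
  by rewrite card_ord leqNgt hp.
have /connectP[[|k pth]/=] := r_irr i j; first by move=> _ E; rewrite E eqxx in ji.
move=> /andP[rik _] _; rewrite /holding_rate (bigD1 k)//= ltr_pwDl//.
by apply: sumr_ge0.
Qed.

(** By the balance equation positivity of m spreads along positive rates, and some m k is positive
    because the total is one. *)
Lemma stationary_gt0 i : 0 < m i.
Proof.
have [m0 m1 mr] := hm.
have [k mk] : exists k, 0 < m k.
  apply/existsP; rewrite -[X in is_true X]negbK negb_exists; apply/negP => /forallP h.
  have : \sum_i m i <= 0 by apply: sumr_le0 => j _; rewrite leNgt.
  by rewrite m1 leNgt ltr01.
have step a c : 0 < m a -> 0 < r a c -> 0 < m c.
  move=> ma ac; rewrite -(pmulr_lgt0 _ (holding_rate_gt0 c)) -mr (bigD1 a)//= ltr_pwDl ?mulr_gt0//.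
  by apply: sumr_ge0 => l _; rewrite mulr_ge0.
have /connectP[pth] := r_irr k i.
elim: pth k mk => [|c pth IH] a ma /=; first by move=> _ ->.
by move=> /andP[ac cp] ip; exact: IH (step _ _ ma ac) cp ip.
Qed.

Definition jump_matrix : 'M[R]_p := \matrix_(i, j) (r i j / holding_rate r i).

Lemma jump_matrix_ge0 i j : 0 <= jump_matrix i j.
Proof. by rewrite mxE divr_ge0// ltW ?holding_rate_gt0. Qed.

Lemma jump_matrix_sum i : \sum_j jump_matrix i j = 1.
Proof.
under eq_bigr do rewrite mxE.
by rewrite -mulr_suml divff// gt_eqF// holding_rate_gt0.
Qed.

(* [w / (m lam)] is a function on the time-reversed chain. *)
Let superharmonic (w : 'rV[R]_p) (i : 'I_p) : 0 <= w 0 i ->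
  (forall l, l != i -> 0 <= w 0 l - (w *m jump_matrix) 0 l) -> forall l, 0 <= w 0 l.
Proof.
move=> wi wl l; pose ml k := m k * holding_rate r k.
have ml0 k : 0 < ml k by rewrite mulr_gt0 ?stationary_gt0 ?holding_rate_gt0.
suff : 0 <= w 0 l / ml l by rewrite pmulr_lge0// invr_gt0.
apply: (@minimum_principle (fun l k => m k * r k l) (pred1 i) (fun k => w 0 k / ml k)) => {l}.
- by move=> l k; rewrite mulr_ge0// ltW// stationary_gt0.
- move=> l; exists i => /=; first by rewrite eqxx.
  have H : connect [rel x y | [rel k l | 0 < r k l] y x] l i by rewrite connect_rev /= r_irr.
  apply: connect_sub H => a c /= ac; apply: connect1.
  by rewrite /= mulr_gt0// stationary_gt0.
- by move=> s /eqP->; rewrite divr_ge0// ltW.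
- move=> l /wl /le_trans; apply; rewrite le_eqVlt; apply/orP; left; apply/eqP.
  under [RHS]eq_bigr do rewrite mulrBr.
  rewrite sumrB -mulr_suml; have [_ _ ->] := hm.
  have -> : m l * holding_rate r l * (w 0 l / ml l) = w 0 l by rewrite mulrC divfK// gt_eqF// ml0.
  congr (_ - _); rewrite mxE; apply: eq_bigr => k _; rewrite mxE.
  have := ml0 k; rewrite /ml => mk; field.
  by rewrite !gt_eqF// ?stationary_gt0 ?holding_rate_gt0.
Qed.

(** The matrix of the system that prescribes w - w P off i and w itself at i. *)
Let killed i : 'M[R]_p :=
  \matrix_(k, l) (if l == i then (k == i)%:R else (k == l)%:R - jump_matrix k l).

Let killedE (w : 'rV[R]_p) i l : (w *m killed i) 0 l =
  if l == i then w 0 i else w 0 l - (w *m jump_matrix) 0 l.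
Proof.
rewrite mxE; under eq_bigr do rewrite mxE.
have D k : \sum_j w 0 j * (j == k)%:R = w 0 k.
  by rewrite (bigD1 k)//= eqxx mulr1 big1 ?addr0// => j /negbTE->; rewrite mulr0.
have [_|_] := eqVneq l i; first exact: D.
by under eq_bigr do rewrite mulrBr; rewrite sumrB D !mxE.
Qed.

Let killed_unit i : killed i \in unitmx.
Proof.
rewrite unitmxE unitfE; apply/negP => /det0P[v v0 /rowP vk]; case/eqP: v0.
have vE l : (if l == i then v 0 i else v 0 l - (v *m jump_matrix) 0 l) = 0.
  by rewrite -killedE vk mxE.
have vi : v 0 i = 0 by have := vE i; rewrite eqxx.
apply/rowP => l; rewrite mxE; apply/eqP; rewrite eq_le; apply/andP; split.
  have := @superharmonic (- v) i; rewrite mxE vi oppr0 => /(_ (lexx 0)) H.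
  rewrite -oppr_ge0; have := H _ l; rewrite mxE; apply=> k ki.
  rewrite mulNmx !mxE -opprD; have := vE k; rewrite (negbTE ki).
  by rewrite mxE => ->; rewrite oppr0.
apply: (superharmonic (i := i)); first by rewrite vi.
by move=> k ki; have := vE k; rewrite (negbTE ki) => ->.
Qed.

(** [w i] solves w - w P = 1 off i with value 0 at i; its sign comes from the minimum principle. C
    majorises all the entries through their sum. *)
Lemma barrier_exists : exists w C, barrier jump_matrix w C.
Proof.
pose w i := (\row_l (l != i)%:R) *m invmx (killed i).
have wE i l : (if l == i then w i 0 i else w i 0 l - (w i *m jump_matrix) 0 l) = (l != i)%:R.
  by rewrite -killedE /w mulmxKV ?killed_unit// mxE.
have wi i : w i 0 i = 0 by have := wE i i; rewrite eqxx.
have w0 i l : 0 <= w i 0 l.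
  apply: (superharmonic (i := i)) => [|k ki]; first by rewrite wi.
  by have := wE i k; rewrite (negbTE ki) => ->.
have wP0 i l : 0 <= (w i *m jump_matrix) 0 l.
  by rewrite mxE sumr_ge0// => k _; rewrite mulr_ge0 ?jump_matrix_ge0.
pose C := 1 + \sum_i \sum_l (w i 0 l + (w i *m jump_matrix) 0 l).
have CE i l : 1 + (w i 0 l + (w i *m jump_matrix) 0 l) <= C.
  have S0 k : 0 <= \sum_l (w k 0 l + (w k *m jump_matrix) 0 l).
    by apply: sumr_ge0 => j _; exact: addr_ge0.
  rewrite /C lerD2l (bigD1 i)//= ler_wpDr ?sumr_ge0// (bigD1 l)//= ler_wpDr ?sumr_ge0//.
  by move=> j _; exact: addr_ge0.
exists w, C; split.
- exact: jump_matrix_ge0.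
- exact: jump_matrix_sum.
- by move=> i; rewrite mxE r_diag mul0r.
- exact: wi.
- move=> i l li; have := wE i l; rewrite (negbTE li) /=; lra.
- exact: w0.
- have i : 'I_p by exists 0%N; exact: ltnW.
  by have := CE i i; have := w0 i i; have := wP0 i i; lra.
- by move=> i l; have := CE i l; have := wP0 i l; lra.
- by move=> i l; have := CE i l; have := w0 i l; lra.
Qed.

End irreducible_chain.

Lemma small_scale_exists (R : realType) p (C : R) : (0 < p)%N -> 0 <= C ->
  exists e, small_scale p C e.
Proof.
move=> p0 C0; have C3 : 0 < 2 * C + 3 by rewrite ltr_wpDl// mulr_ge0.
exists (p%:R^-1 / 2 / (2 * C + 3)); split; first by rewrite !divr_gt0 ?invr_gt0 ?ltr0n.
by rewrite mulrC divfK// gt_eqF.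
Qed.

(** * Linear algebra of the trace chain *)

Section trace_algebra.
Context {R : realType} {p : nat} (B : {set 'I_p}).
Variables (m lam : 'I_p -> R) (r rB : 'I_p -> 'I_p -> R) (P q : 'M[R]_p).
Hypothesis P_sum : forall i, \sum_j P i j = 1.
Hypothesis r_lam : forall i j, r i j = lam i * P i j.
Hypothesis m_stat : forall j, \sum_i m i * r i j = m j * lam j.
Hypothesis q_ge0 : forall l k, 0 <= q l k.
Hypothesis q_out : forall l k, k \notin B -> q l k = 0.
Hypothesis q_sum : forall l, \sum_k q l k = 1.
Hypothesis qE : forall l k, k \in B ->
  q l k = P l k + \sum_(c | c \notin B) P l c * q c k.
Hypothesis rB_q : forall j k, j \in B -> k \in B ->
  rB j k = (j != k)%:R * (lam j * q j k).

(** [q l k] stands for the probability that the chain started from l returns to B at k, after at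
    least one jump; here time zero counts as a visit. *)
Definition hitting_matrix : 'M[R]_p :=
  \matrix_(l, k) (if l \in B then (l == k)%:R else q l k).
Local Notation L := hitting_matrix.

Lemma hitting_matrix_ge0 i j : 0 <= L i j.
Proof. by rewrite mxE; case: ifP. Qed.

Lemma hitting_matrix_out i j : j \notin B -> L i j = 0.
Proof.
move=> jB; rewrite mxE; case: ifPn => iB; last exact: q_out.
by case: eqP jB => // <-; rewrite iB.
Qed.

Lemma hitting_matrix_id i j : i \in B -> L i j = (i == j)%:R.
Proof. by move=> iB; rewrite mxE iB. Qed.

Let sum_delta (j : 'I_p) (f : 'I_p -> R) : \sum_k (j == k)%:R * f k = f j.
Proof.
rewrite (bigD1 j)//= eqxx mul1r big1 ?addr0// => k kj.
by rewrite eq_sym (negbTE kj) mul0r.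
Qed.

Lemma hitting_matrix_sum i : \sum_j L i j = 1.
Proof.
have [iB|iB] := boolP (i \in B); last first.
  by rewrite -[RHS](q_sum i); apply: eq_bigr => j _; rewrite mxE (negbTE iB).
under eq_bigr do rewrite hitting_matrix_id//.
by rewrite -[RHS](sum_delta i (fun=> 1)); apply: eq_bigr => k _; rewrite mulr1.
Qed.

(** Decomposition according to the first jump. *)
Let PL : P *m L = q.
Proof.
apply/matrixP => l k; rewrite mxE; have [kB|kB] := boolP (k \in B); last first.
  by rewrite q_out// big1// => c _; rewrite hitting_matrix_out// mulr0.
rewrite qE// (bigID (mem B))/=; congr (_ + _).
  rewrite (bigD1 k)//= hitting_matrix_id// eqxx mulr1 big1 ?addr0// => c /andP[cB ck].
  by rewrite hitting_matrix_id// (negbTE ck) mulr0.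
by apply: eq_bigr => c cB; rewrite mxE (negbTE cB).
Qed.

Let row_gen j k : (row j (P - 1%:M) *m L) 0 k = q j k - L j k.
Proof. by rewrite -row_mul mulmxBl mul1mx PL mxE mxE mxE. Qed.

Lemma hitting_matrix_kill j : j \notin B -> row j (P - 1%:M) *m L = 0.
Proof.
by move=> jB; apply/rowP => k; rewrite row_gen !mxE (negbTE jB) subrr.
Qed.

Let sum_B (f : 'I_p -> R) j : \sum_(k in B) q j k * f k = \sum_k q j k * f k.
Proof.
rewrite [RHS](bigID (mem B))/= [X in _ = _ + X]big1 ?addr0// => k kB.
by rewrite q_out// mul0r.
Qed.

Lemma hitting_matrix_drift j : j \in B ->
  drift_vec rB B j = lam j *: (row j (P - 1%:M) *m L).
Proof.
move=> jB; apply/rowP => i; rewrite summxE [RHS]mxE row_gen.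
transitivity (lam j * \sum_(k in B) q j k * ((k == i)%:R - (j == i)%:R)).
  rewrite mulr_sumr; apply: eq_bigr => k kB; rewrite !mxE rB_q// eqxx/=.
  rewrite ![i == _]eq_sym; have [->|_] := eqVneq j k; first by rewrite subrr !mulr0.
  by rewrite mul1r mulrA.
rewrite sum_B; congr (_ * _).
under eq_bigr do rewrite mulrBr.
rewrite sumrB -mulr_suml q_sum mul1r hitting_matrix_id//; congr (_ - _).
by under eq_bigr do rewrite mulrC eq_sym; rewrite sum_delta.
Qed.

Let mu j := m j * lam j.

Let mu_P k : \sum_j mu j * P j k = mu k.
Proof. by rewrite /mu -m_stat; apply: eq_bigr => j _; rewrite r_lam; ring. Qed.

(** Invariance under P gives mu q = mu P L = mu L; the contributions of the states outside B, where
    the rows of L and q agree, cancel. *)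
Let mu_q k : k \in B -> \sum_(j in B) mu j * q j k = mu k.
Proof.
move=> kB; have : \sum_j mu j * q j k = \sum_l mu l * L l k.
  transitivity (\sum_j \sum_l mu j * P j l * L l k).
    by apply: eq_bigr => j _; rewrite -PL mxE mulr_sumr; apply: eq_bigr => l _; rewrite mulrA.
  by rewrite exchange_big/=; apply: eq_bigr => l _; rewrite -mulr_suml mu_P.
rewrite (bigID (mem B))/= [RHS](bigID (mem B))/=.
rewrite [X in _ = _ + X -> _](eq_bigr (fun l => mu l * q l k)); last first.
  by move=> l lB; rewrite mxE (negbTE lB).
move=> /addIr->; rewrite (bigD1 k)//= hitting_matrix_id// eqxx mulr1.
rewrite big1 ?addr0// => l /andP[lB lk].
by rewrite hitting_matrix_id// (negbTE lk) mulr0.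
Qed.

(** After expansion the kernel enters only through its row sums, its action on u and v, and its
    column sums weighted by [mu]. *)
Let expand (D : {set 'I_p}) (a : 'I_p -> 'I_p -> R) (u v : 'I_p -> R) :
  \sum_(j in D) \sum_(l in D) mu j * a j l * ((u j - u l) * (v j - v l)) =
  \sum_(j in D) mu j * (u j * v j * \sum_(l in D) a j l
     - u j * \sum_(l in D) a j l * v l - v j * \sum_(l in D) a j l * u l)
  + \sum_(l in D) (\sum_(j in D) mu j * a j l) * (u l * v l).
Proof.
rewrite [X in _ = _ + X](_ : _ = \sum_(j in D) \sum_(l in D) mu j * a j l * (u l * v l)); last first.
  by rewrite exchange_big; apply: eq_bigr => l _; rewrite mulr_suml.
rewrite -big_split/=; apply: eq_bigr => j _; rewrite !mulr_sumr -!sumrB mulr_sumr -big_split/=.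
by apply: eq_bigr => l _; ring.
Qed.

(* Both sides only involve [mu (q - 1)] on [B]: outside [B] the rows of [L] and
   [q = P L] agree, and [mu] is invariant for [P] and for [q] on [B]. *)
Lemma hitting_matrix_dirichlet i k : i \in B -> k \in B ->
  \sum_j \sum_l m j * r j l * (((basis_vec R j - basis_vec R l) *m L) 0 i *
     ((basis_vec R j - basis_vec R l) *m L) 0 k) =
  \sum_(j in B) \sum_(l in B) m j * rB j l * ((basis_vec R j - basis_vec R l) 0 i *
     (basis_vec R j - basis_vec R l) 0 k).
Proof.
move=> iB kB; pose d (i j : 'I_p) : R := (j == i)%:R.
have LE i' j l : ((basis_vec R j - basis_vec R l) *m L) 0 i' = L j i' - L l i'.
  by rewrite mulmxBl mxE [in X in _ + X]mxE /basis_vec -!rowE !mxE.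
have dE i' j l : (basis_vec R j - basis_vec R l) 0 i' = d i' j - d i' l.
  by rewrite !mxE /d !(eq_sym i') eqxx.
transitivity (\sum_(j in [set: 'I_p]%SET) \sum_(l in [set: 'I_p]%SET)
    mu j * P j l * ((L j i - L l i) * (L j k - L l k))).
  apply: eq_big => [j|j _]; rewrite ?inE//; apply: eq_big => [l|l _]; rewrite ?inE//.
  by rewrite !LE r_lam /mu; congr (_ * _); rewrite mulrA.
transitivity (\sum_(j in B) \sum_(l in B)
    mu j * q j l * ((d i j - d i l) * (d k j - d k l))); last first.
  apply: eq_bigr => j jB; apply: eq_bigr => l lB; rewrite !dE rB_q//.
  have [->|_] := eqVneq j l; first by rewrite !subrr !mul0r !mulr0.
  by rewrite mul1r /mu; congr (_ * _); rewrite mulrA.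
rewrite !expand.
have setTE (f : 'I_p -> R) : \sum_(j in [set: 'I_p]%SET) f j = \sum_j f j.
  by apply: eq_bigl => j; rewrite inE.
rewrite !setTE.
have L1 j i' : \sum_(l in [set: 'I_p]%SET) P j l * L l i' = q j i'.
  by rewrite setTE -PL mxE.
have d1 j i' : i' \in B -> \sum_(l in B) q j l * d i' l = q j i'.
  move=> i'B; rewrite sum_B -[RHS](sum_delta i' (q j)); apply: eq_bigr => l _.
  by rewrite mulrC /d eq_sym.
have q1 j : \sum_(l in B) q j l = 1.
  by rewrite -(q_sum j); have := sum_B (fun=> 1) j; under eq_bigr do rewrite mulr1; move=> ->; under eq_bigr do rewrite mulr1.
rewrite [X in _ + X](_ : _ = \sum_j mu j * (L j i * L j k)); last first.
  by apply: eq_bigr => l _; rewrite setTE mu_P.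
rewrite [X in _ = _ + X](_ : _ = \sum_(j in B) mu j * (d i j * d k j)); last first.
  by apply: eq_bigr => l lB; rewrite mu_q.
rewrite -!big_split/= (bigID (mem B))/= [X in _ + X]big1 ?addr0.
  by apply: eq_bigr => j jB; rewrite !L1 !d1// q1 setTE P_sum !hitting_matrix_id.
move=> j jB; rewrite !L1 setTE P_sum !mxE (negbTE jB).
by ring.
Qed.

End trace_algebra.

(** * Trace rates *)

Section finite_additivity.
Context {d : measure_display} {T : measurableType d} {R : realType}.

Lemma measure_fin_bigcup_pred (mu : {measure set T -> \bar R}) (I : finType) (Q : pred I)
  (F : I -> set T) : (forall i, Q i -> measurable (F i)) -> trivIset [set` Q] F ->
  mu (\bigcup_(i in [set` Q]) F i) = (\sum_(i | Q i) mu (F i))%E.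
Proof.
move=> mF tF; rewrite measure_fin_bigcup//.
rewrite (@fsbigE _ _ _ _ _ [seq i <- index_enum I | Q i]) ?filter_uniq ?index_enum_uniq//.
- rewrite big_filter_cond/=; apply: eq_bigl => i.
  by rewrite andb_idr// => Qi; apply/mem_set.
- by move=> i /=; rewrite mem_filter => /andP[].
- by move=> i /= Qi; rewrite mem_filter mem_index_enum andbT; move=> /negP; case.
Qed.

Lemma probability_setIl (P : probability T R) (A E : set T) :
  measurable A -> measurable E -> P A = 1%E -> P (A `&` E) = P E.
Proof.
move=> mA mE PA; rewrite -[in RHS](setIT E) -(setUv A) setIUr [A `&` E]setIC.
rewrite measureU0 //; [exact: measurableI|exact/measurableI/measurableC|].
have PA0 : P (~` A) = 0 by rewrite probability_setC// PA subee.
apply: (subset_measure0 _ (measurableC mA) (@subIsetr _ _ _) PA0).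
exact/measurableI/measurableC.
Qed.

End finite_additivity.

(** * Hitting and return times of a single jump path *)

Section first_entrance.
Context {R : realType} {p : nat} (X : R -> 'I_p) (Y : nat -> 'I_p) (tau : nat -> R).
Hypothesis tau_gt0 : forall n, 0 < tau n.
Hypothesis tau_unbounded : forall t : R, exists n, t < \sum_(k < n) tau k.
Hypothesis X_Y : forall n t, \sum_(k < n) tau k <= t < \sum_(k < n.+1) tau k -> X t = Y n.
Let S n := \sum_(k < n) tau k.

Let S_lt : {homo S : i j / (i < j)%N >-> i < j}.
Proof. by apply: homo_ltn lt_trans _ => n; rewrite /S big_ord_recr/= ltrDl. Qed.

Let S_le : {homo S : i j / (i <= j)%N >-> i <= j}.
Proof. by move=> i j; rewrite leq_eqVlt => /predU1P[->//|/S_lt/ltW]. Qed.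

Let S0 : S 0 = 0. Proof. by rewrite /S big_ord0. Qed.

Let jump_index t : 0 <= t -> exists n, S n <= t < S n.+1.
Proof.
move=> t0; have ex : exists n, t < S n by exact: tau_unbounded.
have := ex_minnP ex; case: ex_minnP => -[|n] tn nmin _.
  by move: tn; rewrite S0 ltNge t0.
by exists n; rewrite tn andbT leNgt; apply/negP => /nmin; rewrite ltnn.
Qed.

Let entrance (A : set nat) : \bar R :=
  ereal_inf [set t%:E | t in [set t | exists2 n, A n & S n <= t < S n.+1]].

Let entrance_first A n : A n -> (forall k, A k -> (n <= k)%N) -> entrance A = (S n)%:E.
Proof.
move=> An nmin; apply/eqP; rewrite eq_le; apply/andP; split.
  by apply: ereal_inf_lbound; exists (S n) => //; exists n; rewrite // lexx S_lt.
apply: le_ereal_inf_tmp => _ [t [k /nmin nk /andP[kt _]] <-].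
by rewrite lee_fin (le_trans (S_le nk)).
Qed.

Let entrance_none A : (forall k, ~ A k) -> entrance A = +oo%E.
Proof.
move=> A0; rewrite -ereal_inf0; congr ereal_inf; apply/seteqP; split => // _ [t [k /A0]] //.
Qed.

Let timesE (A : 'I_p -> Prop) :
  [set t | 0 <= t /\ A (X t)] = [set t | exists2 n, A (Y n) & S n <= t < S n.+1].
Proof.
apply/seteqP; split => t /=.
  by move=> [/jump_index[n tn]] ; rewrite (X_Y tn) => An; exists n.
by move=> [n An tn]; rewrite (X_Y tn); split => //; case/andP: tn => + _; apply: le_trans; rewrite -S0 S_le.
Qed.

Let hitting_timeE k :
  ereal_inf [set t%:E | t in [set t | 0 <= t /\ X t = k]] = entrance [set n | Y n = k].
Proof. by rewrite (timesE (fun a => a = k)). Qed.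

Hypothesis Y_jump : forall n, Y n.+1 <> Y n.

Let first_jump_timeE : ereal_inf [set t%:E | t in [set t | 0 <= t /\ X t <> X 0]] = (S 1)%:E.
Proof.
have X0 : X 0 = Y 0%N by apply: X_Y; rewrite -!/(S _) S0 lexx/= -S0 S_lt.
rewrite X0 (timesE (fun a => a <> Y 0%N)); apply: (@entrance_first [set n | Y n <> Y 0%N]) => /=.
  exact: Y_jump.
by case.
Qed.

Let return_timeE (B : {set 'I_p}) :
  ereal_inf [set t%:E | t in [set t | [/\ 0 <= t, ((S 1)%:E <= t%:E)%E & X t \in B]]] =
  entrance [set n | (0 < n)%N /\ Y n \in B].
Proof.
congr ereal_inf; congr image; apply/seteqP; split => t /=.
  move=> [t0]; rewrite lee_fin => t1 XB; have [n tn] := jump_index t0.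
  exists n => //; split; last by rewrite -(X_Y tn).
  by case: n tn => // /andP[_]; rewrite ltNge t1.
move=> [n [n0 nB] tn]; rewrite (X_Y tn) lee_fin; case/andP: tn => nt _.
by split => //; apply: le_trans nt; rewrite -?S0 S_le.
Qed.

(** A path started off k that never returns to B has both times infinite, hence equal; this case is
    kept here and turns out to be null later. A path started at k hits it at time zero, before any
    return. The index [s.+1] reflects that returns count from the first jump on. *)
Lemma hitting_eq_return (B : {set 'I_p}) k : k \in B ->
  (ereal_inf [set t%:E | t in [set t | 0 <= t /\ X t = k]] =
   ereal_inf [set t%:E | t in [set t | [/\ 0 <= t,
     (ereal_inf [set t%:E | t in [set t | (0 <= t)%R /\ X t <> X 0%R]] <= t%:E)%E & X t \in B]]])
  <->
  (Y 0%N <> k /\ ((exists s, (forall t, (t < s)%N -> Y t.+1 \notin B) /\ Y s.+1 = k) \/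
    (forall s, Y s.+1 \notin B))).
Proof.
move=> kB; rewrite first_jump_timeE return_timeE hitting_timeE; split; last first.
  move=> [Y0 [[s [sB sk]]|nB]].
    rewrite (@entrance_first _ s.+1)//= => [|[|t]//= tk]; last first.
      by rewrite ltnS leqNgt; apply/negP => /sB; rewrite tk kB.
    rewrite (@entrance_first _ s.+1)//= ?sk// => -[|t] [//= _ tB].
    by rewrite ltnS leqNgt; apply/negP => /sB; rewrite tB.
  rewrite !entrance_none// => -[|n] //=.
    by case.
  - by move=> [_]; apply/negP; exact: nB.
  - by move=> nk; have := nB n; rewrite nk kB.
have [nB|] := pselect (forall s, Y s.+1 \notin B).
  rewrite [X in _ = X -> _]entrance_none; last first.
    by move=> [|n] [//= _]; apply/negP; exact: nB.
  move=> h; split; last by right.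
  move=> Y0; move: h; rewrite (@entrance_first _ 0%N)//.
move=> /existsNP[s0 /negP]; rewrite negbK => s0B.
have ex : exists s, Y s.+1 \in B by exists s0.
case: (ex_minnP ex) => s sB smin.
rewrite [X in _ = X -> _](@entrance_first _ s.+1)//=; last first.
  by move=> [|t] [//= _ /smin].
have [[n0 n0k]|nk] := pselect (exists n, Y n = k); last first.
  by rewrite entrance_none// => n nk'; apply: nk; exists n.
have exk : exists n, Y n == k by exists n0; exact/eqP.
case: (ex_minnP exk) => n /eqP nk nmin.
rewrite (@entrance_first _ n)//= => [|i /eqP/nmin//].
move=> [Sns]; have {Sns} ns : n = s.+1.
  by have [/S_lt|/S_lt|//] := ltngtP n s.+1; rewrite Sns ltxx.
split.
  by move=> /eqP/nmin; rewrite ns.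
left; exists s; split; last by rewrite -ns.
by move=> t ts; apply/negP => /smin; rewrite leqNgt ts.
Qed.

End first_entrance.

(** * First return probabilities and the rates of the trace *)

Section trace_rates.
Context {R : realType} {p : nat} {d : measure_display} {Omega : measurableType d}.
Variables (r : 'I_p -> 'I_p -> R) (Pr : 'I_p -> probability Omega R).
Variables (X : R -> Omega -> 'I_p) (Y : nat -> Omega -> 'I_p) (tau : nat -> Omega -> R).
Hypothesis hp : (2 <= p)%N.
Hypothesis r_ge0 : forall i j, 0 <= r i j.
Hypothesis r_diag : forall i, r i i = 0.
Hypothesis r_irr : irreducible_rates r.
Hypothesis Y_meas : forall n i, measurable (Y n @^-1` [set i]).
Hypothesis Y_jump : forall n w, Y n.+1 w <> Y n w.
Hypothesis tau_gt0 : forall n w, 0 < tau n w.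
Hypothesis tau_unbounded : forall w (t : R), exists n, t < \sum_(k < n) tau k w.
Hypothesis X_Y : forall n w t,
  \sum_(k < n) tau k w <= t < \sum_(k < n.+1) tau k w -> X t w = Y n w.
Hypothesis law : forall (j : 'I_p) n (i : nat -> 'I_p) (t : nat -> R),
  (forall k, 0 <= t k) ->
  Pr j [set w | forall k, (k <= n)%N -> Y k w = i k /\ t k < tau k w] =
  ((i 0%N == j)%:R *
   \prod_(k < n) (r (i k) (i k.+1) / holding_rate r (i k)) *
   \prod_(k < n.+1) expR (- (holding_rate r (i k) * t k)))%:E.
Variable B : {set 'I_p}.
Hypothesis B_ex : exists i, i \in B.

Let P := jump_matrix r.

Let hold_gt0 := holding_rate_gt0 r_ge0 r_irr hp.

Let path_law j n i : Pr j [set w | forall k, (k <= n)%N -> Y k w = i k] =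
  ((i 0%N == j)%:R * \prod_(k < n) P (i k) (i k.+1))%:E.
Proof.
(* The thresholds are taken to be 0: the holding times are positive, so they impose nothing. *)
have := law j n i (t := fun=> 0) (fun=> lexx 0).
rewrite [X in _ = (_ * X)%:E]big1 ?mulr1 => [|k _]; last by rewrite mulr0 oppr0 expR0.
under eq_bigr do rewrite -[_ / _](mxE matrix_key (fun i j => r i j / holding_rate r i)).
move=> <-; congr (Pr j _); apply/seteqP; split => w h k kn; last by have [] := h k kn.
by split; [exact: h|exact: tau_gt0].
Qed.

Let Y_in (A : set 'I_p) n : measurable [set w | A (Y n w)].
Proof.
rewrite (_ : [set w | _] = \bigcup_(i in A) (Y n @^-1` [set i])); last first.
  apply/seteqP; split => w /=; first by move=> Aw; exists (Y n w).
  by move=> [i Ai ->].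
exact: fin_bigcup_measurable.
Qed.

Let Y_all (A : nat -> set 'I_p) : measurable [set w | forall n, A n (Y n w)].
Proof.
rewrite (_ : [set w | _] = \bigcap_n [set w | A n (Y n w)]); last first.
  by apply/seteqP; split => w h n; [move=> _; exact: h|exact: (h n I)].
by apply: bigcapT_measurable => n; exact: Y_in.
Qed.

Let path n (i : nat -> 'I_p) : set Omega := [set w | forall k, (k <= n)%N -> Y k w = i k].

Let first_at n s k : set Omega :=
  [set w | (forall t, (t < s)%N -> Y (n + t).+1 w \notin B) /\ Y (n + s).+1 w = k].

Let path_meas n i : measurable (path n i).
Proof. exact: (Y_all (fun k a => (k <= n)%N -> a = i k)). Qed.

Let first_at_meas n s k : measurable (first_at n s k).
Proof.
apply: measurableI; last exact: (Y_in (fun a => a = k)).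
rewrite [X in measurable X](_ : _ = \bigcap_t [set w | (t < s)%N -> Y (n + t).+1 w \notin B]); last first.
  by apply/seteqP; split => w h t; [move=> _; exact: h|exact: (h t I)].
by apply: bigcapT_measurable => t; exact: (Y_in (fun a => (t < s)%N -> a \notin B)).
Qed.

(** Taboo probabilities: s jumps to states outside B, then one jump to k. *)
Let a := fix a s (k l : 'I_p) : R :=
  if s is s'.+1 then \sum_(c | c \notin B) P l c * a s' k c else P l k.

Let extend n (i : nat -> 'I_p) c l := if l == n.+1 then c else i l.

Let extend_weight n i c j :
  ((extend n i c 0%N == j)%:R * \prod_(k < n.+1) P (extend n i c k) (extend n i c k.+1)) =
  ((i 0%N == j)%:R * \prod_(k < n) P (i k) (i k.+1)) * P (i n) c.
Proof.
rewrite big_ord_recr/= mulrA; congr (_ * _ * _).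
  apply: eq_bigr => k _; rewrite /extend !ltn_eqF ?ltnS// ?leqW//; last exact: ltnW.
by rewrite /extend ltn_eqF// eqxx.
Qed.

Let path_extend n i c w : path n.+1 (extend n i c) w <-> path n i w /\ Y n.+1 w = c.
Proof.
split=> [h|[h hc] k].
  split=> [k kn|]; last by have := h n.+1 (leqnn _); rewrite /extend eqxx.
  by have := h k (leqW kn); rewrite /extend ltn_eqF// ltnS.
by rewrite leq_eqVlt /extend => /predU1P[->|kn]; [rewrite eqxx|rewrite ltn_eqF//; exact: h].
Qed.

(** The Markov property is available only through the laws of finite paths, so a prescribed path is
    carried along and lengthened by one state at each step of the induction. *)
Let first_at_law s n i k j : Pr j (path n i `&` first_at n s k) =
  (((i 0%N == j)%:R * \prod_(l < n) P (i l) (i l.+1)) * a s k (i n))%:E.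
Proof.
elim: s n i => [|s IH] n i /=.
  rewrite -extend_weight -path_law; congr (Pr j _); apply/seteqP; split => w.
    by move=> [h [_]]; rewrite addn0 => hk; apply/path_extend.
  by move=> /path_extend[h hk]; split => //; split => //; rewrite addn0.
rewrite (_ : _ `&` _ = \bigcup_(c in [set` [pred c | c \notin B]])
    (path n.+1 (extend n i c) `&` first_at n.+1 s k)); last first.
  apply/seteqP; split => w.
    move=> [h [nB hk]]; exists (Y n.+1 w).
      by have := nB 0%N isT; rewrite addn0.
    split; first by apply/path_extend.
    by split=> [t ts|]; rewrite addSnnS; [exact: nB|].
  move=> [c /= cB] [/path_extend[h hc] [nB hk]]; split => //; split.
    move=> [|t] ts; first by rewrite addn0 hc.
    by rewrite addnS -addSn; exact: nB.
  by rewrite addnS -addSn.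
rewrite measure_fin_bigcup_pred.
- rewrite mulr_sumr -sumEFin; apply: eq_big => // c _.
  apply: (etrans (IH n.+1 (extend n i c))); congr (_%:E).
  by rewrite extend_weight [extend _ _ _ n.+1]/extend eqxx mulrA.
- by move=> c _; exact: measurableI.
- move=> c c' _ _ [w [[/path_extend[_ <-] _] [/path_extend[_ <-] _]]] //.
Qed.

Let entry k := \bigcup_s first_at 0 s k.

Let entry_meas k : measurable (entry k).
Proof. exact: bigcupT_measurable. Qed.

Let start_law l : Pr l [set w | Y 0%N w = l] = 1%E.
Proof.
have := path_law l 0 (fun=> l); rewrite big_ord0 eqxx mulr1 => <-; congr (Pr l _).
by apply/seteqP; split => w h; [move=> k; rewrite leqn0 => /eqP->|exact: (h 0%N)].
Qed.

Let first_at0_law s k l : Pr l (first_at 0 s k) = (a s k l)%:E.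
Proof.
have := first_at_law s 0 (fun=> l) k l; rewrite big_ord0 eqxx !mul1r => <-.
rewrite probability_setIl// -[RHS](start_law l); congr (Pr l _).
by apply/seteqP; split => w h; [exact: (h 0%N)|move=> k'; rewrite leqn0 => /eqP->].
Qed.

Let first_at_inj s s' k k' w : k \in B -> k' \in B ->
  first_at 0 s k w -> first_at 0 s' k' w -> s = s'.
Proof.
move=> kB k'B [nB hk] [nB' hk'].
have [ss|ss|//] := ltngtP s s'.
  by have := nB' _ ss; rewrite hk kB.
by have := nB _ ss; rewrite hk' k'B.
Qed.

Definition return_matrix : 'M[R]_p :=
  \matrix_(l, k) (if k \in B then fine (Pr l (entry k)) else 0).
Local Notation q := return_matrix.

Let entry_law l k : k \in B -> Pr l (entry k) = (q l k)%:E.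
Proof. by move=> kB; rewrite mxE kB fineK// fin_num_measure. Qed.

Let entry_series l k : k \in B -> \sum_(0 <= s < n) a s k l @[n --> \oo] --> q l k.
Proof.
move=> kB; have : (fun n => \sum_(0 <= s < n) Pr l (first_at 0 s k))%E @ \oo --> Pr l (entry k).
  apply: measure_sigma_additive => //; apply/trivIsetP => s s' _ _ /eqP ss.
  by rewrite -subset0 => w [h h']; apply: ss; exact: first_at_inj h h'.
rewrite entry_law// (_ : (fun _ => _) = (fun n => (\sum_(0 <= s < n) a s k l)%:E)).
  by move=> /fine_cvg.
by apply/funext => n; rewrite -sumEFin; apply: eq_bigr => s _.
Qed.

Lemma return_matrix_ge0 l k : 0 <= q l k.
Proof. by rewrite mxE; case: ifP => // _; exact: fine_ge0. Qed.

Lemma return_matrix_out l k : k \notin B -> q l k = 0.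
Proof. by rewrite mxE => /negbTE->. Qed.

(** Both sides are limits of the partial sums of the taboo probabilities, whose recursion shifts the
    index by one. *)
Lemma return_matrixE l k : k \in B ->
  q l k = P l k + \sum_(c | c \notin B) P l c * q c k.
Proof.
move=> kB; have h1 := entry_series (l := l) kB; rewrite -cvg_shiftS in h1.
have h2 : \sum_(0 <= s < n.+1) a s k l @[n --> \oo] -->
    P l k + \sum_(c | c \notin B) P l c * q c k.
  have E n : \sum_(0 <= s < n.+1) a s k l =
      P l k + \sum_(c | c \notin B) P l c * \sum_(0 <= s < n) a s k c.
    rewrite big_nat_recl//=; congr (_ + _); rewrite exchange_big/=.
    by apply: eq_bigr => c _; rewrite mulr_sumr.
  under eq_fun do rewrite E.
  apply: cvgD; first exact: cvg_cst.
  by apply: cvg_bigsum => c _; apply: cvgMr; exact: entry_series.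
exact: (cvg_unique _ h1 h2).
Qed.

Let never : set Omega := [set w | forall s, Y s.+1 w \notin B].

Let neverE : never = ~` \bigcup_(k in [set` [pred k | k \in B]]) entry k.
Proof.
apply/seteqP; split => w.
  move=> nB [k /= kB [s _ [_ hk]]].
  by have := nB s; move: hk; rewrite add0n => ->; rewrite kB.
move=> ne s; apply/negP => sB; apply: ne.
have ex : exists s, Y s.+1 w \in B by exists s.
case: (ex_minnP ex) => s0 s0B smin; exists (Y s0.+1 w) => //.
exists s0 => //; split => // t ts; apply/negP => /smin; by rewrite leqNgt ts.
Qed.

Let entries_meas : measurable (\bigcup_(k in [set` [pred k | k \in B]]) entry k).
Proof. by apply: fin_bigcup_measurable. Qed.

Let never_law l : Pr l never = (1 - \sum_k q l k)%:E.
Proof.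
rewrite neverE probability_setC// EFinB; congr (_ - _)%E.
rewrite measure_fin_bigcup_pred//.
  have -> : \sum_k q l k = \sum_(k in B) q l k.
    rewrite (bigID (mem B))/= [X in _ + X]big1 ?addr0// => k; exact: return_matrix_out.
  by rewrite -sumEFin; apply: eq_big => // k; rewrite inE; exact: entry_law.
move=> k k' /=; rewrite !inE => kB k'B [w [[s _ h] [s' _ h']]].
by have ss := first_at_inj kB k'B h h'; case: h h' => _ <- [_ <-]; rewrite ss.
Qed.

(** Recurrence: f is the probability of never returning to B, and its first jump equation only
    involves states outside B. The minimum principle for -f, set to zero on B, gives f <= 0 off B;
    the equation then gives f = 0 everywhere. *)
Lemma return_matrix_sum l : \sum_k q l k = 1.
Proof.
pose f l := 1 - \sum_k q l k.
have f0 i : 0 <= f i by rewrite -lee_fin -never_law.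
have fE i : f i = \sum_(c | c \notin B) P i c * f c.
  rewrite /f -[X in X - _](jump_matrix_sum r_ge0 r_irr hp i).
  rewrite (bigID (mem B))/= [\sum_k q i k](bigID (mem B))/= [X in _ - (_ + X)]big1 ?addr0 => [|k]; last exact: return_matrix_out.
  under [\sum_(k in B) q i k]eq_bigr => k kB do rewrite return_matrixE//.
  rewrite big_split/= opprD addrACA subrr add0r exchange_big/= -sumrB.
  apply: eq_bigr => c _; rewrite -mulr_sumr mulrBr mulr1; congr (_ - _ * _).
  by rewrite [RHS](bigID (mem B))/= [X in _ = _ + X]big1 ?addr0 => [//|k]; exact: return_matrix_out.
suff fB c : c \notin B -> f c = 0.
  by apply/eqP; rewrite eq_sym -subr_eq0 -/(f l) fE big1// => c /fB->; rewrite mulr0.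
move=> cB; apply/eqP; rewrite eq_le f0 andbT -oppr_ge0.
have := @minimum_principle _ _ P (mem B) (fun i => if i \in B then 0 else - f i).
move=> /(_ _ _ _ _ c); rewrite (negbTE cB); apply.
- by move=> i j; exact: jump_matrix_ge0.
- have [i iB] := B_ex; move=> j; exists i => //.
  apply: connect_sub (r_irr j i) => x y /= xy; apply: connect1.
  by rewrite /= mxE divr_gt0.
- by move=> s /= ->.
- move=> i /= iB; rewrite (negbTE iB).
  under eq_bigr do rewrite mulrBr.
  rewrite sumrB -mulr_suml (jump_matrix_sum r_ge0 r_irr hp) mul1r fE.
  rewrite [X in _ - X](bigID (mem B))/= [X in _ - (X + _)]big1 => [|k ->]; last by rewrite mulr0.
  rewrite add0r -opprD oppr_ge0 -big_split/= sumr_le0// => k kB.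
  by rewrite (negbTE kB) mulrN subrr.
Qed.

(** Never returning to B is a null event by recurrence, and the start differs from k almost surely
    under [Pr j] when j <> k. *)
Lemma trace_rateE j k : j \in B -> k \in B ->
  trace_rate r Pr X B j k = (j != k)%:R * (holding_rate r j * q j k).
Proof.
move=> jB kB; rewrite /trace_rate; have [_|jk] := eqVneq j k; first by rewrite mul0r.
rewrite mul1r; congr (_ * _).
have never_null : Pr j never = 0 by rewrite never_law return_matrix_sum subrr.
have never_meas : measurable never.
  by rewrite neverE; exact: measurableC.
rewrite (_ : [set w | _] = ([set w | Y 0%N w <> k] `&` (entry k `|` never))); last first.
  apply/seteqP; split => w /=.
    move=> /(hitting_eq_return (fun n => tau_gt0 n w) (tau_unbounded w)
      (fun n t => @X_Y n w t) (fun n => @Y_jump n w) kB)[Y0 [[s hs]|nB]]; split => //.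
      by left; exists s.
    by right.
  move=> [Y0 h]; apply/(hitting_eq_return (fun n => tau_gt0 n w) (tau_unbounded w)
      (fun n t => @X_Y n w t) (fun n => @Y_jump n w) kB); split => //.
  by case: h => [[s _ hs]|nB]; [left; exists s|right].
rewrite probability_setIl; last 3 first.
- exact: (Y_in (fun a => a <> k)).
- exact: measurableU.
- apply/eqP; rewrite eq_le probability_le1 ?andTb; last exact: (Y_in (fun a => a <> k)).
  rewrite -(start_law j); apply: le_measure; rewrite ?inE.
  + exact: (Y_in (fun a => a = j)).
  + exact: (Y_in (fun a => a <> k)).
  + by move=> w /= ->; apply/eqP.
by rewrite measureU0//= entry_law.
Qed.

End trace_rates.

(** With no state outside B, the first return is the first jump and the return matrix is the jump
    matrix. *)
Lemma trace_rate_full {R : realType} {p : nat} {d : measure_display} {Omega : measurableType d}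
  (r : 'I_p -> 'I_p -> R) (Pr : 'I_p -> probability Omega R) (X : R -> Omega -> 'I_p) :
  (2 <= p)%N -> (forall i j, 0 <= r i j) -> (forall i, r i i = 0) -> irreducible_rates r ->
  markov_chain r Pr X -> trace_rate r Pr X [set: 'I_p]%SET = r.
Proof.
move=> hp r0 rd ri [Y [tau [[Ym _] [Yj t0] tu XY law]]].
have ex : exists i : 'I_p, i \in [set: 'I_p]%SET by exists (Ordinal (ltnW hp)); rewrite inE.
apply/funext => j; apply/funext => k.
rewrite (trace_rateE hp r0 ri Ym Yj t0 tu XY law ex) ?inE//.
rewrite (return_matrixE Ym t0 law) ?inE// big_pred0; last by move=> c; rewrite inE.
have [->|_] := eqVneq j k; first by rewrite mul0r rd.
by rewrite mul1r addr0 mxE mulrC divfK// gt_eqF// holding_rate_gt0.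
Qed.

(** * Martingale problems *)

Lemma bounded_convergence {d : measure_display} {T : measurableType d} {R : realType}
  (mu : {measure set T -> \bar R}) (D : set T) (f_ : nat -> T -> R) (f : T -> R) (M : R) :
  measurable D -> (mu D < +oo)%E -> (forall n, measurable_fun D (f_ n)) ->
  (forall x, D x -> f_ n x @[n --> \oo] --> f x) ->
  (forall n x, D x -> `|f_ n x| <= M) ->
  mu.-integrable D (EFin \o f) /\
  (\int[mu]_(x in D) (f_ n x)%:E @[n --> \oo] --> \int[mu]_(x in D) (f x)%:E)%E.
Proof.
move=> mD Dfin mf fcv fM.
have mE n : measurable_fun D (EFin \o f_ n) by exact/measurable_EFinP.
have cvE x : D x -> (EFin \o f_ n) x @[n --> \oo] --> (EFin \o f) x.
  by move=> Dx; apply: cvg_EFin; [exact: nearW|exact: fcv].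
have iM : mu.-integrable D (EFin \o (fun=> M)).
  by apply: measurable_bounded_integrable => //; exact: bounded_cst.
have fME n x : D x -> (`|(EFin \o f_ n) x| <= (EFin \o (fun=> M)) x)%E.
  by move=> Dx; rewrite lee_fin; exact: fM.
have mEf : measurable_fun D (EFin \o f) by exact: (emeasurable_fun_cvg (fun n => EFin \o f_ n)).
by have [] := @dominated_convergence _ _ _ mu D mD (fun n => EFin \o f_ n) (EFin \o f)
  (EFin \o (fun=> M)) mE mEf (aeW _ cvE) iM (aeW _ (fun x n => @fME n x)).
Qed.

(** * Transfer of a martingale problem to the paths in a face *)

Section restriction.
Context {R : realType} {p : nat} (B : {set 'I_p}).
Local Notation S := [set: 'I_p]%SET.
Variables (hB : (1 < #|B|)%N) (hS : (1 < #|S|)%N).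
Local Notation pathsB := (path_space R hB).
Local Notation pathsS := (path_space R hS).

Lemma face_le_setT (x : 'rV[R]_p) : face B x -> face S x.
Proof. by move=> [sx _]; rewrite face_setTE. Qed.

Let include_subproof (w : pathsB) : sval w \in @trajectories R p S.
Proof.
by case: w => w /= /set_mem[cw w0 fw]; apply/mem_set; split => // t; exact: face_le_setT.
Qed.

Definition include (w : pathsB) : pathsS := exist _ (sval w) (include_subproof w).

Lemma path_cont (C : {set 'I_p}) (hC : (1 < #|C|)%N) (w : path_space R hC) : continuous (sval w).
Proof. by case: w => w /= /set_mem[]. Qed.

Lemma path_face (C : {set 'I_p}) (hC : (1 < #|C|)%N) (w : path_space R hC) t : face C (sval w t).
Proof. by case: w => w /= /set_mem[]. Qed.

Lemma path_neg (C : {set 'I_p}) (hC : (1 < #|C|)%N) (w : path_space R hC) t :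
  t <= 0 -> sval w t = sval w 0.
Proof. by case: w => w /= /set_mem[_ + _]; apply. Qed.

Let path_events_include (D : set R) :
  path_events (hB := hB) D = preimage_set_system setT include (path_events (hB := hS) D).
Proof.
apply/seteqP; split => A.
  move=> [t Dt [U oU ->]]; exists (path_at hS t @^-1` U); first by exists t => //; exists U.
  by rewrite setTI.
by move=> [_ [t Dt [U oU ->]] <-]; exists t => //; exists U => //; rewrite setTI.
Qed.

(** An arbitrary set of times covers both the whole sigma-algebra and the filtration. *)
Lemma sigma_include (D : set R) (A : set pathsB) : <<s path_events (hB := hB) D >> A <->
  exists2 A' : set pathsS, <<s path_events (hB := hS) D >> A' & A = include @^-1` A'.
Proof.
rewrite path_events_include (@g_sigma_preimageE (path_type R hB) (path_type R hS)); split.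
  by move=> [A' mA' <-]; exists A' => //; rewrite setTI.
by move=> [A' mA' ->]; exists A' => //; rewrite setTI.
Qed.

Lemma measurable_include (A : set pathsS) : measurable A -> measurable (include @^-1` A).
Proof. by move=> mA; apply/sigma_include; exists A. Qed.

Lemma measurable_fun_include : measurable_fun [set: pathsB] include.
Proof. by move=> _ A mA; rewrite setTI; exact: measurable_include. Qed.

Lemma filtration_measurable (C : {set 'I_p}) (hC : (1 < #|C|)%N) (t : R)
  (A : set (path_space R hC)) : natural_filtration R hC t A -> measurable A.
Proof.
apply: sub_sigma_algebra2 => {A} A [s st [U oU ->]]; exists s => //; last by exists U.
by move: st; rewrite /= !in_itv/= => /andP[->].
Qed.

(** By continuity, a path that is in the closed face at rational times stays in it; this countable
    description makes the image measurable. Negative rationals are sent to 0, since the events only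
    concern nonnegative times. *)
Let image_include : inclusion_image (hC := hS) [set: pathsB] =
  \bigcap_(q : rat) (path_at hS (Num.max 0 (ratr q)) @^-1` face B).
Proof.
apply/seteqP; split => w.
  by move=> [w' _ ww'] q _; have := path_face w' (Num.max 0 (ratr q)); rewrite ww'.
move=> wB.
have cB : closed (face B : set 'rV[R]_p) by apply: compact_closed (@face_compact R p B).
have cl : closed (sval w @^-1` face B).
  by apply: closed_comp cB => t _; exact: path_cont.
have wf t : face B (sval w t).
  rewrite -[face B _]/((sval w @^-1` face B) t); apply: cl; move=> U.
  rewrite nbhsE => -[V [oV Vt] VU].
  have [u [Vu [q _ uq]]] := @dense_rat R V (ex_intro _ t Vt) oV.
  exists (ratr q); split; last by apply: VU; rewrite uq.
  have := wB q I; rewrite /= /path_at; case: (leP 0 (ratr q : R)) => // /ltW q0.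
  by rewrite (path_neg w q0).
have wt : sval w \in @trajectories R p B.
  by apply/mem_set; split => //; [exact: path_cont|exact: path_neg].
by exists (exist _ (sval w) wt).
Qed.

Let path_at_meas (t : R) (A : set 'rV[R]_p) : 0 <= t -> closed A ->
  measurable (path_at hS t @^-1` A : set pathsS).
Proof.
move=> t0 cA; rewrite -[A]setCK preimage_setC; apply: measurableC.
apply: sub_sigma_algebra; exists t; first by rewrite /= in_itv/= t0.
by exists (~` A) => //; exact: closed_openC.
Qed.

Let image_meas : measurable (inclusion_image (hC := hS) [set: pathsB]).
Proof.
rewrite image_include -[X in measurable X]setCK setC_bigcap; apply: measurableC.
apply: bigcupT_measurable_rat => q; apply: measurableC; apply: path_at_meas.
  by rewrite le_max lexx.
exact: compact_closed (@face_compact R p B).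
Qed.

Variables (PS : probability pathsS R) (PB : probability pathsB R).
Hypothesis restr : is_restriction PS PB.

(** The image of the inclusion has full measure for [PS] because [PB] has mass one. *)
Let pushforward_include (A : set pathsS) : measurable A -> PS A = PB (include @^-1` A).
Proof.
move=> mA; rewrite restr; last exact: measurable_include.
rewrite -(@probability_setIl _ _ _ PS (inclusion_image (hC := hS) [set: pathsB]) A)//.
  congr (PS _); apply/seteqP; split => w.
    move=> [[w' _ ww'] Aw]; exists w' => //; rewrite /= (_ : include w' = w)//.
    by apply/eq_sig_hprop => //= x; exact: Prop_irrelevance.
  move=> [w' /= Aw ww']; split; first by exists w'.
  rewrite (_ : w = include w')//.
  by apply/eq_sig_hprop => //= x; exact: Prop_irrelevance.
by rewrite -(restr measurableT) probability_setT.
Qed.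

Variables (F Gl : 'rV[R]_p -> R) (H G : nat -> 'rV[R]_p -> R) (M : R).
Hypothesis H_cvg : forall x, face B x -> H n x @[n --> \oo] --> F x.
Hypothesis G_cvg : forall x, face B x -> G n x @[n --> \oo] --> Gl x.
Hypothesis H_bd : forall n x, face B x -> `|H n x| <= M.
Hypothesis G_bd : forall n x, face B x -> `|G n x| <= M.
Hypothesis G_cont : forall n, {within face S, continuous (G n)}.

Let N_ n t (w : pathsS) : R := H n (path_at hS t w) -
  \int[lebesgue_measure]_(s in `[0, t]) G n (path_at hS s w).
Let N t (w : pathsB) : R := F (path_at hB t w) -
  \int[lebesgue_measure]_(s in `[0, t]) Gl (path_at hB s w).

Hypothesis N_mart : forall n, martingale PS (natural_filtration R hS) (N_ n).

Let itv_fin t : ((lebesgue_measure (`[0%R, t] : set R) : \bar R) < +oo)%E.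
Proof. by rewrite lebesgue_measure_itv/=; case: ifP => // _; rewrite -EFinB ltry. Qed.

Let G_path_meas n (w : pathsS) t : measurable_fun (`[0, t] : set R) (fun s => G n (sval w s)).
Proof.
apply: measurable_funTS; apply: continuous_measurable_fun => s.
have /subspace_continuousP cG := @G_cont n.
have := cG _ (path_face w s); move=> cGs; move=> Q /cGs hQ.
have {}hQ : nbhs (sval w s) (fun z => face S z -> Q (G n z)) := hQ.
have hu : \forall u \near s, face S (sval w u) -> Q (G n (sval w u)) := @path_cont S hS w s _ hQ.
suff : \forall u \near s, Q (G n (sval w u)) by [].
by apply: filterS hu => u; apply; exact: path_face.
Qed.

Let inner t (w : pathsB) : 0 <= t -> N_ n t (include w) @[n --> \oo] --> N t w.
Proof.
move=> t0; apply: cvgB; first exact: H_cvg (path_face w t).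
have [iG cvG] := bounded_convergence (mu := lebesgue_measure)
  (measurable_itv `[0, t]) (itv_fin t) (fun n => G_path_meas n (include w) (t := t))
  (fun s _ => G_cvg (path_face w s)) (fun n s _ => G_bd n (path_face w s)).
apply: fine_cvg; rewrite fineK; first exact: cvG.
exact: integrable_fin_num.
Qed.

Let N_bd n t (w : pathsB) : 0 <= t -> `|N_ n t (include w)| <= M + M * t.
Proof.
move=> t0; apply: le_trans (ler_normB _ _) _; apply: lerD; first exact: H_bd (path_face w t).
have iG : lebesgue_measure.-integrable (`[0, t] : set R) (EFin \o (fun s => G n (sval w s))).
  apply: measurable_bounded_integrable; [exact: measurable_itv|exact: itv_fin| |].
    exact: (G_path_meas n (include w)).
  exists M; split; first exact: num_real.
  move=> M' MM' s _; apply: le_trans (ltW MM'); exact: G_bd (path_face w s).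
apply: le_trans (le_normr_Rintegral _ iG) _ => //.
apply: (@le_trans _ _ (\int[lebesgue_measure]_(s in `[0, t]) M)).
  apply: le_Rintegral => //.
  - apply: (integrable_norm iG).
  - apply: (@measurable_bounded_integrable _ _ _ _ (fun=> M)) => //; first exact: itv_fin.
    exact: bounded_cst.
  - by move=> s _; exact: G_bd (path_face w s).
rewrite Rintegral_cst//.
have M0 : 0 <= M by apply: le_trans (H_bd 0 (path_face w t)).
have E : fine (lebesgue_measure (`[0, t] : set R)) = t.
  rewrite lebesgue_measure_itv/= lte_fin; case: ltP => [_|t_le]; first by rewrite -EFinB subr0.
  by apply/eqP; rewrite eq_le t0 t_le.
by apply: ler_wpM2l => //; rewrite -[leRHS]E.
Qed.

(** Adaptedness passes to pointwise limits, taken with respect to the sigma-algebra of the times up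
    to t. *)
Let N_meas t : 0 <= t ->
  measurable_fun [set: g_sigma_algebraType (path_events (hB := hB) `[0, t])] (N t).
Proof.
move=> t0; refine (@measurable_fun_cvg _ (g_sigma_algebraType (path_events (hB := hB) `[0, t])) R
  setT (fun n w => N_ n t (include w)) (N t) _ _).
  move=> n _ A mA; rewrite setTI; apply/sigma_include.
  have [adapt _ _] := N_mart n; exists (N_ n t @^-1` A) => //.
  exact: adapt.
by move=> w _; exact: inner.
Qed.

Let N__integral n t s (A : set pathsS) : 0 <= s <= t -> natural_filtration R hS s A ->
  (\int[PB]_(w in include @^-1` A) (N_ n t (include w))%:E =
   \int[PB]_(w in include @^-1` A) (N_ n s (include w))%:E)%E.
Proof.
move=> st FA; have mA := filtration_measurable FA.
have [adapt int eq] := N_mart n.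
have /andP[s0 st'] := st; have t0 := le_trans s0 st'.
have pf u : 0 <= u -> (\int[PB]_(w in include @^-1` A) (N_ n u (include w))%:E =
    \int[PS]_(w in A) (N_ n u w)%:E)%E.
  move=> u0.
  have mN : measurable_fun [set: pathsS] (EFin \o N_ n u).
    apply/measurable_EFinP => _ C mC; rewrite setTI.
    by apply: filtration_measurable (adapt u u0 C mC).
  have iN : PB.-integrable (include @^-1` A) ((EFin \o N_ n u) \o include).
    apply: (@measurable_bounded_integrable _ _ _ PB (fun w => N_ n u (include w))).
    - exact: measurable_include.
    - exact: le_lt_trans (probability_le1 _ (measurable_include mA)) (ltry 1).
    - apply: measurable_funTS; apply/measurable_EFinP.
      exact: (measurableT_comp mN measurable_fun_include).
    - exists (M + M * u); split; first exact: num_real.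
      by move=> M' MM' w _; apply: le_trans (ltW MM'); exact: N_bd.
  rewrite -(@integral_pushforward _ _ _ _ _ include measurable_fun_include PB A _ mN iN mA).
  apply: eq_measure_integral; first exact: measurable_fun_include.
  by move=> ? C mC _; exact/esym/pushforward_include.
exact: etrans (pf t t0) (etrans (eq s t st A FA) (esym (pf s s0))).
Qed.

Lemma restriction_martingale : martingale PB (natural_filtration R hB) N.
Proof.
have mN t : 0 <= t -> measurable_fun [set: pathsB] (N t).
  move=> t0 _ A mA; rewrite setTI.
  have := N_meas t0 measurableT mA; rewrite setTI; exact: filtration_measurable.
have mN_ n t : 0 <= t -> measurable_fun [set: pathsB] (fun w => N_ n t (include w)).
  move=> t0; apply: (measurableT_comp (f := N_ n t)) measurable_fun_include => _ A mA.
  by rewrite setTI; have [adapt _ _] := N_mart n; exact: filtration_measurable (adapt t t0 A mA).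
have bc t (A : set pathsB) : 0 <= t -> measurable A -> _ /\ _ := fun t0 mA =>
  @bounded_convergence _ _ _ PB A (fun n w => N_ n t (include w)) (N t) (M + M * t) mA
    (le_lt_trans (probability_le1 PB mA) (ltry 1))
    (fun n => measurable_funTS (mN_ n t t0)) (fun w _ => @inner t w t0) (fun n w _ => @N_bd n t w t0).
split.
- move=> t t0 A mA; have := N_meas t0 measurableT mA; by rewrite setTI.
- by move=> t t0; have [] := bc t setT t0 measurableT.
- move=> s t st A FA; have /andP[s0 st'] := st; have t0 := le_trans s0 st'.
  have mA := filtration_measurable FA.
  have [_ cvt] := bc t A t0 mA; have [_ cvs] := bc s A s0 mA.
  have [A' FA' AE] := (sigma_include _ _).1 FA.
  apply: (cvg_unique (@ereal_hausdorff R) cvt); apply: cvg_trans _ cvs; apply: near_eq_cvg; apply: nearW => n.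
  by rewrite AE; exact/esym/(N__integral n st FA').
Qed.

End restriction.

(** Makes the generator measurable along continuous paths, for the time integrals. *)
Lemma generator_continuous {R : realType} {p : nat} (b : R) (m : 'I_p -> R)
  (rB : 'I_p -> 'I_p -> R) (B : {set 'I_p}) (H : 'rV[R]_p -> R) : (0 < #|B|)%N ->
  domain m rB B H -> {within face B, continuous (generator b m rB B H)}.
Proof.
move=> B0 [[_ H2] HK]; apply/subspace_continuousP => x fx.
apply: cvgD; apply: cvgMr.
  by apply: cvg_bigsum => j jB; have /subspace_continuousP := HK j jB; exact.
apply: cvg_bigsum => j jB; apply: cvg_bigsum => k kB; apply: cvgMr.
have tV := tangent_basis (R := R) jB kB; have [_ ext] := H2 _ _ tV tV.
by have /subspace_continuousP := face_extension_continuous B0 ext; exact.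
Qed.

Theorem proposition2p8
  (R : realType) (p : nat) (hp : (2 <= p)%N)
  (r : 'I_p -> 'I_p -> R)
  (r_ge0 : forall i j, 0 <= r i j) (r_diag : forall i, r i i = 0)
  (r_irr : irreducible_rates r)
  (m : 'I_p -> R) (hm : stationary r m)
  (b : R) (hb : 1 <= b)
  (d : measure_display) (Omega : measurableType d)
  (Pr : 'I_p -> probability Omega R) (X : R -> Omega -> 'I_p)
  (hX : markov_chain r Pr X)
  (x : 'rV[R]_p) (hx : simplex x)
  (hA : zero_set x != finset.set0)
  (hB : (1 < #|finset.setC (zero_set x)|)%N)
  (Px : probability (path_space R (card_full hp)) R)
  (Px_sol :
    let rS := trace_rate r Pr X finset.setT in
    solves_martingale_problem (generator b m rS finset.setT)
      (domain m rS finset.setT) Px)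
  (Px_start : Px [set w | path_at (card_full hp) 0 w = x] = 1%E)
  (PB : probability (path_space R hB) R)
  (hPB : is_restriction Px PB) :
  let B := finset.setC (zero_set x) in
  let rB := trace_rate r Pr X B in
  solves_martingale_problem (generator b m rB B) (domain m rB B) PB.
Proof.
move=> B rB F FD.
have [Y [tau [[Ym _] [Yj t0] tu XY law]]] := hX.
(* For B = S the trace is the chain itself, so the assumption on [Px] concerns the rates r. *)
have rS : trace_rate r Pr X [set: 'I_p]%SET = r by exact: trace_rate_full.
have [i0 i0B] : exists i, i \in B by apply/card_gt0P; exact: ltnW hB.
have ex : exists i, i \in B by exists i0.
pose P := jump_matrix r; pose q := return_matrix Pr Y B.
have P_sum := jump_matrix_sum r_ge0 r_irr hp.
have r_lam i j : r i j = holding_rate r i * P i j.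
  by rewrite mxE mulrC divfK// gt_eqF// holding_rate_gt0.
have [_ _ m_stat] := hm.
have q_ge0 : forall l k, 0 <= q l k := return_matrix_ge0 Pr Y B.
have q_out l k : k \notin B -> q l k = 0 := @return_matrix_out _ _ _ _ Pr Y B l k.
have q_sum := return_matrix_sum hp r_ge0 r_irr Ym t0 law ex.
have qE l k kB := @return_matrixE _ _ _ _ r Pr Y tau Ym t0 law B l k kB.
have rB_q j k jB kB := @trace_rateE _ _ _ _ r Pr X Y tau hp r_ge0 r_irr Ym Yj t0 tu XY law
  B ex j k jB kB.
have [w [C bar]] := barrier_exists r_ge0 r_diag r_irr hm hp.
have [e0 e0_ok] := @small_scale_exists R p C (ltnW hp) (le_trans ler01 (barrier_C_ge1 bar)).
have [H [M [HD Hlim]]] := domain_approximation i0B b bar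
  (hitting_matrix_ge0 B q_ge0) (hitting_matrix_out q_out) (hitting_matrix_sum B q_sum)
  (hitting_matrix_id q) (stationary_gt0 r_ge0 r_irr hm hp) (holding_rate_gt0 r_ge0 r_irr hp)
  r_lam (hitting_matrix_kill q_out qE) (hitting_matrix_drift q_out q_sum qE rB_q)
  (hitting_matrix_dirichlet P_sum r_lam m_stat q_out q_sum qE rB_q) FD e0_ok.
apply: (restriction_martingale hPB (H := H)
  (G := fun n => generator b m r [set: 'I_p]%SET (H n)) (M := M)).
- by move=> z /Hlim[].
- by move=> z /Hlim[].
- by move=> n z /Hlim[].
- by move=> n z /Hlim[].
- move=> n; apply: generator_continuous => //.
  exact: ltnW (card_full hp).
- by move=> n; rewrite -rS in HD *; exact: Px_sol.
Qed.
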